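(* Let $\alpha,\gamma,\beta\in(0,1]$ and $b\ge0$, and let $$M^{\alpha}_{\gamma,\beta}(t)=M(D_\gamma(Y_\beta(t)))+b\,D_\alpha(Y_\beta(t)),\qquad t>0,$$ where $\{M(t)\}$ is a generalized counting process with positive rates $\lambda_1,\dots,\lambda_k$, $\Lambda=\lambda_1+\cdots+\lambda_k$, $D_\gamma$ and $D_\alpha$ are stable subordinators, $Y_\beta$ is an inverse stable subordinator, and all component processes are independent of each other. The probability law of $\{M^{\alpha}_{\gamma,\beta}(t)\}_{t>0}$ is $$\Pr\{M^\alpha_{\gamma,\beta}(t)\in \mathrm{d}x\}=\sum_{n=0}^{\infty}\sum_{\Omega(k,n)}\Big(\prod_{j=1}^k\frac{\lambda_j^{x_j}}{x_j!}\Big)(-\partial_\Lambda)^{z_k}\int_0^\infty e^{-s\Lambda^\gamma}g_\alpha(x-n,b^\alpha s)\,h_\beta(s,t)\,\mathrm{d}s\,\mathrm{d}x,$$ where $z_k=x_1+\cdots+x_k$, and it solves $$\bigg(\frac{\mathrm{d}^\beta}{\mathrm{d}t^\beta}+b^\alpha D_x^\alpha+\Big(\sum_{j=1}^k\lambda_j(I-T^j)\Big)^\gamma\bigg)w(x,t)=0,\qquad x\ge0,$$ with $w(x,0)=\delta(x)$. Here $(I-T)^\gamma=\sum_{r=0}^\infty(-1)^r\binom{\gamma}{r}T^r$, where $T^r=e^{-r\partial_x}$ if $b>0$ and $T^r=B^r$ if $b=0$, with $B$ the backward shift operator; $D_x^\alpha$ is the Riemann-Liouville fractional derivative and $\frac{\mathrm{d}^\beta}{\mathrm{d}t^\beta}$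 the Caputo fractional derivative.
   Context: Generalized counting process (GCP): for $k\ge1$ and $\lambda_1,\dots,\lambda_k>0$, it is the non-negative integer valued Lévy process $\{M(t)\}_{t\ge0}$, $M(0)=0$, with $\Pr\{M(t+h)=n+j\mid M(t)=n\}=1-\Lambda h+o(h)$ for $j=0$, $=\lambda_jh+o(h)$ for $1\le j\le k$, $=o(h)$ for $j\ge k+1$, where $\Lambda=\sum_{j=1}^k\lambda_j$. Equivalently $\mathbb{E}(u^{M(t)})=\exp(-t\sum_{j=1}^k\lambda_j(1-u^j))$ for $|u|\le1$. Stable subordinator $\{D_\alpha(t)\}$, $0<\alpha<1$: non-decreasing Lévy process with $\mathbb{E}(e^{-sD_\alpha(t)})=e^{-ts^\alpha}$, $s>0$; $D_1(t)=t$. Inverse stable subordinator: $Y_\beta(t)=\inf\{x>0:D_\beta(x)>t\}$ for a stable subordinator $D_\beta$; $Y_1(t)=t$. $g_\alpha(\cdot,t)$ and $h_\beta(\cdot,t)$ denote the densities of $D_\alpha(t)$ and $Y_\beta(t)$ (in degenerate cases, such as $\alpha=1$, $\beta=1$, or $b=0$ where $g_\alpha(\cdot,0)=\delta$, these are Dirac deltas); $g_\alpha(x,\cdot)=0$ for $x<0$. $\Omega(k,n)=\{(x_1,\dots,x_k)\in\mathbb{N}_0^k:\sum_{j=1}^kjx_j=n\}$, $\mathbb{N}_0$ the non-negative integers. The operator $\partial_\Lambda$ is differentiation with respect to $\Lambda$, treated as a variable independent of the factors $\lambda_j^{x_j}$ (it acts only on $e^{-s\Lambda^\gamma}$), after which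 $\Lambda=\sum_j\lambda_j$. $\delta$ is the Dirac delta. The translation operator is $e^{y\partial_x}f(x)=f(x+y)$; so $T$ shifts $x$ by $-1$: $(Tf)(x)=f(x-1)$, likewise $(Bf)(x)=f(x-1)$, with functions extended by $0$ to negative arguments. The fractional power is given by the corresponding binomial expansion $$\Big(\sum_{j=1}^k\lambda_j(I-T^j)\Big)^\gamma=\Lambda^\gamma\sum_{r=0}^\infty(-1)^r\binom{\gamma}{r}\Big(\frac1\Lambda\sum_{j=1}^k\lambda_jT^j\Big)^r .$$ Riemann-Liouville derivative: for $0<\alpha<1$, $D_x^\alpha f(x)=\frac{1}{\Gamma(1-\alpha)}\frac{\mathrm{d}}{\mathrm{d}x}\int_0^x\frac{f(s)}{(x-s)^\alpha}\,\mathrm{d}s$, and $D_x^1f=f'$; its Laplace transform is $\eta^\alpha\tilde f(\eta)$. Caputo derivative: for $0<\beta<1$, $\frac{\mathrm{d}^\beta}{\mathrm{d}t^\beta}f(t)=\frac{1}{\Gamma(1-\beta)}\int_0^t(t-s)^{-\beta}f'(s)\,\mathrm{d}s$, and $f'(t)$ for $\beta=1$; its Laplace transform is $\mu^\beta\tilde f(\mu)-\mu^{\beta-1}f(0)$. ''The law solves the equation'' means that its (generalized) density $w(x,t)$ does; the equation is understood in the sense of generalized functions, i.e. through Laplace transforms in $x$ and $t$. *)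

(* Defs.v *)
From HB Require Import structures.
From mathcomp Require Import all_boot all_order all_algebra.
From mathcomp Require Import all_classical all_reals all_analysis.

Set Implicit Arguments.
Unset Strict Implicit.
Unset Printing Implicit Defensive.

Import Order.TTheory GRing.Theory Num.Theory.
Import numFieldNormedType.Exports.

Local Open Scope classical_set_scope.
Local Open Scope ring_scope.

Section processes.
Context {d : measure_display} {T : measurableType d} {R : realType}.
Variable P : probability T R.

(* Processes are indexed by R, but only their values at times t >= 0 are ever
   constrained or used. *)
Implicit Types X D : R -> T -> R.

(* Mutual independence of a finite family of classes of events. *)
Definition mutually_independent (I : finType) (F : I -> set (set T)) : Prop :=
  forall (J : {set I}) (A : I -> set T), (forall i, i \in J -> F i (A i)) ->
  P (\bigcap_(i in [set` J]) A i) = (\prod_(i in J) P (A i))%E.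

Definition sigma_of_variable (U : T -> R) : set (set T) :=
  preimage_set_system [set: T] U measurable.

Definition sigma_of_process X : set (set T) :=
  <<s \bigcup_(t in [set t : R | 0 <= t]) sigma_of_variable (X t) >>.

Definition independent_increments X : Prop :=
  forall (n : nat) (t : nat -> R), 0 <= t 0%N ->
    {homo t : i j / (i <= j)%N >-> i <= j} ->
    mutually_independent (fun i : 'I_n =>
      sigma_of_variable (fun omega => X (t i.+1) omega - X (t i) omega)).

Definition stationary_increments X : Prop :=
  forall t h : R, 0 <= t -> 0 <= h -> forall A : set R, measurable A ->
    P [set omega | A (X (t + h) omega - X t omega)] =
    P [set omega | A (X h omega)].

Definition cadlag (x : R -> R) : Prop :=
  (forall t, 0 <= t -> x s @[s --> t^'+] --> x t) /\
  (forall t, 0 < t -> cvg (x s @[s --> t^'-])).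

(* All paths, rather than almost all of them, are regular: this is what makes
   the time-changed processes below measurable on a space which is not assumed
   to be complete. *)
Record levy_process X : Prop := LevyProcess {
  levy_measurable : forall t, 0 <= t -> measurable_fun [set: T] (X t) ;
  levy_start : forall omega, X 0 omega = 0 ;
  levy_independent : independent_increments X ;
  levy_stationary : stationary_increments X ;
  levy_cadlag : forall omega, cadlag (fun t => X t omega)
}.

Definition total_rate (k : nat) (lambda : 'I_k -> R) : R :=
  \sum_(j < k) lambda j.

(* Pr{M(t + h) = n + j | M(t) = n} *)
Definition transition_probability (M : R -> T -> nat) (t h : R) (n j : nat) : R :=
  fine (P [set omega | M (t + h) omega = (n + j)%N /\ M t omega = n]) /
  fine (P [set omega | M t omega = n]).

(* The index j : 'I_k carries the rate lambda_(j + 1) of the jumps of size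
   j + 1; the conditional probabilities only make sense for reachable n. *)
Record generalized_counting_process (k : nat) (lambda : 'I_k -> R)
    (M : R -> T -> nat) : Prop := GeneralizedCountingProcess {
  gcp_levy : levy_process (fun t omega => (M t omega)%:R) ;
  gcp_no_jump : forall t n, 0 <= t -> P [set omega | M t omega = n] != 0%E ->
    (fun h : R => transition_probability M t h n 0 - (1 - total_rate lambda * h))
      =o_ (0^'+) (fun h : R => h) ;
  gcp_jump : forall t n (j : 'I_k), 0 <= t ->
    P [set omega | M t omega = n] != 0%E ->
    (fun h : R => transition_probability M t h n j.+1 - lambda j * h)
      =o_ (0^'+) (fun h : R => h) ;
  gcp_large_jump : forall t n j, (k < j)%N -> 0 <= t ->
    P [set omega | M t omega = n] != 0%E ->
    (fun h : R => transition_probability M t h n j) =o_ (0^'+) (fun h : R => h)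
}.

Definition stable_subordinator (alpha : R) D : Prop :=
  if alpha < 1 then
    [/\ levy_process D,
        forall omega s t, 0 <= s -> s <= t -> D s omega <= D t omega
      & forall t s : R, 0 <= t -> 0 < s ->
          (\int[P]_omega (expR (- s * D t omega))%:E =
           (expR (- t * s `^ alpha))%:E)%E]
  else forall t omega, 0 <= t -> D t omega = t.

Definition inverse_process D : R -> T -> R :=
  fun t omega => inf [set x : R | 0 < x /\ t < D x omega].

End processes.

Section operators.
Context {R : realType}.

Notation leb := (@lebesgue_measure R).

(* Generalized densities on [0, +oo[ are represented by set functions (in
   practice probability laws): nu stands for the f with nu A = \int_A f. *)
Implicit Types (nu : set R -> \bar R) (f : R -> R).

Definition laplace nu (eta : R) : \bar R :=
  (\int[nu]_(x in `[0%R, +oo[) (expR (- eta * x))%:E)%E.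

(* v is the Laplace transform at p > 0 of the function F on [0, +oo[, the
   integral being required to converge absolutely. *)
Definition has_laplace (F : R -> \bar R) (p v : R) : Prop :=
  leb.-integrable `[0, +oo[ (fun x => (expR (- p * x))%:E * F x)%E /\
  (\int[leb]_(x in `[0%R, +oo[) ((expR (- p * x))%:E * F x) = v%:E)%E.

Definition gamma_function (a : R) : R :=
  fine (\int[leb]_(x in `]0%R, +oo[) (x `^ (a - 1) * expR (- x))%:E)%E.

(* Riemann-Liouville derivative of nu, i.e. the generalized derivative of
     x |-> 1 / Gamma(1 - alpha) \int_0^x (x - s)^(- alpha) nu(ds),
   tested against x |-> e^(- eta x): by definition of the generalized
   derivative, the transform of F' is eta times the transform of F for F
   vanishing on the negative half-line. *)
Definition RL_integral (alpha : R) nu (x : R) : \bar R :=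
  (((gamma_function (1 - alpha))^-1)%:E *
   \int[nu]_(s in `[0%R, x[) ((x - s) `^ (- alpha))%:E)%E.

Definition laplace_RL_derivative (alpha : R) nu (eta : R) : \bar R :=
  if alpha < 1 then
    (eta%:E *
     \int[leb]_(x in `[0%R, +oo[)
       ((expR (- eta * x))%:E * RL_integral alpha nu x))%E
  else (eta%:E * laplace nu eta)%E.

(* Caputo derivative of a function f of t which need not be differentiable.
   With f' the generalized derivative, the convolution of f' with
   t^(- beta) / Gamma(1 - beta) is the generalized derivative of
     t |-> 1 / Gamma(1 - beta) \int_0^t (t - s)^(- beta) (f s - f 0) ds,
   which vanishes at t = 0. *)
Definition caputo_integral (beta : R) f (t : R) : \bar R :=
  if beta < 1 then
    (((gamma_function (1 - beta))^-1)%:E *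
     \int[leb]_(s in `[0%R, t[) ((t - s) `^ (- beta) * (f s - f 0))%:E)%E
  else (f t - f 0)%:E.

Definition has_laplace_caputo (beta : R) f (mu v : R) : Prop :=
  exists2 v0, has_laplace (caputo_integral beta f) mu v0 & v = mu * v0.

(* (T f)(x) = f (x - 1), with f extended by 0 to negative arguments. On
   generalized densities this covers both the translation e^(- d/dx) and the
   backward shift B, the latter acting on laws carried by the integers. *)
Definition shift nu : set R -> \bar R := pushforward nu (fun x : R => x + 1).

(* 1 / Lambda \sum_j lambda_j T^j *)
Definition mean_shift (k : nat) (lambda : 'I_k -> R) nu : set R -> \bar R :=
  fun A => (((total_rate lambda)^-1)%:E *
            \sum_(j < k) (lambda j)%:E * iter j.+1 shift nu A)%E.

Definition generalized_binomial (gamma : R) (r : nat) : R :=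
  (\prod_(i < r) (gamma - i%:R)) / r`!%:R.

(* Terms of the binomial expansion of (\sum_j lambda_j (I - T^j))^gamma nu,
   up to the factor Lambda^gamma, tested against x |-> e^(- eta x). *)
Definition fractional_shift_term (k : nat) (lambda : 'I_k -> R) (gamma : R)
    nu (eta : R) (r : nat) : R :=
  (-1) ^+ r * generalized_binomial gamma r *
  fine (laplace (iter r (mean_shift lambda) nu) eta).

Definition laplace_fractional_shift (k : nat) (lambda : 'I_k -> R) (gamma : R)
    nu (eta : R) : R :=
  total_rate lambda `^ gamma *
  limn (series (fractional_shift_term lambda gamma nu eta)).

(* The family (w t)_(t >= 0) of generalized densities in x solves
     (d^beta/dt^beta + b^alpha D_x^alpha
        + (\sum_j lambda_j (I - T^j))^gamma) w = 0:
   the double transform of the left-hand side, in x at eta and in t at mu,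
   vanishes for all eta, mu > 0. *)
Definition solves_equation (alpha beta gamma b : R) (k : nat)
    (lambda : 'I_k -> R) (w : R -> set R -> \bar R) : Prop :=
  forall eta mu : R, 0 < eta -> 0 < mu ->
  (forall t, 0 <= t ->
     cvgn (series (fractional_shift_term lambda gamma (w t) eta))) /\
  exists c r s : R,
    [/\ has_laplace_caputo beta (fun t => fine (laplace (w t) eta)) mu c,
        has_laplace (fun t => laplace_RL_derivative alpha (w t) eta) mu r,
        has_laplace
          (fun t => (laplace_fractional_shift lambda gamma (w t) eta)%:E) mu s
      & c + b `^ alpha * r + s = 0].

(* \int_0^oo e^(- s L^gamma) phi(s) h(ds), as a function of L *)
Definition exponential_mixture (gamma : R) (h : set R -> \bar R)
    (phi : R -> R) (L : R) : R :=
  fine (\int[h]_(s in `[0%R, +oo[) (expR (- s * L `^ gamma) * phi s)%:E)%E.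

(* Omega(k, n); bounding the entries by n loses nothing, as x_j <= j x_j. *)
Definition Omega (k n : nat) : {set {ffun 'I_k -> 'I_n.+1}} :=
  [set x : {ffun 'I_k -> 'I_n.+1} | (\sum_(j < k) j.+1 * x j == n)%N]%SET.

(* \sum_n \sum_(Omega(k, n)) (\prod_j lambda_j^(x_j) / x_j!)
     (- d/dLambda)^(z_k) \int_0^oo e^(- s Lambda^gamma) (phi n s) h(ds) *)
Definition law_series (k : nat) (lambda : 'I_k -> R) (gamma : R)
    (h : set R -> \bar R) (phi : nat -> R -> R) : \bar R :=
  (\sum_(0 <= n <oo) \sum_(x in Omega k n)
    let z := (\sum_(j < k) x j)%N in
    ((\prod_(j < k) (lambda j ^+ x j / (x j)`!%:R)) *
     ((-1) ^+ z *
      derive1n z (exponential_mixture gamma h (phi n)) (total_rate lambda)))%:E)%E.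

End operators.

Section time_changed_process.
Context {d : measure_display} {T : measurableType d} {R : realType}.

(* M(D_gamma(Y_beta(t))) + b D_alpha(Y_beta(t)) *)
Definition time_changed (b : R) (M : R -> T -> nat) (Dgamma Dalpha Y : R -> T -> R)
    : R -> T -> R :=
  fun t omega =>
    (M (Dgamma (Y t omega) omega) omega)%:R + b * Dalpha (Y t omega) omega.

End time_changed_process.

(* Main.v *)
(** Conditioning on independent sigma-algebras ("freezing") reduces every
    statement to one about a single process. With [U = D_gamma(Y_beta t)],
    freezing everything but [M] and using
    [P (M u = n) = sum over Omega(k, n) of prod_j lambda_j^x_j / x_j! * u^z * exp (- Lambda u)]
    gives the law as a sum of expectations of
    [U^z exp (- Lambda U) phi_n(Y_beta t)], where [phi_n s] is the probability
    that [n + D_alpha(b^alpha s)] lies in the given set, because [b D_alpha(s)]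
    and [D_alpha(b^alpha s)] have the same law. Freezing [D_gamma] identifies
    the mixture [L |-> E (exp (- Y_beta t * L^gamma) phi_n(Y_beta t))] with
    [E (exp (- L U) phi_n(Y_beta t))], whose derivatives in [L] bring down the
    powers of [- U].

    For the equation, freezing gives [E exp (- eta X t) = E exp (- c Y_beta t)]
    with [c = S^gamma + b^alpha eta^alpha] and
    [S = sum_j lambda_j (1 - exp (- j eta))]. The transform in [t] of the right
    hand side is [v = mu^(beta - 1) / (mu^beta + c)]; the three operators act as
    [mu^beta v - mu^(beta - 1)], [eta^alpha v] and [S^gamma v], and the weighted
    sum is [0]. *)

Require Import Defs.
From HB Require Import structures.
From mathcomp Require Import all_boot all_order all_algebra.
From mathcomp Require Import all_classical all_reals all_analysis.
From mathcomp Require Import measurable_realfun.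
From mathcomp Require Import ring lra.

Set Implicit Arguments.
Unset Strict Implicit.
Unset Printing Implicit Defensive.

Import Order.TTheory GRing.Theory Num.Theory.
Import numFieldNormedType.Exports.

Local Open Scope classical_set_scope.
Local Open Scope ring_scope.

(** * Freezing independent sigma-algebras *)

(** The delicate point of freezing is measurability: a random time must be measurable for the
    sigma-algebra of the processes that supply it, and the process read at that time jointly
    measurable for its own sigma-algebra. Hence the work on generated sigma-algebras, and the use of
    right continuity of every path.

    The law of [M] is not given but has to be extracted from first-order asymptotics. Independent
    stationary increments make the Laplace transform multiplicative in time, so its slope at [0]
    determines it; the point masses are then recovered by comparing power series on []0, 1]].

    The inverse process is handled through the sets of [x] with [D x <= t], whose Lebesgue measure
    is [Y t]. This gives joint measurability by Tonelli and, after exchanging integrals, the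
    transform in [t] without any density of [Y t]. Paths of [D] that stay bounded, or stay at [0]
    for a positive time, are excluded by exponential Markov bounds.

    Integrands are kept nonnegative wherever possible, so that Tonelli applies with no prior
    integrability; for the Caputo derivative this means working with [1 - f]. *)

Section pushforward_law.
Context {d d' : measure_display} {T : measurableType d} {S : measurableType d'}.
Context {R : realType}.

Definition to_mfun (X : T -> S) (mX : measurable_fun setT X) : {mfun T >-> S} :=
  HB.pack X (isMeasurableFun.Build _ _ _ _ X mX).

Definition law (P : probability T R) (X : T -> S) (mX : measurable_fun setT X) :
  probability S R := distribution P (to_mfun mX).

Lemma integral_law (P : probability T R) (X : T -> S) (mX : measurable_fun setT X)
    (f : S -> \bar R) : measurable_fun setT f -> (forall x, 0 <= f x)%E ->
  (\int[law P mX]_x f x = \int[P]_w f (X w))%E.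
Proof. by move=> mf f0; rewrite /law ge0_integral_distribution. Qed.

End pushforward_law.

Section freezing.
Context {d : measure_display} {T : measurableType d} {R : realType}.
Variable P : probability T R.
Local Open Scope ereal_scope.

Definition independent_classes (F G : set (set T)) :=
  forall A B, F A -> G B -> P (A `&` B) = P A * P B.

(** For fixed [A] in [F], the finite measures [B |-> P (B & A)] and [B |-> P A * P B] agree on the
    pi-system [G], which contains the whole space, hence on the sigma-algebra it generates. *)
Lemma independent_g_sigma_algebra (F G : set (set T)) :
  F `<=` measurable -> G `<=` measurable -> setI_closed G -> G setT ->
  independent_classes F G -> independent_classes F <<s G >>.
Proof.
move=> mF mG GI GT FG A B FA GB.
have mA := mF _ FA.
have mB : measurable B.
  by move: GB; apply: smallest_sub => //; exact: sigma_algebra_measurable.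
have PA0 : (0 <= fine (P A))%R by exact: fine_ge0.
pose r : {nonneg R} := NngNum PA0.
have PAE : (r%:num)%:E = P A by rewrite /= fineK// fin_num_measure.
rewrite setIC -[LHS]/(mrestr P mA B) -PAE -[RHS]/(mscale r P B).
apply: (g_sigma_algebra_measure_unique G mG (fun=> setT)) => //.
- by rewrite bigcup_const.
- move=> C GC; transitivity (P (A `&` C)); first by rewrite setIC.
  by rewrite FG// -PAE.
- by move=> _; rewrite /= /mrestr setTI ltey_eq fin_num_measure.
Qed.

Lemma g_sigma_algebra_sub_measurable (G : set (set T)) :
  G `<=` measurable -> <<s G >> `<=` @measurable _ T.
Proof. by move=> mG; apply: smallest_sub => //; exact: sigma_algebra_measurable. Qed.

Lemma measurable_id_g_sigma_algebraType (G : set (set T)) : G `<=` measurable ->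
  measurable_fun setT (id : T -> g_sigma_algebraType G).
Proof.
by move=> mG _ B mB; rewrite setTI; exact: g_sigma_algebra_sub_measurable mB.
Qed.

(** The freezing principle. Independence says that the diagonal map [w |-> (w, w)], into the product
    of the two generated sigma-algebras, has the product of the two restrictions of [P] as its law;
    Tonelli then separates the variables. *)
Lemma independent_integral (F G : set (set T))
    (f : g_sigma_algebraType F * g_sigma_algebraType G -> \bar R) :
  F `<=` measurable -> G `<=` measurable ->
  independent_classes <<s F >> <<s G >> ->
  measurable_fun setT f -> (forall x, 0 <= f x) ->
  \int[P]_w f (w, w) = \int[P]_w \int[P]_w' f (w', w).
Proof.
move=> mF mG FG mf f0.
have mIF := measurable_id_g_sigma_algebraType mF.
have mIG := measurable_id_g_sigma_algebraType mG.
have mD := measurable_fun_pair mIF mIG.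
rewrite -(integral_law P mD mf f0).
rewrite (eq_measure_integral (law P mIF \x law P mIG)); last first.
  by move=> A mA _; apply/esym; apply: product_measure_unique => //.
rewrite (fubini_tonelli2 f mf f0) integral_law.
- apply: eq_integral => w _; rewrite /fubini_G integral_law//.
  by apply: measurableT_comp mf _; exact: pair2_measurable.
- exact: measurable_fun_fubini_tonelli_G.
- by move=> x; apply: integral_ge0.
Qed.

Lemma mutually_independent_classes (I : finType) (F : I -> set (set T))
    (J : {set I}) (i : I) : i \notin J ->
  (forall j, F j `<=` measurable) -> (forall j, setI_closed (F j)) ->
  (forall j, F j setT) -> mutually_independent P F ->
  independent_classes (F i)
    <<s [set B | exists2 A : I -> set T, (forall j, F j (A j)) &
                 B = \bigcap_(j in [set` J]) A j] >>.
Proof.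
move=> iJ mF FI FT indF; apply: independent_g_sigma_algebra => //.
- move=> _ [A FA ->]; apply: fin_bigcap_measurable => [|j _]; last exact: mF.
  exact: finite_finset.
- move=> _ _ [A FA ->] [B FB ->]; exists (fun j => A j `&` B j).
    by move=> j; exact: FI.
  apply/seteqP; split=> w /=; first by move=> [Aw Bw] j Jj; split; [exact: Aw|exact: Bw].
  by move=> ABw; split=> j /ABw[].
- by exists (fun=> setT) => //; apply/seteqP; split.
move=> A _ FA [B FB ->].
(* The set [B i] is arbitrary and absent from the intersection over [J], since [i] is not in [J]; it
   can be replaced by [A]. *)
pose C j := if j == i then A else B j.
have CE j : j \in J -> C j = B j.
  by move=> jJ; rewrite /C; case: eqP => // ji; rewrite -ji jJ in iJ.
have -> : A `&` \bigcap_(j in [set` J]) B j = \bigcap_(j in [set` (i |: J)%SET]) C j.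
  apply/seteqP; split=> [w [Aw Bw] j /=|w Cw].
    by rewrite !inE /C; case: eqP => //= _; exact: Bw.
  split; first by have := Cw i; rewrite /C eqxx; apply; rewrite /= !inE eqxx.
  by move=> j Jj; rewrite -CE//; apply: Cw; rewrite /= !inE Jj orbT.
rewrite (indF (i |: J)%SET C); last first.
  by move=> j _; rewrite /C; case: eqP => [->|].
rewrite big_setU1//= {1}/C eqxx; congr (_ * _).
rewrite indF//; apply: eq_bigr => j jJ; by rewrite CE.
Qed.

End freezing.

(** * Joint measurability of right-continuous processes *)

Section right_continuous_process.
Context {d : measure_display} {S : measurableType d} {R : realType}.


(* Joint measurability: [Z] is a pointwise limit of its discretizations, which
   read [Z] at the next multiple of [1 / (m + 1)] to the right of [t]. *)
Lemma right_continuous_process_measurable (Z : R -> S -> R) :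
  (forall t, 0 <= t -> measurable_fun setT (Z t)) ->
  (forall w t, 0 <= t -> Z s w @[s --> t^'+] --> Z t w) ->
  measurable_fun [set: R * S] (fun x => Z (Num.max x.1 0) x.2).
Proof.
move=> mZ cZ.
pose q (m : nat) (t : R) : nat := Num.truncn (Num.max t 0 * m.+1%:R).
apply: (@measurable_fun_cvg _ (R * S)%type R setT
  (fun m x => Z ((q m x.1).+1%:R / m.+1%:R) x.2)).
- move=> m _ B mB; rewrite setTI.
  rewrite (_ : _ @^-1` _ = \bigcup_n
    ([set t | n%:R <= Num.max t 0 * m.+1%:R < n.+1%:R] `*`
      (Z (n.+1%:R / m.+1%:R) @^-1` B))); last first.
    apply/seteqP; split=> -[t w]/=.
      by exists (q m t) => //=; split=> //; apply: truncn_itv; rewrite mulr_ge0// le_max lexx orbT.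
    by move=> [n _ [/= /truncn_def]]; rewrite /q => ->.
  apply: bigcup_measurable => n _; apply: measurableX.
    have mf : measurable_fun [set: R] (fun t : R => Num.max t 0 * m.+1%:R).
      by apply: measurable_funM => //; exact: measurable_maxr.
    have := mf measurableT _ (measurable_itv `[n%:R, n.+1%:R[).
    by rewrite setTI; congr measurable; apply/seteqP; split=> t /=; rewrite in_itv.
  by rewrite -[X in measurable X]setTI; apply: mZ.
move=> [t w] _ /=.
have t0 : 0 <= Num.max t 0 by rewrite le_max lexx orbT.
(* The discretized times exceed [t] strictly, because the successor of the truncation is used; so
   convergence from the right applies along them. *)
move/cvg_at_rightP : (cZ w _ t0); apply.
have qP m := truncn_itv (mulr_ge0 t0 (ler0n R m.+1)).
split=> [m|].
  by rewrite ltr_pdivlMr//; have /andP[] := qP m.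
apply: (@squeeze_cvgr _ _ _ _ (fun=> Num.max t 0) (fun m => Num.max t 0 + m.+1%:R^-1)).
- apply: nearW => m; rewrite ler_pdivlMr// ltW; last by have /andP[] := qP m.
  by rewrite /= ler_pdivrMr// mulrDl mulVf// -natr1 lerD2r; have /andP[] := qP m.
- exact: cvg_cst.
- rewrite -[X in _ --> X]addr0; apply: cvgD; first exact: cvg_cst.
  exact: cvg_harmonic.
Qed.
End right_continuous_process.

(** * Derivatives of Laplace integrals *)

Section laplace_derivative.
Context {d : measure_display} {T : measurableType d} {R : realType}.
Variables (mu : {measure set T -> \bar R}) (U V : T -> R).
Hypotheses (mU : measurable_fun setT U) (mV : measurable_fun setT V).
Hypotheses (U0 : forall w, 0 <= U w) (V0 : forall w, 0 <= V w).
Variable L0 : R.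
Hypothesis intL0 : (\int[mu]_w (expR (- L0 * U w) * V w)%:E < +oo)%E.

Lemma expr_le_expR (x : R) n : 0 <= x -> x ^+ n <= n`!%:R * expR x.
Proof.
move=> x0; case: n => [|n].
  by rewrite expr0 fact0 mul1r (le_trans _ (expR_ge1Dx x))// lerDl.
rewrite mulrC -ler_pdivrMr ?ltr0n ?fact_gt0//.
by rewrite (le_trans _ (expR_ge1Dxn n x0))// lerDr.
Qed.

Let mexp L : measurable_fun setT (fun w => expR (- L * U w)).
Proof. by apply: measurableT_comp => //; exact: measurable_funM. Qed.

Let mf z L : measurable_fun setT (fun w => U w ^+ z * expR (- L * U w) * V w).
Proof.
apply: measurable_funM => //; apply: measurable_funM => //.
exact: measurable_funX.
Qed.

Let f_ge0 z L w : 0 <= U w ^+ z * expR (- L * U w) * V w.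
Proof. by rewrite !mulr_ge0// ?exprn_ge0// expR_ge0. Qed.

(** The margin [L - L0] pays for the moment: [U ^ z] is at most [z! / (L - L0) ^ z] times
    [exp ((L - L0) U)]. *)
Lemma laplace_moment_lty z L : L0 < L ->
  (\int[mu]_w (U w ^+ z * expR (- L * U w) * V w)%:E < +oo)%E.
Proof.
move=> L0L; have e0 : 0 < L - L0 by rewrite subr_gt0.
pose C : R := z`!%:R / (L - L0) ^+ z.
have C0 : 0 <= C by rewrite mulr_ge0// invr_ge0 exprn_ge0// ltW.
apply: (@le_lt_trans _ _ (\int[mu]_w (C%:E * (expR (- L0 * U w) * V w)%:E))%E).
  apply: ge0_le_integral => //.
  - by move=> w _; rewrite lee_fin.
  - exact/measurable_EFinP.
  - apply/measurable_EFinP; apply: measurable_funM => //.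
    exact: measurable_funM.
  move=> w _; rewrite -EFinM lee_fin mulrA ler_wpM2r// /C.
  rewrite mulrAC ler_pdivlMr ?exprn_gt0// mulrAC -exprMn.
  have -> : - L * U w = - L0 * U w - U w * (L - L0) by ring.
  rewrite expRD (mulrCA _ (expR _)) mulrC ler_wpM2r ?expR_ge0//.
  rewrite expRN ler_pdivrMr ?expR_gt0// expr_le_expR//.
  by rewrite mulr_ge0// ltW.
rewrite ge0_integralZl//; last first.
- by move=> w _; rewrite lee_fin mulr_ge0// expR_ge0.
- by apply/measurable_EFinP; exact: measurable_funM.
by rewrite lte_mul_pinfty.
Qed.

Let D z L w : R := (- U w) ^+ z * expR (- L * U w) * V w.

Let mD z L : measurable_fun setT (D z L).
Proof.
apply: measurable_funM => //; apply: measurable_funM => //.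
by apply: measurable_funX; exact: measurableT_comp.
Qed.

Let D_integrable z L : L0 < L -> mu.-integrable setT (EFin \o D z L).
Proof.
move=> L0L; apply/integrableP; split; first exact/measurable_EFinP.
rewrite (eq_integral (fun w => (U w ^+ z * expR (- L * U w) * V w)%:E)).
  exact: laplace_moment_lty.
move=> w _ /=; congr EFin; rewrite /D !normrM normrX normrN.
by rewrite !ger0_norm// ?expR_ge0.
Qed.

Let D_is_derive z (x : R) w : is_derive x 1 (fun L => D z L w) (D z.+1 x w).
Proof.
have h : is_derive x (1 : R) (fun L : R => - L * U w) (- U w).
  by apply: is_derive_eq; rewrite /GRing.scale/=; ring.
have h2 : is_derive x (1 : R) (fun L => expR (- L * U w)) (expR (- x * U w) * - U w).
  by apply: is_derive_eq; rewrite /GRing.scale/= mulrC.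
rewrite /D exprS; apply: is_derive_eq; rewrite /GRing.scale/=; ring.
Qed.

(** Induction on [z] by differentiation under the integral. [F] need only agree with the integral to
    the right of [L0], since derivatives are local. *)
Lemma derive1n_laplace (F : R -> R) :
    (forall L, L0 < L -> F L = fine (\int[mu]_w (expR (- L * U w) * V w)%:E)) ->
  forall z L, L0 < L -> (-1) ^+ z * derive1n z F L =
    fine (\int[mu]_w (U w ^+ z * expR (- L * U w) * V w)%:E).
Proof.
move=> FE z L L0L.
have -> : derive1n z F L = \int[mu]_w D z L w.
  elim: z L L0L => [|z IH] L L0L.
    rewrite /derive1n/= FE//; congr fine.
    by apply: eq_integral => w _; rewrite /D expr0 mul1r.
  rewrite derive1nS derive1E.
  rewrite (@near_eq_derive _ _ _ _ (fun L => \int[mu]_w D z L w)); last first.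
    near=> x; apply: IH; near: x; exact: lt_nbhsr.
  rewrite -derive1E.
  (* The absolute value of the next derivative decreases in [L], so on []u, L + 1[] it is dominated
     by its value at [u], integrable because [u] is still above [L0]. *)
  pose u := (L0 + L) / 2.
  have L0u : L0 < u by rewrite ltr_pdivlMr// mulr_natr mulr2n ltrD2l.
  have uL : u < L by rewrite ltr_pdivrMr// mulr_natr mulr2n ltrD2r.
  have := @differentiation_under_integral R d T mu (D z) setT measurableT L u (L + 1).
  rewrite /= in_itv/= uL ltrDl ltr01 => /(_ isT).
  have dD x y : partial1of2 (D z) x y = D z.+1 x y.
    by rewrite partial1of2E; exact: derive_val.
  have uI x : u < x < L + 1 -> L0 < x by move=> /andP[+ _]; exact: lt_trans.
  move=> /(_ _ _ (fun w => `|D z.+1 u w|)) -> //.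
  - by apply: eq_Rintegral => w _; rewrite dD.
  - by move=> x; rewrite in_itv/= => /uI; exact: D_integrable.
  - rewrite (_ : _ \o _ = (fun w => `|(EFin \o D z.+1 u) w|%E)); last first.
      by apply/funext => w /=.
    by apply: integrable_abse; exact: D_integrable.
  - move=> x y; rewrite in_itv/= => /andP[ux _] _; rewrite dD.
    rewrite /D !normrM ler_wpM2r// ler_wpM2l// !ger0_norm ?expR_ge0// ler_expR.
    by rewrite !mulNr lerN2 ler_wpM2r// ltW.
have -> : (-1) ^+ z * (\int[mu]_w D z L w) = \int[mu]_w ((-1) ^+ z * D z L w).
  by rewrite RintegralZl//; exact: D_integrable.
congr fine; apply: eq_integral => w _; congr EFin.
by rewrite /D (exprNn (U w)) !mulrA -expr2 sqrr_sign mul1r.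
Unshelve. all: by end_near. Qed.

End laplace_derivative.

(** * The binomial series for exponents in [[0, 1]] *)

Section binomial_series.
Context {R : realType}.
Implicit Types (g q : R).

Let a g (r : nat) : R := (-1) ^+ r * generalized_binomial g r.

Lemma generalized_binomialS g r :
  r.+1%:R * generalized_binomial g r.+1 = (g - r%:R) * generalized_binomial g r.
Proof.
rewrite /generalized_binomial big_ord_recr/= factS natrM invfM.
rewrite mulrCA mulrA mulrC; field.
by rewrite nat1r !pnatr_eq0 -lt0n fact_gt0.
Qed.

Let aS g r : r.+1%:R * a g r.+1 = (r%:R - g) * a g r.
Proof.
transitivity (- (-1) ^+ r * (r.+1%:R * generalized_binomial g r.+1)).
  by rewrite /a exprS; ring.
by rewrite generalized_binomialS /a; ring.
Qed.

Lemma generalized_binomial_le1 g r : 0 <= g <= 1 -> `|generalized_binomial g r| <= 1.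
Proof.
move=> /andP[g0 g1]; elim: r => [|r IH].
  by rewrite /generalized_binomial big_ord0 fact0 divr1 normr1.
rewrite -(@ler_pM2l _ r.+1%:R)// -[X in X * `|_|]ger0_norm// -normrM.
rewrite generalized_binomialS normrM mulr1 -[leRHS]mulr1 ler_pM//.
have : 0 <= r%:R :> R by [].
by rewrite -natr1 ler_norml; lra.
Qed.

(** Split [|x| ^ n] as [r ^ n * r ^ n] with [r = sqrt |x|]: one factor absorbs the linear growth of
    the coefficients, the other leaves a geometric series. This serves the series and its first two
    formal derivatives, as termwise differentiation requires. *)
Lemma is_cvg_pseries_le_natr (c : R^nat) x :
  (forall n, `|c n| <= n.+1%:R) -> `|x| < 1 -> cvgn (pseries c x).
Proof.
move=> cn x1; pose r := Num.sqrt `|x|.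
have r0 : 0 <= r by exact: sqrtr_ge0.
have r1 : r < 1 by rewrite -sqrtr1 ltr_sqrt.
have xE : `|x| = r * r by rewrite -expr2 sqr_sqrtr.
(* Each of the [n + 1] summands of [1 + r + ... + r ^ n] is at least [r ^ n]. *)
have nr n : n.+1%:R * r ^+ n <= (1 - r)^-1.
  rewrite -[leRHS]mul1r ler_pdivlMr ?subr_gt0//.
  rewrite (@le_trans _ _ (1 - r ^+ n.+1))//; last by rewrite gerBl exprn_ge0.
  have -> : 1 - r ^+ n.+1 = (\sum_(i < n.+1) r ^+ i) * (1 - r).
    by rewrite -opprB subrX1 -mulNr opprB mulrC.
  rewrite ler_wpM2r//; first by rewrite subr_ge0 ltW.
  rewrite mulr_natl -[X in _ *+ X]card_ord -sumr_const ler_sum// => i _.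
  by rewrite ler_wiXn2l// -1?ltnS// ltW.
apply: normed_cvg; rewrite /normed_series_of/=.
apply: (@series_le_cvg R _ (geometric (1 - r)^-1 r)) => //=.
- by move=> n; rewrite mulr_ge0// ?exprn_ge0// invr_ge0 subr_ge0 ltW.
- move=> n; rewrite normrM normrX xE exprMn mulrA.
  rewrite ler_wpM2r ?exprn_ge0// (le_trans _ (nr n))// ler_wpM2r ?exprn_ge0//.
- by apply: is_cvg_geometric_series; rewrite ger0_norm.
Qed.

Let a_le1 g r : 0 <= g <= 1 -> `|a g r| <= 1.
Proof. by move=> /generalized_binomial_le1; rewrite /a normrMsign; exact. Qed.

Let da_le1 g r : 0 <= g <= 1 -> `|pseries_diffs (a g) r| <= 1.
Proof.
move=> g01; have /andP[g0 g1] := g01; elim: r => [|r IH].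
  rewrite /pseries_diffs aS /a /generalized_binomial big_ord0 fact0 divr1 mulr1.
  by rewrite expr0 mulr1 sub0r normrN ger0_norm.
rewrite -(@ler_pM2l _ r.+1%:R)// -[X in X * `|_|]ger0_norm// -normrM.
rewrite /pseries_diffs aS mulrCA normrM mulr1 -[leRHS]mulr1 ler_pM//.
have : 0 <= r%:R :> R by [].
rewrite -natr1 ler_norml; lra.
Qed.

Let a_cvg g x : 0 <= g <= 1 -> `|x| < 1 -> cvgn (pseries (a g) x).
Proof.
move=> g01; apply: is_cvg_pseries_le_natr => n.
by rewrite (le_trans (a_le1 _ g01))// ler1n.
Qed.

Let da_cvg g x : 0 <= g <= 1 -> `|x| < 1 -> cvgn (pseries (pseries_diffs (a g)) x).
Proof.
move=> g01; apply: is_cvg_pseries_le_natr => n.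
by rewrite (le_trans (da_le1 _ g01))// ler1n.
Qed.

Let dda_cvg g x : 0 <= g <= 1 -> `|x| < 1 ->
  cvgn (pseries (pseries_diffs (pseries_diffs (a g))) x).
Proof.
move=> g01; apply: is_cvg_pseries_le_natr => n.
rewrite {1}/pseries_diffs normrM normr_nat -[leRHS]mulr1 ler_wpM2l//.
exact: da_le1.
Qed.

Let f g x : R := limn (pseries (a g) x).
Let df g x : R := limn (pseries (pseries_diffs (a g)) x).

Let f_derive g x : 0 <= g <= 1 -> `|x| < 1 -> is_derive x (1 : R) (f g) (df g x).
Proof.
move=> g01 x1; pose K := (`|x| + 1) / 2.
have K1 : `|K| < 1 by rewrite ger0_norm /K ?divr_ge0// ?addr_ge0//; lra.
have xK : `|x| < `|K| by rewrite [ltRHS]ger0_norm /K ?divr_ge0// ?addr_ge0//; lra.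
by apply: (@pseries_snd_diffs _ _ K) => //; [exact: a_cvg|exact: da_cvg|exact: dda_cvg].
Qed.

(** The recursion [(r + 1) a_(r+1) = (r - g) a_r] turns into this differential equation, already at
    the level of partial sums. *)
Let df_ode g x : 0 <= g <= 1 -> `|x| < 1 -> (1 - x) * df g x = - g * f g x.
Proof.
move=> g01 x1.
have h1 := pseries_diffs_equiv (da_cvg g01 x1).
have h2 := da_cvg g01 x1.
have h3 := a_cvg g01 x1.
suff : pseries (pseries_diffs (a g)) x \- (fun n => x * series (fun i => i%:R * a g i * x ^+ i.-1) n) @ \oo
    --> - g * f g x.
  move=> h; rewrite mulrBl mul1r; apply: (cvg_unique _ _ h) => //.
  by apply: cvgB => //; apply: cvgMr.
rewrite [X in X @ _ --> _](_ : _ = (fun n => - g * pseries (a g) x n)).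
  by apply: cvgMr.
apply/funext => n; rewrite /pseries/series/= !mulr_sumr -sumrB.
apply: eq_bigr => i _; rewrite /pseries_diffs aS.
by case: i => [|i] /=; rewrite ?exprS; ring.
Qed.

Lemma binomial_series g q : 0 <= g <= 1 -> 0 <= q < 1 ->
  series (fun r => (-1) ^+ r * generalized_binomial g r * q ^+ r) @ \oo --> (1 - q) `^ g.
Proof.
move=> g01 /andP[q0 q1].
have x1 x : x \in `[0, q] -> `|x| < 1.
  by rewrite in_itv/= => /andP[x0 xq]; rewrite ger0_norm// (le_lt_trans xq).
have fq : f g q = (1 - q) `^ g; last first.
  by rewrite -fq; apply: a_cvg => //; rewrite ger0_norm.
(* The quotient of the series by [(1 - x) ^ g]; the differential equation makes its derivative
   vanish, so it keeps its value [1] at the origin. *)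
pose h x := f g x * expR (- g * ln (1 - x)).
have hd x : x \in `[0, q] -> is_derive x (1 : R) h 0.
  move=> xq; have fd := f_derive g01 (x1 _ xq).
  have x1' : 0 < 1 - x by rewrite subr_gt0 (le_lt_trans (ler_norm _))// x1.
  have d1 : is_derive x (1 : R) (fun x => 1 - x) (-1).
    by apply: is_derive_eq; rewrite add0r mul1r.
  have d2 := is_derive1_ln x1'.
  have d3 : is_derive x (1 : R) (fun x => ln (1 - x)) (- (1 - x)^-1).
    by rewrite -mulrN1; exact: (@is_derive1_comp _ (@ln R) (fun x => 1 - x)).
  apply: is_derive_eq; rewrite /GRing.scale/=.
  have := df_ode g01 (x1 _ xq).
  move=> /(congr1 (fun z => z / (1 - x))); rewrite mulrAC divff ?gt_eqF// mul1r => ->.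
  by field; rewrite gt_eqF.
have h0 : h 0 = 1.
  rewrite /h subr0 ln1 mulr0 expR0 mulr1 /f.
  apply/cvg_lim => //; rewrite -cvg_shiftS/=.
  rewrite (_ : (fun n => _) = cst (1 : R)); first exact: cvg_cst.
  apply/funext => n; rewrite /pseries/series/= big_nat_recl// big1 ?addr0.
    by rewrite /a /generalized_binomial big_ord0 fact0 divr1 !expr0 !mulr1.
  by move=> i _; rewrite exprS mul0r mulr0.
have : h q = 1.
  rewrite -h0; move: q0; rewrite le_eqVlt => /predU1P[<-//|q0].
  have A (x : R) : x \in `]0, q[ -> is_derive x (1 : R) h (cst 0 x).
    by move=> xq; apply: hd; exact: subset_itv_oo_cc.
  have B : {within `[0, q], continuous h}.
    by apply: derivable_within_continuous => x xq; have [] := hd x xq.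
  by have [c _] := MVT q0 A B; rewrite mul0r => /subr0_eq.
rewrite /h /powR subr_eq0 gt_eqF// mulNr expRN => /(congr1 (fun z => z * expR (g * ln (1 - q)))).
by rewrite mulfVK ?mul1r// gt_eqF// expR_gt0.
Qed.

End binomial_series.

Section pushforward_measure.
Context {d d' : measure_display} {T : measurableType d} {S : measurableType d'}.
Context {R : realType}.

Definition pushforward_measure (m : {measure set T -> \bar R}) (X : T -> S)
  (mX : measurable_fun setT X) : {measure set S -> \bar R}.
Proof. by refine (pushforward m X : {measure set S -> \bar R}). Defined.

End pushforward_measure.

(** * Affine substitutions and integrals of exponentials *)

Section lebesgue_affine.
Context {R : realType}.
Local Notation mu := (@lebesgue_measure R).
Local Open Scope ereal_scope.

(** Lebesgue measure equals [c] times its image under [x |-> c x + t], because the two agree on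
    half-open intervals. *)
Lemma ge0_integral_lebesgue_affine (c t : R) (f : R -> \bar R) : (0 < c)%R ->
  measurable_fun [set: R] f -> (forall x, 0 <= f x) ->
  \int[mu]_x f x = c%:E * \int[mu]_x f (c * x + t)%R.
Proof.
move=> c0 mf f0.
pose phi : measurableTypeR R -> measurableTypeR R := fun x => (c * x + t)%R.
have mphi : measurable_fun [set: measurableTypeR R] phi.
  by apply: measurable_funD => //; exact: measurable_funM.
pose r : {nonneg R} := NngNum (ltW c0).
pose nu : {measure set (measurableTypeR R) -> \bar R} :=
  mscale r (pushforward_measure mu mphi).
rewrite (eq_measure_integral nu).
  rewrite ge0_integral_mscale//; congr (_ * _).
  rewrite ge0_integral_pushforward//.
move=> A mA _; apply: lebesgue_measure_unique => //= _ [[a b] _ <-].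
have -> : nu `]a, b]%classic =
    c%:E * mu `]((a - t) / c)%R, ((b - t) / c)%R]%classic.
  congr (_ * mu _); apply/seteqP; split=> x /=; rewrite /phi !in_itv/=;
    by rewrite ltr_pdivrMr// ler_pdivlMr// ltrBlDr lerBrDr mulrC.
rewrite !lebesgue_measure_itv/= !lte_fin ltr_pM2r ?invr_gt0// ltrD2r.
case: ifP => _; last by rewrite mule0.
by rewrite -EFinM; congr EFin; field; rewrite gt_eqF.
Qed.

End lebesgue_affine.

Section exponential_integrals.
Context {R : realType}.
Local Notation mu := (@lebesgue_measure R).
Local Open Scope ereal_scope.

Let F c (x : R) : R := (- (expR (- c * x) / c))%R.

Let dF (c x : R) : c != 0%R -> is_derive x (1 : R)%R (F c) (expR (- c * x)).
Proof.
move=> c0; have h : is_derive x (1 : R)%R (fun x : R => (- c * x)%R) (- c)%R.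
  by apply: is_derive_eq; rewrite /GRing.scale/= mulr1.
have h2 := @is_derive1_comp _ (@expR R) _ _ _ _ (is_derive_expR _) h.
by rewrite /F; apply: is_derive_eq; rewrite /GRing.scale/=; field.
Qed.

Let cF (c x : R) : c != 0%R -> {for x, continuous (F c)}.
Proof.
move=> /(dF x)[dFx _]; exact/differentiable_continuous/derivable1_diffP.
Qed.

Lemma integral_expR_itvcy (c a : R) : (0 < c)%R ->
  \int[mu]_(x in `[a, +oo[) (expR (- c * x))%:E = (expR (- c * a) / c)%:E.
Proof.
move=> c0; have cn0 : c != 0%R by rewrite gt_eqF.
rewrite (@ge0_continuous_FTC2y _ _ (F c) a 0%R).
- by rewrite sub0e -EFinN /F opprK.
- by move=> x _; exact: expR_ge0.
- apply: continuous_subspaceT => x; apply: continuous_comp.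
    exact: mulrl_continuous.
  exact: continuous_expR.
- rewrite -oppr0 -(mul0r c^-1)%R; apply: cvgN; apply: cvgMl.
  under eq_fun do rewrite mulNr.
  apply: (cvg_comp _ (fun x => expR (- x)) _ (@cvgr_expR R)).
  by apply: gt0_cvgMry => //; exact: cvg_id.
- by move=> x _; have [] := dF x cn0.
- exact/cvg_at_right_filter/cF.
- by move=> x _; rewrite derive1E; have [_ ->] := dF x cn0.
Qed.

Lemma integral_expR_itv0c (c a : R) : (0 < c)%R -> (0 <= a)%R ->
  \int[mu]_(x in `[0%R, a[) (expR (- c * x))%:E = ((1 - expR (- c * a)) / c)%:E.
Proof.
move=> c0 a0; have := integral_expR_itvcy 0 c0.
have -> : `[0%R, +oo[%classic = `[0%R, a[ `|` `[a, +oo[ :> set R.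
  apply/seteqP; split=> x /=; rewrite !in_itv/= !andbT.
    by move=> x0; case: ltP => //; [left|right]; rewrite ?x0.
  by move=> [/andP[]|/(le_trans a0)].
rewrite ge0_integral_setU//=.
  rewrite integral_expR_itvcy// mulr0 expR0.
  by move=> h; rewrite mulrBl EFinB -h addeK.
  by apply/measurable_EFinP; exact: measurableT_comp.
apply/disj_setPS => x []/=; rewrite !in_itv/= andbT => /andP[_ xa] ax.
  by move: (lt_le_trans xa ax); rewrite ltxx.
Qed.

End exponential_integrals.

Lemma powR_subr1 {R : realType} (x p : R) : 0 < x -> x `^ p = x `^ (p - 1) * x.
Proof.
move=> x0; rewrite powRB ?powRr1 ?(ltW x0)//; first by rewrite divfK ?gt_eqF.
by apply/implyP => _; rewrite gt_eqF.
Qed.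

(** * Convolution with powers and the Gamma function *)

Section gamma.
Context {R : realType}.
Local Notation mu := (@lebesgue_measure R).
Local Open Scope ereal_scope.

Lemma lebesgue_integral_itv_if (i : interval R) (f : R -> \bar R) :
  \int[mu]_(x in [set` i]) f x = \int[mu]_x (if x \in i then f x else 0).
Proof.
rewrite integral_mkcond; apply: eq_integral => x _; rewrite patchE.
by rewrite mem_setE.
Qed.

Lemma measurable_if_itv (i : interval R) (f : R -> \bar R) :
  measurable_fun setT f ->
  measurable_fun setT (fun x => if x \in i then f x else 0).
Proof.
move=> mf; rewrite (_ : (fun _ => _) = f \_ [set` i]).
  by apply/(measurable_restrictT _ (measurable_itv i)); exact: measurable_funTS.
by apply/funext => x; rewrite patchE mem_setE.
Qed.

Let K (a eta x : R) : R := (x `^ (- a) * expR (- eta * x))%R.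

Let mK a eta : measurable_fun setT (K a eta).
Proof.
apply: measurable_funM; first exact: measurable_powR.
by apply: measurableT_comp => //; exact: measurable_funM.
Qed.

Let K_ge0 a eta x : (0 <= K a eta x)%R.
Proof. by rewrite mulr_ge0// ?powR_ge0 ?expR_ge0. Qed.

Let mKE D a eta : measurable_fun D (fun x => (K a eta x)%:E).
Proof. by apply/measurable_EFinP; apply: measurable_funTS; apply: mK. Qed.

Lemma integral_powR_itv (a e : R) : (0 < a < 1)%R -> (0 < e < 1)%R ->
  \int[mu]_(x in `[e, 1%R]) (x `^ (- a))%:E <= ((1 - a)^-1)%:E.
Proof.
move=> /andP[a0 a1] /andP[e0 e1].
pose F (x : R) : R := ((1 - a)^-1 * x `^ (1 - a))%R.
have dF (x : R) : (0 < x)%R -> is_derive x (1 : R)%R F (x `^ (- a))%R.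
  move=> x0; have := is_derive1_powR (1 - a) x0 => h.
  rewrite /F; apply: is_derive_eq; rewrite /GRing.scale/=.
  rewrite mulrA mulVf ?mul1r; first by congr powR; ring.
  by rewrite subr_eq0 gt_eqF.
have cF (x : R) : (0 < x)%R -> {for x, continuous F}.
  by move=> /dF[dFx _]; exact/differentiable_continuous/derivable1_diffP.
rewrite (@continuous_FTC2 _ _ F)//.
- rewrite -EFinB lee_fin /F powR1 mulr1 gerBl mulr_ge0 ?powR_ge0//.
  by rewrite invr_ge0 subr_ge0 ltW.
- apply: derivable_within_continuous => x; rewrite in_itv/= => /andP[ex _].
  have x0 := lt_le_trans e0 ex.
  by have [] := is_derive1_powR (- a) x0.
- split; first by move=> x; rewrite in_itv/= => /andP[ex _]; have [] := dF x (lt_trans e0 ex).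
    by apply/cvg_at_right_filter/cF.
  by apply/cvg_at_left_filter/cF.
- move=> x; rewrite in_itv/= => /andP[ex _]; rewrite derive1E.
  by have [_ ->] := dF x (lt_trans e0 ex).
Qed.

(** Split at [1]. On []0, 1]] the exponential is at most [1], and [x ^ (- a)] is controlled
    uniformly on the compact intervals [B n] exhausting it; beyond [1] the power is at most [1] and
    the exponential is integrable. *)
Lemma integral_gamma_lty (a : R) : (0 < a < 1)%R ->
  \int[mu]_(x in `]0%R, +oo[) (K a 1 x)%:E < +oo.
Proof.
move=> a01.
have mKE1 D : measurable_fun D (fun x => (K a 1 x)%:E) := @mKE D a 1%R.
pose B n : set R := `[n.+2%:R^-1%R, 1%R]%classic.
have UB : `]0%R, 1%R]%classic = \bigcup_n B n.
  apply/seteqP; split=> [x /=|x [n _]]; rewrite /B/= in_itv/=.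
    move=> /andP[x0 x1]; exists (Num.truncn x^-1) => //; rewrite /B/= in_itv/= x1 andbT.
    rewrite -[leRHS]invrK lef_pV2 ?posrE ?invr_gt0// ltW//.
    by rewrite (lt_trans (truncnS_gt _))// ltr_nat.
  by move=> /andP[nx x1]; rewrite in_itv/= x1 (lt_le_trans _ nx).
have -> : `]0%R, +oo[%classic = `]0%R, 1%R] `|` `]1%R, +oo[ :> set R.
  apply/seteqP; split=> x /=; rewrite !in_itv/= !andbT.
    by move=> x0; case: (leP x 1%R) => x1; [left|right]; rewrite ?x0.
  by move=> [/andP[]|/(lt_trans ltr01)].
rewrite ge0_integral_setU//=; last first.
- apply/disj_setPS => x []/=; rewrite !in_itv/= andbT => /andP[_ xa] ax.
  by move: (le_lt_trans xa ax); rewrite ltxx.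
- by move=> x _; rewrite lee_fin.
- by apply/measurable_EFinP; apply: measurable_funTS; exact: mK.
apply: lte_add_pinfty.
  rewrite UB; apply: (@le_lt_trans _ _ ((1 - a)^-1)%:E); last exact: ltry.
  have h : \int[mu]_(x in B n) (K a 1 x)%:E @[n --> \oo] --> \int[mu]_(x in \bigcup_n B n) (K a 1 x)%:E.
    apply: ge0_nondecreasing_set_cvg_integral.
    - move=> n m nm; apply/subsetPset => x; rewrite /B/= !in_itv/= => /andP[nx ->].
      by rewrite andbT (le_trans _ nx)// lef_pV2 ?posrE// ler_nat.
    - by move=> n; exact: measurable_itv.
    - by move=> n; exact: mKE1.
    - by move=> n x _; rewrite lee_fin.
  rewrite -(cvg_lim _ h)//; apply: lime_le; first exact: cvgP h.
  apply: nearW => n; apply: (@le_trans _ _ (\int[mu]_(x in B n) (x `^ (- a))%:E)).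
    apply: ge0_le_integral.
    - exact: measurable_itv.
    - by move=> x _; rewrite lee_fin.
    - exact: mKE1.
    - by apply/measurable_EFinP; apply: measurable_funTS; exact: measurable_powR.
    - move=> x; rewrite /B/= in_itv/= => /andP[nx _]; rewrite lee_fin ler_piMr ?powR_ge0//.
      by rewrite expR_le1 mulN1r oppr_le0 (le_trans _ nx).
  by apply: integral_powR_itv => //; rewrite invr_gt0 ltr0n/= invf_lt1 ?ltr1n.
apply: (@le_lt_trans _ _ (\int[mu]_(x in `[1%R, +oo[) (expR (- 1 * x))%:E)).
  apply: (@le_trans _ _ (\int[mu]_(x in `]1%R, +oo[) (expR (- 1 * x))%:E)).
    apply: ge0_le_integral.
    - exact: measurable_itv.
    - by move=> x _; rewrite lee_fin.
    - exact: mKE1.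
    - by apply/measurable_EFinP; exact: measurableT_comp.
    - move=> x /=; rewrite in_itv/= andbT => x1; rewrite lee_fin ler_piMl ?expR_ge0//.
      rewrite powRN invf_le1 ?powR_gt0 ?(lt_trans _ x1)// -[leLHS](powRr0 x).
      by rewrite ler_powR ?ltW//; case/andP : a01.
  apply: ge0_subset_integral.
  - exact: measurable_itv.
  - exact: measurable_itv.
  - by apply/measurable_EFinP; exact: measurableT_comp.
  - by move=> x _; rewrite lee_fin expR_ge0.
  - by move=> x /=; rewrite !in_itv/= !andbT => /ltW.
by rewrite integral_expR_itvcy// ltry.
Qed.

Lemma gamma_functionE (a : R) : (0 < a < 1)%R ->
  \int[mu]_(x in `]0%R, +oo[) (K a 1 x)%:E = (gamma_function (1 - a))%:E.
Proof.
move=> a01; rewrite /gamma_function -(_ : \int[mu]_(x in `]0%R, +oo[) (K a 1 x)%:E =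
  \int[mu]_(x in `]0%R, +oo[) (x `^ (1 - a - 1) * expR (- x))%:E).
  rewrite fineK// ge0_fin_numE; first exact: integral_gamma_lty.
  by apply: integral_ge0 => x _; rewrite lee_fin.
by apply: eq_integral => x _; rewrite /K mulN1r; congr (_ `^ _ * _)%:E; ring.
Qed.

Lemma gamma_function_gt0 (a : R) : (0 < a < 1)%R -> (0 < gamma_function (1 - a))%R.
Proof.
move=> a01; rewrite -lte_fin -gamma_functionE//.
have mKE1 D : measurable_fun D (fun x => (K a 1 x)%:E) := @mKE D a 1%R.
apply: (@lt_le_trans _ _ (\int[mu]_(x in `]0%R, 1%R]) (expR (- 1))%:E)).
  rewrite integral_cst//= lebesgue_measure_itv/= lte_fin ltr01 sube0 mule1.
  by rewrite lte_fin expR_gt0.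
apply: (@le_trans _ _ (\int[mu]_(x in `]0%R, 1%R]) (K a 1 x)%:E)).
  apply: ge0_le_integral => //.
  - exact: mKE1.
  - move=> x /=; rewrite in_itv/= => /andP[x0 x1]; rewrite lee_fin.
    rewrite /K -[leLHS]mul1r ler_pM ?expR_ge0//.
      rewrite -[leLHS](powRr0 x) ger_powR ?x0 ?x1//= oppr_le0 ltW//.
      by case/andP : a01.
    by rewrite ler_expR mulN1r lerN2.
apply: ge0_subset_integral => //.
- exact: mKE1.
- by move=> x _; rewrite lee_fin.
- by move=> x /=; rewrite !in_itv/= andbT => /andP[].
Qed.

Lemma integral_gamma_scale (a eta : R) : (0 < a < 1)%R -> (0 < eta)%R ->
  \int[mu]_(x in `]0%R, +oo[) (x `^ (- a) * expR (- eta * x))%:E =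
  (gamma_function (1 - a) * eta `^ (a - 1))%:E.
Proof.
move=> a01 eta0.
pose f e x := if (x : R) \in `]0%R, +oo[ then (K a e x)%:E else 0.
have mf e : measurable_fun [set: R] (f e).
  by apply: measurable_if_itv; apply/measurable_EFinP; exact: mK.
have f0 e (x : R) : 0 <= f e x by rewrite /f; case: ifP => // _; rewrite lee_fin.
have etaV0 : (0 < eta^-1)%R by rewrite invr_gt0.
have fE x : (eta^-1)%:E * f eta (eta^-1 * x + 0)%R = (eta `^ (a - 1))%:E * f 1%R x.
  rewrite /f addr0 !in_itv/= !andbT pmulr_rgt0//.
  case: ifPn => x0; last by rewrite !mule0.
  rewrite -!EFinM; congr EFin.
  rewrite /K powRM ?ltW//.
  rewrite -[eta^-1%R in X in (_ * (X * _ * _))%R]powR_inv1 ?ltW// -powRrM mulN1r opprK.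
  have -> : (- eta * (eta^-1 * x) = -1 * x)%R by field; rewrite gt_eqF.
  have -> : (eta `^ (a - 1) = eta `^ a / eta)%R.
    by rewrite (powR_subr1 a eta0) mulfK// gt_eqF.
  by ring.
rewrite mulrC EFinM -gamma_functionE// !lebesgue_integral_itv_if -/(f 1%R) -/(f eta).
rewrite (ge0_integral_lebesgue_affine 0 etaV0 (mf eta) (f0 eta)).
have mg : measurable_fun [set: R] (fun x => f eta (eta^-1 * x + 0)%R).
  apply: measurableT_comp (mf eta) _.
  by apply: measurable_funD => //; exact: measurable_funM.
have etaV0' : 0 <= (eta^-1)%:E by rewrite lee_fin ltW.
have p0 : 0 <= (eta `^ (a - 1))%:E by rewrite lee_fin powR_ge0.
rewrite -(@ge0_integralZl _ _ _ mu setT measurableT _ mg _ (fun x _ => f0 eta _) etaV0').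
rewrite -(@ge0_integralZl _ _ _ mu setT measurableT _ (mf 1%R) _ (fun x _ => f0 1%R x) p0).
by apply: eq_integral => x _; exact: fE.
Qed.

End gamma.

Section laplace_convolution.
Context {d : measure_display} {S : measurableType d} {R : realType}.
Local Notation mu := (@lebesgue_measure R).
Local Open Scope ereal_scope.

(** Tonelli and the translation [x |-> x + sigma s] leave a Gamma integral, whose constant cancels
    the normalization. With [nu] Lebesgue measure it serves the Caputo derivative, where [phi] is a
    function of time; with [nu] a law and [phi = 1], the Riemann-Liouville derivative. *)
Lemma laplace_convolution (nu : {sigma_finite_measure set S -> \bar R})
    (sigma phi : S -> R) (a eta : R) :
  measurable_fun setT sigma -> measurable_fun setT phi ->
  (forall s, 0 <= phi s)%R -> (0 < a < 1)%R -> (0 < eta)%R ->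
  \int[mu]_(x in `[0%R, +oo[) ((expR (- eta * x))%:E *
     (((gamma_function (1 - a))^-1)%:E *
      \int[nu]_(s in sigma @^-1` `[0%R, x[) ((x - sigma s) `^ (- a) * phi s)%:E)) =
  (eta `^ (a - 1))%:E *
    \int[nu]_(s in sigma @^-1` `[0%R, +oo[) (expR (- eta * sigma s) * phi s)%:E.
Proof.
move=> msigma mphi phi0 a01 eta0.
pose G := gamma_function (1 - a).
have G0 : (0 < G)%R by exact: gamma_function_gt0.
pose h (x : R) (s : S) : R :=
  (G^-1 * (expR (- eta * x) * ((x - sigma s) `^ (- a) * phi s)))%R.
pose f (z : measurableTypeR R * S) : \bar R :=
  if (0 <= sigma z.2)%R && (sigma z.2 < z.1)%R then (h z.1 z.2)%:E else 0.
have h0 x s : (0 <= h x s)%R.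
  by rewrite /h !mulr_ge0 ?expR_ge0 ?powR_ge0// invr_ge0 ltW.
have f0 z : 0 <= f z by rewrite /f; case: ifP => // _; rewrite lee_fin.
have m1 : measurable_fun setT (fun z : measurableTypeR R * S => z.1 : R).
  exact: measurable_fst.
have m2 : measurable_fun setT (fun z : measurableTypeR R * S => sigma z.2).
  by apply: measurableT_comp => //; exact: measurable_snd.
have mf : measurable_fun setT f.
  apply: measurable_fun_ifT => //.
    by apply: measurable_and; [exact: measurable_fun_ler|exact: measurable_fun_ltr].
  apply/measurable_EFinP; apply: measurable_funM => //; apply: measurable_funM.
    by apply: measurableT_comp => //; exact: measurable_funM.
  apply: measurable_funM; last by apply: measurableT_comp => //; exact: measurable_snd.
  exact: (measurableT_comp (measurable_powR (- a)) (measurable_funB m1 m2)).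
have preE (i : interval R) (s : S) : (s \in sigma @^-1` [set` i]) = (sigma s \in i).
  by apply/idP/idP => [/set_mem|si]; [|apply/mem_set].
have mpatch (i : interval R) (g : S -> R) : measurable_fun setT g ->
    measurable_fun setT ((fun s => (g s)%:E) \_ (sigma @^-1` [set` i])).
  move=> mg; have := msigma measurableT _ (measurable_itv i); rewrite setTI => mD.
  apply/(measurable_restrictT _ mD).
  by apply: measurable_funTS; exact/measurable_EFinP.
have mpx x : measurable_fun setT (fun s => (x - sigma s) `^ (- a) * phi s)%R.
  apply: measurable_funM => //.
  exact: (measurableT_comp (measurable_powR (- a)) (measurable_funB _ msigma)).
transitivity (\int[mu]_x \int[nu]_s f (x, s)).
  rewrite lebesgue_integral_itv_if; apply: eq_integral => x _.
  case: ifPn => x0; last first.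
    rewrite integral0_eq// => s _; rewrite /f/=; case: ifP => // /andP[s0 sx].
    by rewrite in_itv/= andbT (le_trans s0 (ltW sx)) in x0.
  rewrite integral_mkcond -ge0_integralZl//; last 3 first.
  - exact: mpatch.
  - by move=> s _; rewrite patchE; case: ifP => // _; rewrite lee_fin mulr_ge0 ?powR_ge0.
  - by rewrite lee_fin invr_ge0 ltW.
  rewrite -ge0_integralZl//; last 2 first.
  - by apply: measurable_funeM; exact: mpatch.
  - move=> s _; rewrite patchE; case: ifP => // _; last by rewrite mule0.
    by rewrite -EFinM lee_fin !mulr_ge0 ?powR_ge0// invr_ge0 ltW.
  apply: eq_integral => s _; rewrite patchE preE in_itv/= /f/=.
  by case: ifP => // _; rewrite ?mule0// -!EFinM /h; congr EFin; ring.
rewrite (fubini_tonelli f mf f0).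
transitivity (\int[nu]_s ((eta `^ (a - 1))%:E *
    ((fun s => (expR (- eta * sigma s) * phi s)%:E) \_ (sigma @^-1` `[0%R, +oo[)) s)).
  apply: eq_integral => s _; rewrite patchE preE in_itv/= andbT.
  case: ifPn => s0; last first.
    by rewrite mule0 integral0_eq// => x _; rewrite /f/= (negbTE s0).
  have mfs : measurable_fun [set: R] (fun x => f (x, s)).
    by apply: measurableT_comp mf _; exact: pair2_measurable.
  (* Moving the origin to [sigma s] turns the condition [sigma s < x] into [0 < x] and splits off
     the factor [exp (- eta * sigma s)]. *)
  rewrite (@ge0_integral_lebesgue_affine _ 1%R (sigma s) (fun x => f (x, s)))//.
  rewrite mul1e.
  transitivity (\int[mu]_x ((G^-1 * (expR (- eta * sigma s) * phi s))%:E *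
      (if x \in `]0%R, +oo[ then (x `^ (- a) * expR (- eta * x))%:E else 0))).
    apply: eq_integral => x _; rewrite /f/= s0 mul1r ltrDr in_itv/= andbT.
    case: ifP => _; last by rewrite mule0.
    rewrite -EFinM /h addrK mulrDr expRD; congr EFin; ring.
  rewrite ge0_integralZl//.
  - rewrite -lebesgue_integral_itv_if integral_gamma_scale// -!EFinM; congr EFin.
    by rewrite -/G; field; rewrite gt_eqF.
  - apply: measurable_if_itv; apply/measurable_EFinP; apply: measurable_funM.
      exact: measurable_powR.
    by apply: measurableT_comp => //; exact: measurable_funM.
  - by move=> x _; case: ifP => // _; rewrite lee_fin mulr_ge0 ?powR_ge0 ?expR_ge0.
  - by rewrite lee_fin !mulr_ge0 ?expR_ge0// invr_ge0 ltW.
rewrite ge0_integralZl//; first by rewrite [in RHS]integral_mkcond.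
- apply: mpatch; apply: measurable_funM => //.
  by apply: measurableT_comp => //; exact: measurable_funM.
- by move=> s _; rewrite patchE; case: ifP => // _; rewrite lee_fin mulr_ge0 ?expR_ge0.
- by rewrite lee_fin powR_ge0.
Qed.

End laplace_convolution.

(** * Uniqueness of Laplace transforms *)

Section laplace_uniqueness.
Context {R : realType}.
Implicit Types (mu nu : probability R R).

(* As [n] grows, [f a n] tends to the indicator of [`]a, +oo[], and [f a n] is a
   linear combination of exponentials. *)
Let N (a : R) (n : nat) : nat := (Num.truncn (n.+1%:R * expR (a * n.+1%:R))).+1.
Let f (a : R) (n : nat) (x : R) : R := (1 - expR (- n.+1%:R * x)) ^+ N a n.

Let NP a n : n.+1%:R * expR (a * n.+1%:R) <= (N a n)%:R <= n.+1%:R * expR (a * n.+1%:R) + 1.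
Proof.
rewrite ltW ?truncnS_gt//= /N -natr1 lerD2r.
by have /andP[] := truncn_itv (mulr_ge0 (ler0n R n.+1) (expR_ge0 (a * n.+1%:R))).
Qed.

Let f_itv a n x : 0 <= x -> 0 <= f a n x <= 1.
Proof.
move=> x0; have e1 : expR (- n.+1%:R * x) <= 1.
  by rewrite expR_le1 mulNr oppr_le0 mulr_ge0.
by rewrite exprn_ge0 ?subr_ge0// exprn_ile1 ?subr_ge0// gerBl expR_ge0.
Qed.

Lemma bernoulli_expr (t : R) n : 0 <= t <= 1 -> 1 - t *+ n <= (1 - t) ^+ n.
Proof.
move=> /andP[t0 t1]; elim: n => [|n IH]; first by rewrite mulr0n subr0 expr0.
rewrite exprS (@le_trans _ _ ((1 - t) * (1 - t *+ n)))//.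
  rewrite mulrBl mul1r mulrBr mulr1 mulrS.
  have : 0 <= t * t *+ n by rewrite mulrn_wge0// mulr_ge0.
  by rewrite mulrnAr; lra.
by rewrite ler_wpM2l// subr_ge0.
Qed.

Lemma bernoulli_expr_inv (t : R) n : 0 <= t <= 1 -> (1 - t) ^+ n <= (1 + t *+ n)^-1.
Proof.
move=> /andP[t0 t1].
rewrite -[leRHS]mul1r ler_pdivlMr ?ltr_pwDl ?mulrn_wge0//.
have h : 1 + t *+ n <= (1 + t) ^+ n.
  elim: n => [|n IH]; first by rewrite mulr0n addr0 expr0.
  rewrite exprS (@le_trans _ _ ((1 + t) * (1 + t *+ n)))//.
    rewrite mulrDl mul1r mulrDr mulr1 mulrS.
    have : 0 <= t * (t *+ n) by rewrite mulr_ge0// mulrn_wge0.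
    lra.
  by rewrite ler_wpM2l// addr_ge0.
rewrite (@le_trans _ _ ((1 - t) ^+ n * (1 + t) ^+ n))//.
  by rewrite ler_wpM2l// exprn_ge0// subr_ge0.
by rewrite -exprMn exprn_ile1//; nra.
Qed.

(** With [e = exp (- (n + 1) x)], the product [N e] is about [(n + 1) exp ((n + 1) (a - x))]. For
    [x > a] it tends to [0], and [(1 - e) ^ N >= 1 - N e]; for [x <= a] it is at least [n + 1], and
    [(1 - e) ^ N <= 1 / (1 + N e)]. The prefactor [n + 1] in [N] settles the boundary case
    [x = a]. *)
Let f_cvg a x : 0 <= a -> 0 <= x -> f a n x @[n --> \oo] --> ((a < x)%R%:R : R).
Proof.
move=> a0 x0; case: ltP => ax.
  have d0 : 0 < x - a by rewrite subr_gt0.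
  (* The constant [4] is [2 * 2]: rounding up in [N] at most doubles the leading term, and
     [exp (- y) <= 2 / y ^ 2] is used at [y = (n + 1) (x - a)]. *)
  apply: (@squeeze_cvgr _ _ _ _ (fun n => 1 - 4 / (x - a) ^+ 2 * n.+1%:R^-1) (fun=> 1)).
  - apply: nearW => n; have /andP[_ ->] := @f_itv a n x x0; rewrite andbT.
    have e01 : 0 <= expR (- n.+1%:R * x) <= 1.
      by rewrite expR_ge0 expR_le1 mulNr oppr_le0 mulr_ge0.
    rewrite (le_trans _ (bernoulli_expr _ e01))// lerD2l lerN2.
    rewrite -(mulr_natl (expR _)).
    have /andP[_ NU] := NP a n.
    rewrite (le_trans (ler_wpM2r (expR_ge0 _) NU))//.
    have n1 : 1 <= n.+1%:R :> R by rewrite ler1n.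
    pose E := expR (- n.+1%:R * (x - a)).
    have h1 : expR (a * n.+1%:R) * expR (- n.+1%:R * x) = E.
      by rewrite -expRD; congr expR; ring.
    have h2 : expR (- n.+1%:R * x) <= E by rewrite ler_expR; nra.
    have h3 : E <= 2 / (n.+1%:R * (x - a)) ^+ 2.
      rewrite ler_pdivlMr ?exprn_gt0 ?mulr_gt0// mulrC /E mulNr expRN.
      rewrite ler_pdivrMr ?expR_gt0//.
      have := expR_ge1Dxn 1 (ltW (mulr_gt0 (ltr0Sn R n) d0)).
      have : 0 < 2 :> R by [].
      have -> : 2`!%:R = 2 :> R by [].
      by rewrite expr2; lra.
    apply: (@le_trans _ _ (2 * n.+1%:R * E)).
      rewrite mulrDl mul1r -(mulrA n.+1%:R) h1.
      by have := expR_ge0 (- n.+1%:R * (x - a)); rewrite -/E; nra.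
    apply: (@le_trans _ _ (2 * n.+1%:R * (2 / (n.+1%:R * (x - a)) ^+ 2))).
      by rewrite ler_wpM2l.
    by rewrite le_eqVlt; apply/orP; left; apply/eqP; field; rewrite gt_eqF//=; lra.
  - rewrite -[X in _ --> X](subr0 1); apply: cvgB; first exact: cvg_cst.
    rewrite -(mulr0 (4 / (x - a) ^+ 2)); apply: cvgMr; exact: cvg_harmonic.
  - exact: cvg_cst.
apply: (@squeeze_cvgr _ _ _ _ (fun=> 0) (fun n => n.+1%:R^-1)).
- apply: nearW => n; have /andP[-> _] := @f_itv a n x x0.
  have e01 : 0 <= expR (- n.+1%:R * x) <= 1.
    by rewrite expR_ge0 expR_le1 mulNr oppr_le0 mulr_ge0.
  rewrite (le_trans (bernoulli_expr_inv _ e01))//.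
  rewrite lef_pV2 ?posrE ?ltr_pwDl ?mulrn_wge0 ?expR_ge0//.
  rewrite -(mulr_natl (expR _)).
  have /andP[NL _] := NP a n.
  have := ler_wpM2r (expR_ge0 (- n.+1%:R * x)) NL.
  rewrite -mulrA -expRD => h.
  have h1 : 1 <= expR (a * n.+1%:R + - n.+1%:R * x).
    have e : a * n.+1%:R + - n.+1%:R * x = n.+1%:R * (a - x) by ring.
    by rewrite e -expR0 ler_expR mulr_ge0// subr_ge0.
  have := ler0n R n.+1; nra.
- exact: cvg_cst.
- exact: cvg_harmonic.
Qed.

Let D : set R := `[0, +oo[%classic.

Let mD : measurable D. Proof. exact: measurable_itv. Qed.

Let mexp s : measurable_fun D (fun x => expR (- s * x)).
Proof. by apply: measurableT_comp => //; exact: measurable_funM. Qed.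

Let integrable_exp mu s : 0 <= s -> mu.-integrable D (fun x => (expR (- s * x))%:E).
Proof.
move=> s0; apply: (@le_integrable _ _ _ _ _ mD _ (cst 1%E)).
- exact/measurable_EFinP.
- move=> x; rewrite /D/= in_itv/= andbT => x0.
  by rewrite ger0_norm ?expR_ge0// lee_fin normr1 expR_le1 mulNr oppr_le0 mulr_ge0.
- exact: finite_measure_integrable_cst.
Qed.

Let p a n : {poly R} := (1 - 'X) ^+ N a n.

Let fE a n x : f a n x =
  \sum_(i < size (p a n))
    (p a n)`_i * expR (- (i%:R * n.+1%:R) * x).
Proof.
transitivity ((p a n).[expR (- n.+1%:R * x)]).
  by rewrite /p horner_exp !hornerE.
rewrite horner_coef; apply: eq_bigr => i _; congr (_ * _).
by rewrite -expRM_natl; congr expR; ring.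
Qed.

Let integral_fE mu a n : (\int[mu]_(x in D) (f a n x)%:E =
  \sum_(i < size (p a n))
    ((p a n)`_i)%:E * laplace mu (i%:R * n.+1%:R))%E.
Proof.
under eq_integral do rewrite fE -sumEFin.
rewrite integral_sum//; last first.
  move=> i; under eq_fun do rewrite EFinM.
  by apply: integrableZl => //; apply: integrable_exp; exact: mulr_ge0.
apply: eq_bigr => i _; under eq_integral do rewrite EFinM.
by rewrite integralZl//; apply: integrable_exp; exact: mulr_ge0.
Qed.

Let laplace_itv mu a : 0 <= a -> mu `]a, +oo[%classic =
  limn (fun n => \int[mu]_(x in D) (f a n x)%:E)%E.
Proof.
move=> a0; apply/esym/cvg_lim => //.
rewrite (_ : mu _ = \int[mu]_(x in D) ((a < x)%R%:R%:E : \bar R))%E; last first.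
  rewrite (eq_integral (fun x => (\1_(`]a, +oo[%classic : set R) x)%:E)); last first.
    by move=> x _; rewrite indicE mem_setE in_itv/= andbT.
  rewrite integral_indic//; congr (mu _); apply/seteqP; split=> x /=.
    by rewrite /D/= !in_itv/= !andbT => ax; split => //; exact: ltW (le_lt_trans a0 ax).
  by case.
apply: (@dominated_cvg _ _ _ _ _ mD _ _ (cst 1%E)).
- move=> n; apply/measurable_EFinP; rewrite /f; apply: measurable_funX.
  by apply: measurable_funB => //; exact: mexp.
- by move=> x; rewrite /D/= in_itv/= andbT => x0; apply/cvg_EFin; [exact: nearW|exact: f_cvg].
- by [].
- exact: finite_measure_integrable_cst.
- move=> n x; rewrite /D/= in_itv/= andbT => /(@f_itv a n)/andP[f0 f1].
  by rewrite /= ger0_norm// lee_fin.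
Qed.

(** The integrals of the functions [f a n] are combinations of transform values and converge to the
    mass of []a, +oo[]; these rays form a generating pi-system. *)
Lemma laplace_unique mu nu :
  mu `[0, +oo[%classic = 1%E -> nu `[0, +oo[%classic = 1%E ->
  (forall s, 0 < s -> laplace mu s = laplace nu s) ->
  forall A, measurable A -> mu A = nu A.
Proof.
move=> mu1 nu1 munu.
(* The constant coefficient of the polynomial has frequency [0], so the transforms must agree there
   too; both equal the total mass [1]. *)
have munu0 s : 0 <= s -> laplace mu s = laplace nu s.
  rewrite le_eqVlt => /predU1P[<-|]; last exact: munu.
  rewrite /laplace; under eq_integral do rewrite oppr0 mul0r expR0.
  under [RHS]eq_integral do rewrite oppr0 mul0r expR0.
  by rewrite !integral_cst//= mu1 nu1.
have ray a : mu `]a, +oo[%classic = nu `]a, +oo[%classic.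
  case: (leP 0 a) => a0.
    rewrite !laplace_itv//; congr (limn _); apply/funext => n.
    rewrite !integral_fE; apply: eq_bigr => i _; congr (_ * _)%E.
    by apply: munu0; exact: mulr_ge0.
  have h (m : probability R R) : m D = 1%E -> m `]a, +oo[%classic = 1%E.
    move=> m1; apply/eqP; rewrite eq_le probability_le1//= -m1 le_measure ?inE//.
    by move=> x; rewrite /D/= !in_itv/= !andbT; exact: lt_le_trans.
  by rewrite !h.
apply: (measure_unique (@RGenOInfty.G R) (fun n : nat => `](- n%:R), +oo[%classic)).
- exact: RGenOInfty.measurableE.
- move=> _ _ [x ->] [y ->]; exists (Num.max x y).
  by apply/seteqP; split=> z /=; rewrite !in_itv/= !andbT gt_max => /andP.
- by move=> n; exists (- n%:R).
- apply/seteqP; split=> // x _; exists (Num.truncn `|x|).+1 => //=.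
  by rewrite in_itv/= andbT ltrNl (le_lt_trans (ler_norm _))// normrN truncnS_gt.
- by move=> _ [a ->]; exact: ray.
- by move=> n; rewrite (le_lt_trans (probability_le1 _ _))// ltry.
Qed.

End laplace_uniqueness.

(** * Products of independent variables and increments of Lévy processes *)

Section independent_variables.
Context {d : measure_display} {T : measurableType d} {R : realType}.
Variable P : probability T R.
Local Open Scope ereal_scope.

Lemma independent_variables_integralM (U V : T -> R) (f g : R -> \bar R) :
  measurable_fun setT U -> measurable_fun setT V ->
  independent_classes P (sigma_of_variable U) (sigma_of_variable V) ->
  measurable_fun setT f -> measurable_fun setT g ->
  (forall x, 0 <= f x) -> (forall x, 0 <= g x) ->
  \int[P]_w (f (U w) * g (V w)) = \int[P]_w f (U w) * \int[P]_w g (V w).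
Proof.
move=> mU mV UV mf mg f0 g0.
have mUV := measurable_fun_pair mU mV.
pose h (z : R * R) := f z.1 * g z.2.
have mh : measurable_fun [set: R * R] h.
  apply: emeasurable_funM; apply: measurableT_comp => //.
have h0 z : 0 <= h z by rewrite mule_ge0.
rewrite -[LHS]/(\int[P]_w h (U w, V w)) -(integral_law P mUV mh h0).
rewrite (eq_measure_integral (law P mU \x law P mV)); last first.
  move=> A mA _; apply/esym; apply: product_measure_unique => // B C mB mC.
  rewrite -[RHS]/(P (U @^-1` B) * P (V @^-1` C)) -UV//.
  - by exists B => //; rewrite setTI.
  - by exists C => //; rewrite setTI.
rewrite (fubini_tonelli2 h mh h0) -(integral_law P mU mf f0) -(integral_law P mV mg g0).
rewrite -ge0_integralZl//; last by apply: integral_ge0.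
apply: eq_integral => y _; rewrite /fubini_G/= muleC -ge0_integralZl//.
by apply: eq_integral => x _; rewrite muleC.
Qed.

Lemma eq_integral_law (U V : T -> R) (f : R -> \bar R) :
  measurable_fun setT U -> measurable_fun setT V ->
  (forall A : set R, measurable A -> P (U @^-1` A) = P (V @^-1` A)) ->
  measurable_fun setT f -> (forall x, 0 <= f x) ->
  \int[P]_w f (U w) = \int[P]_w f (V w).
Proof.
move=> mU mV UV mf f0; rewrite -(integral_law P mU mf f0) -(integral_law P mV mf f0).
by apply: eq_measure_integral => A mA _; exact: UV.
Qed.

(** A multiplicative [f] factors along [X (s + t) = X s + (X (s + t) - X s)]; the second increment
    is independent of the first and distributed as [X t]. *)
Lemma levy_process_integral_expM (X : R -> T -> R) (f : R -> R) (s t : R) :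
  levy_process P X -> (0 <= s)%R -> (0 <= t)%R ->
  measurable_fun setT f -> (forall x, 0 <= f x)%R ->
  (forall x y, f (x + y) = f x * f y)%R ->
  \int[P]_w (f (X (s + t)%R w))%:E =
  \int[P]_w (f (X s w))%:E * \int[P]_w (f (X t w))%:E.
Proof.
move=> levyX s0 t0 mf f0 fM; have [mX X0 indX statX _] := levyX.
have st0 : (0 <= s + t)%R by exact: addr_ge0.
have mI : measurable_fun setT (fun w => X (s + t)%R w - X s w)%R.
  by apply: measurable_funB; exact: mX.
transitivity (\int[P]_w ((f (X s w))%:E * (f (X (s + t)%R w - X s w)%R)%:E)).
  by apply: eq_integral => w _; rewrite -EFinM -fM (addrC (X s w)) subrK.
rewrite (@independent_variables_integralM _ _ (EFin \o f) (EFin \o f) (mX s s0) mI);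
  first congr (_ * _).
- apply: (@eq_integral_law _ _ (EFin \o f)) => //.
  + exact: mX.
  + by move=> A mA; exact: statX.
  + exact/measurable_EFinP.
- pose tau (i : nat) : R := if i == 0%N then 0%R else if i == 1%N then s else (s + t)%R.
  (* The times are [0], [s], [s + t]; starting at [0] makes the first increment equal to [X s]. *)
  have tau_homo : {homo tau : i j / (i <= j)%N >-> (i <= j)%R}.
    by move=> [|[|i]] [|[|j]] // _; rewrite /tau//= lerDl.
  have ind := indX 2%N tau (lexx _) tau_homo.
  move=> A B FA FB.
  pose C (i : 'I_2) := if i == ord0 then A else B.
  have := ind [set: 'I_2]%SET C.
  rewrite (eq_bigl xpredT); last by move=> i; rewrite inE.
  rewrite !big_ord_recl big_ord0 mule1 {1 2}/C/= => <-.
    congr (P _); apply/seteqP; split=> w /=.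
      by move=> [Aw Bw] i _; rewrite /C; case: ifP.
    by move=> h; split; [apply: (h ord0)|apply: (h (lift ord0 ord0))]; rewrite /= inE.
  move=> i _; rewrite /C; case: eqP => [->|i0].
    by case: FA => D mD <-; exists D => //; rewrite /tau/=; congr (_ `&` _); apply/seteqP; split=> w /=; rewrite X0 subr0.
  have -> : i = lift ord0 ord0 :> 'I_2 by apply/val_inj => /=; case: i i0 => -[|[|]]//= h h0; exfalso; apply: h0; exact: val_inj.
  by [].
- exact/measurable_EFinP.
- exact/measurable_EFinP.
- by move=> x; rewrite lee_fin.
- by move=> x; rewrite lee_fin.
Qed.

End independent_variables.

(** * Truncation bounds for generating functions *)

Section probability_generating_function.
Context {d : measure_display} {T : measurableType d} {R : realType}.
Variables (P : probability T R) (N : T -> nat).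
Hypothesis mN : forall j, measurable [set w | N w = j].

Lemma measurable_fun_nat : measurable_fun setT N.
Proof.
move=> _ B _; rewrite setTI (_ : _ @^-1` _ = \bigcup_(j in B) [set w | N w = j]).
  by apply: bigcup_measurable => j _; exact: mN.
by apply/seteqP; split=> w /= => [Bw|[j Bj ->]//]; exists (N w).
Qed.

Let p j : R := fine (P [set w | N w = j]).

Let step (a : nat -> R) n c w : R := \sum_(j < n) a j * \1_[set w | N w = j] w + c.

Let stepE a n c w : step a n c w = (if (N w < n)%N then a (N w) else 0) + c.
Proof.
congr (_ + _); rewrite (eq_bigr (fun j : 'I_n => if j == N w :> nat then a j else 0)).
  rewrite -big_mkcond/=; case: ifPn => Nn.
    by rewrite (big_pred1 (Ordinal Nn)).
  by rewrite big1// => j /eqP jN; move: Nn; rewrite -jN ltn_ord.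
move=> j _; rewrite indicE; case: eqP => [->|jN].
  by rewrite mem_set ?mulr1.
by rewrite memNset ?mulr0//= => Nj; apply: jN.
Qed.

Let mstep a n c : measurable_fun setT (step a n c).
Proof.
apply: measurable_funD => //; apply: measurable_sum => j.
by apply: measurable_funM => //; exact: measurable_indic.
Qed.

Let integral_step a n c : (forall j, (j < n)%N -> 0 <= a j) -> 0 <= c ->
  (\int[P]_w (step a n c w)%:E = (\sum_(j < n) a j * p j + c)%:E)%E.
Proof.
move=> a0 c0; under eq_integral do rewrite EFinD -sumEFin.
rewrite ge0_integralD//; last 2 first.
- by move=> w _; apply: sume_ge0 => j _; rewrite lee_fin mulr_ge0// a0.
- apply: emeasurable_sum => j; apply/measurable_EFinP.
  by apply: measurable_funM => //; exact: measurable_indic.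
have -> : (\int[P]_w c%:E = c%:E)%E.
  rewrite (_ : (fun=> c%:E) = cst c%:E)// integral_cst//.
  by rewrite -[RHS]mule1; congr (_ * _)%E; exact: probability_setT.
rewrite EFinD -sumEFin; congr (_ + _)%E.
rewrite ge0_integral_sum//; last 2 first.
- move=> j; apply/measurable_EFinP.
  by apply: measurable_funM => //; exact: measurable_indic.
- by move=> j w _; rewrite lee_fin mulr_ge0// a0.
apply: eq_bigr => j _; under eq_integral do rewrite EFinM.
rewrite ge0_integralZl//; last 2 first.
- by apply/measurable_EFinP; exact: measurable_indic.
- by rewrite lee_fin a0.
by rewrite integral_indic// setIT EFinM fineK// fin_num_measure.
Qed.

(** On the event [n <= N] the variable [q ^ N] lies between [0] and [q ^ n]; replacing it there by
    these values gives two simple functions around it. *)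
Lemma probability_generating_function_bounds (q : R) n : 0 <= q <= 1 ->
  ((\sum_(j < n) q ^+ j * p j)%:E <= \int[P]_w (q ^+ N w)%:E <=
   (\sum_(j < n) (q ^+ j - q ^+ n) * p j + q ^+ n)%:E)%E.
Proof.
move=> /andP[q0 q1].
have mq : measurable_fun setT (fun w => (q ^+ N w)%:E).
  by apply/measurable_EFinP; apply: (measurableT_comp (f := fun j : nat => q ^+ j)) => //; exact: measurable_fun_nat.
have qn0 : 0 <= q ^+ n by exact: exprn_ge0.
apply/andP; split.
  rewrite -[X in (X%:E <= _)%E]addr0 -integral_step//; last by move=> j _; exact: exprn_ge0.
  apply: ge0_le_integral => //.
  - by move=> w _; rewrite lee_fin stepE addr0; case: ifP => // _; exact: exprn_ge0.
  - exact/measurable_EFinP.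
  - by move=> w _; rewrite lee_fin stepE addr0; case: ifP => // _; exact: exprn_ge0.
rewrite -(integral_step (a := fun j => q ^+ j - q ^+ n))//; last first.
  by move=> j jn; rewrite subr_ge0 ler_wiXn2l// ltnW.
apply: ge0_le_integral => //.
- by move=> w _; rewrite lee_fin exprn_ge0.
- exact/measurable_EFinP.
- move=> w _; rewrite lee_fin stepE; case: ltnP => Nn; first by rewrite subrK.
  by rewrite add0r ler_wiXn2l.
Qed.

End probability_generating_function.

(** * The law of a generalized counting process *)

Section small_time.
Context {R : realType}.

(** Telescoping: on [[0, 1]] errors add up at most linearly under powers. *)
Lemma ler_normB_exprn (x y : R) n : 0 <= x <= 1 -> 0 <= y <= 1 ->
  `|x ^+ n - y ^+ n| <= n%:R * `|x - y|.
Proof.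
move=> /andP[x0 x1] /andP[y0 y1]; elim: n => [|n IH].
  by rewrite !expr0 subrr normr0 mul0r.
have -> : x ^+ n.+1 - y ^+ n.+1 = x * (x ^+ n - y ^+ n) + (x - y) * y ^+ n.
  by rewrite !exprS; ring.
rewrite -natr1 (mulrDl n%:R) mul1r (le_trans (ler_normD _ _))// !normrM lerD//.
  by rewrite ger0_norm// (le_trans _ IH)// ler_piMl.
by rewrite ler_piMr// normrX ger0_norm// exprn_ile1.
Qed.

Lemma expRN_bounds (x : R) : 0 <= x -> 0 <= expR (- x) - (1 - x) <= x ^+ 2.
Proof.
move=> x0; apply/andP; split; first by rewrite subr_ge0 -[_ - x]/(1 + - x) expR_ge1Dx.
have x1 : 0 < 1 + x by rewrite ltr_pwDl.
rewrite lerBlDr expRN (@le_trans _ _ (1 + x)^-1)//.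
  by rewrite lef_pV2 ?posrE ?expR_gt0// expR_ge1Dx.
rewrite -[leLHS]mul1r ler_pdivrMr//.
by have := exprn_ge0 3 x0; rewrite !exprS expr0; nra.
Qed.

(* Writing [L t] as [L (t / n) ^ n] and comparing with the powers of
   [exp (- S t / n)] leaves an error of [n] times [o(t / n)]. *)
Lemma multiplicative_exponential (L : R -> R) (S : R) : 0 <= S ->
  (forall t, 0 <= t -> 0 <= L t <= 1) -> L 0 = 1 ->
  (forall s t, 0 <= s -> 0 <= t -> L (s + t) = L s * L t) ->
  (forall e, 0 < e -> \forall h \near 0^'+, `|L h - (1 - S * h)| <= e * h) ->
  forall t, 0 <= t -> L t = expR (- t * S).
Proof.
move=> S0 L01 L0 LM Lo t; rewrite le_eqVlt => /predU1P[<-|t0].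
  by rewrite oppr0 mul0r expR0.
have Ln n h : 0 <= h -> L (h *+ n) = L h ^+ n.
  move=> h0; elim: n => [|n IH]; first by rewrite mulr0n expr0.
  by rewrite mulrS LM ?mulrn_wge0// IH exprS.
apply/eqP; rewrite -subr_eq0 -normr_eq0 eq_le normr_ge0 andbT.
apply/ler_addgt0Pr => e e0; rewrite add0r.
(* Over [n] steps of length [t / n] this tolerance accumulates to [e / 2]. The other half is left
   for the quadratic errors of the exponential, which total [S ^ 2 * t ^ 2 / n]. *)
have e2 : 0 < e / (2 * t) by rewrite divr_gt0// mulr_gt0.
have [d /= d0 dP] := Lo _ e2.
near \oo => n.
have n0 : 0 < n%:R :> R by rewrite ltr0n; near: n; exact: nbhs_infty_gt.
have h0 : 0 < t / n%:R by rewrite divr_gt0.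
have tE : t = (t / n%:R) *+ n by rewrite -mulr_natr mulfVK// gt_eqF.
have EE : expR (- t * S) = expR (- (S * (t / n%:R))) ^+ n.
  by rewrite -expRM_natl; congr expR; field; rewrite gt_eqF.
rewrite {1}tE (Ln _ _ (ltW h0)) EE.
have St0 : 0 <= S * (t / n%:R) by rewrite mulr_ge0// ltW.
have E01 : 0 <= expR (- (S * (t / n%:R))) <= 1 by rewrite expR_ge0 expR_le1 oppr_le0.
rewrite (le_trans (ler_normB_exprn _ (L01 _ (ltW h0)) E01))//.
have A : `|L (t / n%:R) - (1 - S * (t / n%:R))| <= e / (2 * t) * (t / n%:R).
  apply: dP => //=; rewrite sub0r normrN gtr0_norm// ltr_pdivrMr// mulrC -ltr_pdivrMr//.
  by near: n; exact: nbhs_infty_gtr.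
have /andP[B0 B1] := expRN_bounds St0.
have C : S ^+ 2 * t ^+ 2 / n%:R <= e / 2.
  rewrite ler_pdivrMr// -ler_pdivrMl ?divr_gt0//.
  by near: n; exact: nbhs_infty_ger.
apply: (@le_trans _ _ (n%:R * (e / (2 * t) * (t / n%:R) + (S * (t / n%:R)) ^+ 2))).
  rewrite ler_wpM2l// (le_trans _ (lerD A B1))//.
  rewrite -(ger0_norm B0) (le_trans _ (ler_normB _ _))//.
  by rewrite le_eqVlt; apply/orP; left; apply/eqP; congr `|_|; ring.
have -> : n%:R * (e / (2 * t) * (t / n%:R) + (S * (t / n%:R)) ^+ 2) = e / 2 + S ^+ 2 * t ^+ 2 / n%:R.
  by field; rewrite !gt_eqF.
by rewrite [leRHS]splitr lerD2l.
Unshelve. all: by end_near. Qed.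

End small_time.

Section gcp_laplace.
Context {d : measure_display} {T : measurableType d} {R : realType}.
Variables (P : probability T R) (k : nat) (lambda : 'I_k -> R) (M : R -> T -> nat).
Hypothesis lambda0 : forall j, 0 <= lambda j.
Hypothesis HM : generalized_counting_process P lambda M.

Let levyM := gcp_levy HM.

Lemma gcp_measurable_eq t n : 0 <= t -> measurable [set w | M t w = n].
Proof.
move=> t0; have := levy_measurable levyM t0 measurableT (measurable_set1 (n%:R : R)).
rewrite setTI; congr measurable; apply/seteqP; split=> w /=; last by move->.
by move=> /eqP; rewrite eqr_nat => /eqP.
Qed.

Lemma gcp_start w : M 0 w = 0%N.
Proof. by have /eqP := levy_start levyM w; rewrite pnatr_eq0 => /eqP. Qed.

Let p h j : R := fine (P [set w | M h w = j]).

Let start1 : P [set w | M 0 w = 0%N] = 1%E.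
Proof.
rewrite (_ : [set _ | _] = setT) ?probability_setT//.
by apply/seteqP; split=> w // _; exact: gcp_start.
Qed.

Let transitionE h j : transition_probability P M 0 h 0 j = p h j.
Proof.
rewrite /transition_probability start1 divr1 add0r add0n; congr (fine (P _)).
by apply/seteqP; split=> [w []//|w /= Mw]; split => //; exact: gcp_start.
Qed.

Let start_neq0 : P [set w | M 0 w = 0%N] != 0%E.
Proof. by rewrite start1 eqe oner_eq0. Qed.

Definition laplace_exponent (eta : R) : R :=
  \sum_(j < k) lambda j * (1 - expR (- eta * j.+1%:R)).

Let L eta t : R := fine (\int[P]_w (expR (- eta * (M t w)%:R))%:E).

Let LE eta t : (\int[P]_w (expR (- eta * (M t w)%:R))%:E =
   \int[P]_w (expR (- eta) ^+ M t w)%:E)%E.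
Proof. by apply: eq_integral => w _; rewrite -expRM_natr. Qed.

(** At time [0] the process is surely in state [0], so transition probabilities out of that state
    are the plain masses [p h j]; finitely many jump sizes allow one common neighbourhood. *)
Let p_small e : 0 < e -> \forall h \near 0^'+,
  `|p h 0 - (1 - total_rate lambda * h)| <= e * h /\
  forall j : 'I_k, `|p h j.+1 - lambda j * h| <= e * h.
Proof.
move=> e0.
have a := gcp_no_jump HM (lexx 0) start_neq0.
have b (j : 'I_k) := gcp_jump HM j (lexx 0) start_neq0.
have a' : \forall h \near 0^'+, `|p h 0 - (1 - total_rate lambda * h)| <= e * h.
  move/eqoP : a => /(_ _ e0) a; near=> h; have h0 : 0 < h by [].
  have : `|transition_probability P M 0 h 0 0 - (1 - total_rate lambda * h)| <= e * `|h|.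
    by near: h; exact: a.
  by rewrite transitionE (gtr0_norm h0).
have b' (j : 'I_k) : \forall h \near 0^'+, `|p h j.+1 - lambda j * h| <= e * h.
  move/eqoP : (b j) => /(_ _ e0) bj; near=> h; have h0 : 0 < h by [].
  have : `|transition_probability P M 0 h 0 j.+1 - lambda j * h| <= e * `|h|.
    by near: h; exact: bj.
  by rewrite transitionE (gtr0_norm h0).
near=> h; split; first by near: h.
near: h; exact: filter_forall.
Unshelve. all: by end_near. Qed.

(** The generating function is truncated at [k + 1]. The mass above [k] is not estimated directly:
    it is the complement of the masses at [0, ..., k], weighted by at most [q ^ (k + 1)]. *)
Let L_small eta e : 0 <= eta -> 0 < e ->
  \forall h \near 0^'+, `|L eta h - (1 - laplace_exponent eta * h)| <= e * h.
Proof.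
(* The error is shared among the [k + 1] masses, with a factor [2] to spare. *)
move=> eta0 e0; have K0 : 0 < 2 * k.+1%:R :> R by rewrite mulr_gt0.
near=> h; have h0 : 0 < h by [].
have [A B] : `|p h 0 - (1 - total_rate lambda * h)| <= e / (2 * k.+1%:R) * h /\
    forall j : 'I_k, `|p h j.+1 - lambda j * h| <= e / (2 * k.+1%:R) * h.
  by near: h; apply: p_small; rewrite divr_gt0.
set e' := e / _ * h in A B.
pose q := expR (- eta).
have q01 : 0 <= q <= 1 by rewrite expR_ge0 expR_le1 oppr_le0.
have bnd n := @probability_generating_function_bounds _ _ _ P (M h)
  (fun j => gcp_measurable_eq j (ltW h0)) q n q01.
have fin : (\int[P]_w (q ^+ M h w)%:E)%E \is a fin_num.
  have /andP[l u] := bnd 0%N; rewrite ge0_fin_numE; last by rewrite (le_trans _ l)// big_ord0.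
  by rewrite (le_lt_trans u)// ltry.
have := bnd k.+1.
rewrite -(fineK fin) -LE -/(L eta h) !lee_fin => /andP[].
rewrite !big_ord_recl !expr0 => l u.
have {}l : p h 0 + \sum_(j < k) q ^+ j.+1 * p h j.+1 <= L eta h.
  by rewrite mul1r in l; exact: l.
have {}u : L eta h <= (1 - q ^+ k.+1) * p h 0 +
    \sum_(j < k) (q ^+ j.+1 - q ^+ k.+1) * p h j.+1 + q ^+ k.+1.
  exact: u.
pose a0 := p h 0 - (1 - total_rate lambda * h).
pose a (j : 'I_k) := p h j.+1 - lambda j * h.
have sumE (c : 'I_k -> R) : \sum_(j < k) c j * p h j.+1 =
    \sum_(j < k) c j * a j + (\sum_(j < k) c j * lambda j) * h.
  by rewrite mulr_suml -big_split/=; apply: eq_bigr => j _; rewrite /a; ring.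
have sum_le (c : 'I_k -> R) : (forall j, 0 <= c j <= 1) ->
    `|\sum_(j < k) c j * a j| <= k%:R * e'.
  move=> c01; rewrite (le_trans (ler_norm_sum _ _ _))//.
  rewrite mulr_natl -[X in _ *+ X]card_ord -sumr_const ler_sum// => j _.
  have /andP[c0 c1] := c01 j; rewrite normrM ger0_norm// (le_trans _ (B j))//.
  by rewrite ler_piMl.
have SE : laplace_exponent eta = total_rate lambda - \sum_(j < k) q ^+ j.+1 * lambda j.
  rewrite /laplace_exponent /total_rate -sumrB; apply: eq_bigr => j _.
  by rewrite /q -expRM_natr; ring.
have qj j : 0 <= q ^+ j <= 1 by case/andP: q01 => q0 q1; rewrite exprn_ge0// exprn_ile1.
have keE : e * h = 2 * k.+1%:R * e' by rewrite /e'; field; rewrite gt_eqF.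
have e'0 : 0 <= e' by rewrite (le_trans _ A).
have qj0 j := andP (qj j).
have [Q0 Q1] := andP (qj k.+1).
move: A; rewrite ler_norml -/a0 => /andP[A0 A1].
have kE : k.+1%:R = k%:R + 1 :> R by rewrite natr1.
rewrite keE kE SE; apply/ler_normlP; rewrite opprB; split.
- have := sum_le (fun j => q ^+ j.+1) (fun j => qj j.+1).
  move: l; rewrite sumE ler_norml => l /andP[B0 B1].
  by rewrite /a0 in A0; nra.
- have c01 (j : 'I_k) : 0 <= q ^+ j.+1 - q ^+ k.+1 <= 1.
    have /andP[q0 q1] := q01; have /andP[qj0' qj1] := qj j.+1.
    rewrite subr_ge0 ler_wiXn2l//= 1?ltnW// ?ltnS//.
    by rewrite (le_trans _ qj1)// gerBl.
  have := sum_le (fun j => q ^+ j.+1 - q ^+ k.+1) c01.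
  move: u; rewrite sumE ler_norml => u /andP[B0 B1].
  have Qa : (1 - q ^+ k.+1) * a0 <= e' by nra.
  (* At first order in [h] all terms carrying [q ^ (k + 1)] cancel, so the upper bound has the same
     slope as the lower one. *)
  have E2 : \sum_(j < k) (q ^+ j.+1 - q ^+ k.+1) * lambda j =
      \sum_(j < k) q ^+ j.+1 * lambda j - q ^+ k.+1 * total_rate lambda.
    by rewrite /total_rate mulr_sumr -sumrB; apply: eq_bigr => j _; rewrite mulrBl.
  rewrite E2 in u; rewrite /a0 in Qa; nra.
Unshelve. all: by end_near. Qed.

Lemma laplace_exponent_ge0 eta : 0 <= eta -> 0 <= laplace_exponent eta.
Proof.
move=> eta0; apply: sumr_ge0 => j _; rewrite mulr_ge0// subr_ge0 expR_le1.
by rewrite mulNr oppr_le0 mulr_ge0.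
Qed.

Lemma gcp_laplace eta t : 0 <= eta -> 0 <= t ->
  (\int[P]_w (expR (- eta * (M t w)%:R))%:E = (expR (- t * laplace_exponent eta))%:E)%E.
Proof.
move=> eta0 t0.
have q01 : 0 <= expR (- eta) <= 1 by rewrite expR_ge0 expR_le1 oppr_le0.
have bnd s : 0 <= s -> (0 <= \int[P]_w (expR (- eta * (M s w)%:R))%:E <= 1)%E.
  move=> s0; have := @probability_generating_function_bounds _ _ _ P (M s)
    (fun j => gcp_measurable_eq j s0) _ 0%N q01.
  by rewrite LE !big_ord0 expr0 add0r.
have fin s : 0 <= s -> (\int[P]_w (expR (- eta * (M s w)%:R))%:E)%E \is a fin_num.
  by move=> /bnd/andP[l u]; rewrite ge0_fin_numE// (le_lt_trans u)// ltry.
rewrite -(fineK (fin t t0)); congr EFin.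
apply: (@multiplicative_exponential _ (L eta) _ (laplace_exponent_ge0 eta0) _ _ _ _ t t0).
- by move=> s s0; rewrite -!lee_fin fineK ?fin// bnd.
- rewrite /L (eq_integral (cst 1%E)); last first.
    by move=> w _; rewrite gcp_start mulr0 expR0.
  by rewrite integral_cst// mul1e -[RHS]/(fine 1%E); congr fine; exact: probability_setT.
- move=> r s r0 s0; rewrite /L -fineM ?fin//; congr fine.
  apply: (@levy_process_integral_expM _ _ _ P _ (fun x => expR (- eta * x)) r s levyM) => //.
    by apply: measurableT_comp => //; exact: measurable_funM.
  by move=> x y; rewrite mulrDr expRD.
- by move=> e e0; exact: L_small.
Qed.

End gcp_laplace.

(** * The sums over [Omega] as power series coefficients *)

Section multi_poisson_polynomial.
Context {R : realType} (k : nat).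
Implicit Types (a : 'I_k -> R).

(* Truncation at degree [N] of the exponential series of [a X ^ (j + 1)]. *)
Let E (j N : nat) (r : R) : {poly R} :=
  \sum_(i < N.+1) (r ^+ i / i`!%:R) *: 'X^(j.+1 * i).

Let Q N a : {poly R} := \prod_(j < k) E j N (a j).

(** The coefficient of [u ^ n] in [exp (sum_j a_j u ^ (j + 1))]. For [a_j = lambda_j t] it is, up to
    the factor [exp (- Lambda t)], the probability that the counting process equals [n]. *)
Definition compound_weight a (n : nat) : R :=
  \sum_(x in Omega k n) \prod_(j < k) (a j ^+ x j / (x j)`!%:R).

Let Q_expand N a : Q N a =
  \sum_(x : {ffun 'I_k -> 'I_N.+1})
    (\prod_(j < k) (a j ^+ x j / (x j)`!%:R)) *: 'X^(\sum_(j < k) j.+1 * x j).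
Proof.
rewrite /Q /E bigA_distr_bigA/=; apply: eq_bigr => x _.
by rewrite scaler_prod -expr_sum.
Qed.

(** Truncating at [n] itself makes the exponents range over ['I_n.+1], the very type of the entries
    in [Omega k n]; other truncations are reached by stability of low coefficients. *)
Let coef_Q n a : (Q n a)`_n = compound_weight a n.
Proof.
rewrite Q_expand coef_sum /compound_weight [RHS]big_mkcond/=.
apply: eq_bigr => x _; rewrite coefZ coefXn inE eq_sym.
by case: eqP; rewrite ?mulr1 ?mulr0.
Qed.

Let E_ge0 j N r i : 0 <= r -> 0 <= (E j N r)`_i.
Proof.
move=> r0; rewrite coef_sum sumr_ge0// => l _.
by rewrite coefZ coefXn !mulr_ge0// ?invr_ge0// exprn_ge0.
Qed.

Let prod_ge0 (F : 'I_k -> {poly R}) i : (forall j i, 0 <= (F j)`_i) ->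
  0 <= (\prod_(j < k) F j)`_i.
Proof.
move=> F0; elim/big_rec : _ i => [|j p _ IH] i; first by rewrite coef1.
by rewrite coefM sumr_ge0// => l _; rewrite mulr_ge0.
Qed.

Let Q_ge0 N a i : (forall j, 0 <= a j) -> 0 <= (Q N a)`_i.
Proof. by move=> a0; apply: prod_ge0 => j l; exact: E_ge0. Qed.

Let coef_E_stable j N n r i : (i <= n)%N -> (n <= N)%N -> (E j N r)`_i = (E j n r)`_i.
Proof.
move=> iN nN; rewrite -(subnK nN); elim: (N - n)%N => [//|m IH].
rewrite addSn /E big_ord_recr/= coefD -/(E j (m + n) r) IH coefZ coefXn.
case: eqP => [ij|_]; last by rewrite mulr0 addr0.
have : (i < j.+1 * (m + n).+1)%N.
  by rewrite (leq_ltn_trans iN)// (leq_trans _ (leq_pmull _ _))// ltnS leq_addl.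
by rewrite ij ltnn.
Qed.

Let coef_prod_stable (F G : 'I_k -> {poly R}) n :
  (forall j i, (i <= n)%N -> (F j)`_i = (G j)`_i) ->
  forall i, (i <= n)%N -> (\prod_(j < k) F j)`_i = (\prod_(j < k) G j)`_i.
Proof.
move=> FG; elim/big_rec2 : _ => [//|j p q _ IH] i iN.
rewrite !coefM; apply: eq_bigr => l _.
by rewrite FG ?IH// ?(leq_trans _ iN)// ?leq_subr// -ltnS.
Qed.

Let coef_Q_stable N n a : (n <= N)%N -> (Q N a)`_n = compound_weight a n.
Proof.
move=> nN; rewrite -coef_Q; apply: (@coef_prod_stable _ _ n) => // j i iN.
exact: coef_E_stable.
Qed.

Let EP j N r u : (E j N r).[u] = series (exp_coeff (r * u ^+ j.+1)) N.+1.
Proof.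
rewrite /E /series/= horner_sum big_mkord; apply: eq_bigr => i _.
by rewrite hornerZ hornerXn /exp_coeff/= exprMn -exprM; ring.
Qed.

Let cvg_prod (s : seq 'I_k) (F : 'I_k -> R^nat) (x : 'I_k -> R) :
  (forall j, F j n @[n --> \oo] --> x j) ->
  \prod_(j <- s) F j n @[n --> \oo] --> \prod_(j <- s) x j.
Proof.
move=> Fx; elim: s => [|j s IH].
  by rewrite big_nil; under eq_fun do rewrite big_nil; exact: cvg_cst.
by rewrite big_cons; under eq_fun do rewrite big_cons; exact: cvgM.
Qed.

Let Q_cvg a u : (Q n a).[u] @[n --> \oo] --> expR (\sum_(j < k) a j * u ^+ j.+1).
Proof.
rewrite expR_sum /Q; under eq_fun do rewrite horner_prod.
apply: cvg_prod => j; under eq_fun do rewrite EP.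
have h : series (exp_coeff (a j * u ^+ j.+1)) n @[n --> \oo] -->
    expR (a j * u ^+ j.+1) by exact: is_cvg_series_exp_coeff.
by rewrite -cvg_shiftS in h.
Qed.

(** All coefficients are nonnegative, so the part of degree at least [n] lies between [0] and
    [u ^ n] times its value at [1]. This holds for each truncation [Q N] and passes to the limit. *)
Lemma compound_weight_bounds a u n : (forall j, 0 <= a j) -> 0 <= u <= 1 ->
  \sum_(i < n) compound_weight a i * u ^+ i <= expR (\sum_(j < k) a j * u ^+ j.+1)
    <= \sum_(i < n) compound_weight a i * u ^+ i + u ^+ n * expR (\sum_(j < k) a j).
Proof.
move=> a0 /andP[u0 u1].
have split N x : (n <= N)%N -> (Q N a).[x] =
    \sum_(i < n) compound_weight a i * x ^+ i +
    \sum_(n <= i < maxn n (size (Q N a))) (Q N a)`_i * x ^+ i.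
  move=> nN; rewrite (@horner_coef_wide _ (maxn n (size (Q N a)))) ?leq_maxr//.
  rewrite -(big_mkord xpredT (fun i => (Q N a)`_i * x ^+ i)).
  rewrite (@big_cat_nat _ _ _ n)//= ?leq_maxl// big_mkord; congr (_ + _).
  by apply: eq_bigr => i _; rewrite coef_Q_stable// (leq_trans (ltnW (ltn_ord i))).
have Q_cvg1 : (Q n a).[1] @[n --> \oo] --> expR (\sum_(j < k) a j).
  have -> : \sum_(j < k) a j = \sum_(j < k) a j * 1 ^+ j.+1.
    by apply: eq_bigr => j _; rewrite expr1n mulr1.
  exact: Q_cvg.
apply/andP; split.
- rewrite -(cvg_lim _ (@Q_cvg a u))//.
  apply: limr_ge; first exact: cvgP (@Q_cvg a u).
  near=> N.
  rewrite (split N); last by near: N; exact: nbhs_infty_ge.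
  rewrite lerDl sumr_ge0// => i _.
  by rewrite mulr_ge0// ?exprn_ge0//; exact: Q_ge0.
- set s := (X in _ <= X + _).
  have h : s + u ^+ n * (Q N a).[1] @[N --> \oo] --> s + u ^+ n * expR (\sum_(j < k) a j).
    by apply: cvgD; [exact: cvg_cst|exact: cvgMr].
  rewrite -(cvg_lim _ (@Q_cvg a u))// -(cvg_lim _ h)//.
  apply: ler_lim; [exact: cvgP (@Q_cvg a u)|exact: cvgP h|]; near=> N.
  have nN : (n <= N)%N by near: N; exact: nbhs_infty_ge.
  rewrite (split N)// lerD2l (split N 1)// mulrDr.
  rewrite ler_wpDl//.
    rewrite mulr_ge0 ?exprn_ge0// sumr_ge0// => i _.
    by rewrite expr1n mulr1 -(@coef_Q_stable N) ?Q_ge0// (leq_trans (ltnW (ltn_ord i))).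
  rewrite mulr_sumr !big_nat ler_sum// => i /andP[ni _].
  rewrite expr1n mulr1 mulrC ler_wpM2r ?Q_ge0//.
  exact: ler_wiXn2l.
Unshelve. all: by end_near. Qed.

End multi_poisson_polynomial.

Section power_series_uniqueness.
Context {R : realType}.

(** Strong induction: once the lower coefficients agree, the bounds at order [n + 1] give
    [p n <= c n + u * C] and symmetrically, and [u] can be taken arbitrarily small. Neither
    differentiation nor the point [u = 0] is involved. *)
Lemma power_series_coef_unique (p c : nat -> R) (F : R -> R) (C : R) :
  (forall n u, 0 < u <= 1 ->
    \sum_(i < n) p i * u ^+ i <= F u <= \sum_(i < n) p i * u ^+ i + u ^+ n * C) ->
  (forall n u, 0 < u <= 1 ->
    \sum_(i < n) c i * u ^+ i <= F u <= \sum_(i < n) c i * u ^+ i + u ^+ n * C) ->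
  p =1 c.
Proof.
have le (a b : nat -> R) n : (forall i, (i < n)%N -> a i = b i) ->
    (forall n u, 0 < u <= 1 -> \sum_(i < n) a i * u ^+ i <= F u) ->
    (forall n u, 0 < u <= 1 -> F u <= \sum_(i < n) b i * u ^+ i + u ^+ n * C) ->
    a n <= b n.
  move=> ab aF bF; apply/ler_addgt0Pr => e e0.
  (* Small enough for [u * C <= e]; the added [1] avoids dividing by zero. *)
  pose u := Num.min 1 (e / (`|C| + 1)).
  have C1 : 0 < `|C| + 1 by rewrite ltr_wpDl.
  have u01 : 0 < u <= 1 by rewrite /u lt_min ltr01 divr_gt0//= ge_min lexx.
  have /andP[u0 u1] := u01.
  have := le_trans (aF n.+1 u u01) (bF n.+1 u u01).
  rewrite !big_ord_recr/= (eq_bigr (fun i : 'I_n => b i * u ^+ i)); last first.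
    by move=> i _; rewrite ab.
  have un0 : 0 < u ^+ n by exact: exprn_gt0.
  rewrite -addrA lerD2l exprS => h.
  have {}h : a n <= b n + u * C by nra.
  rewrite (le_trans h)// lerD2l (le_trans (ler_wpM2l (ltW u0) (ler_norm C)))//.
  have ue : u <= e / (`|C| + 1) by rewrite /u ge_min lexx orbT.
  rewrite (le_trans (ler_wpM2r (normr_ge0 C) ue))// mulrAC ler_pdivrMr//.
  by apply: ler_wpM2l; [exact: ltW|rewrite lerDl].
move=> pF cF n; elim/ltn_ind: n => n IH; apply/eqP; rewrite eq_le.
apply/andP; split; apply: le => //.
- by move=> m u /(pF m)/andP[].
- by move=> m u /(cF m)/andP[].
- by move=> i /IH.
- by move=> m u /(cF m)/andP[].
- by move=> m u /(pF m)/andP[].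
Qed.

End power_series_uniqueness.

Section gcp_law.
Context {d : measure_display} {T : measurableType d} {R : realType}.
Variables (P : probability T R) (k : nat) (lambda : 'I_k -> R) (M : R -> T -> nat).
Hypothesis lambda0 : forall j, 0 <= lambda j.
Hypothesis HM : generalized_counting_process P lambda M.

Lemma gcp_law t n : 0 <= t -> P [set w | M t w = n] =
  (\sum_(x in Omega k n) (\prod_(j < k) (lambda j ^+ x j / (x j)`!%:R)) *
     (t ^+ (\sum_(j < k) x j)%N * expR (- total_rate lambda * t)))%:E.
Proof.
move=> t0.
have mM := fun j => gcp_measurable_eq HM j t0.
pose p j := fine (P [set w | M t w = j]).
pose e := expR (- total_rate lambda * t).
pose c j := compound_weight (fun i => lambda i * t) j * e.
pose F u := fine (\int[P]_w (u ^+ M t w)%:E)%E.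
have FE u : 0 < u <= 1 -> (\int[P]_w (u ^+ M t w)%:E)%E =
    (expR (\sum_(j < k) lambda j * t * u ^+ j.+1) * e)%:E.
  (* The Laplace transform at [eta = - ln u] is the generating function at [u]; this requires
     [u > 0], which explains the half-open range in the uniqueness lemma. *)
  move=> /andP[u0 u1]; have lnu : 0 <= - ln u by rewrite oppr_ge0 ln_le0.
  rewrite (eq_integral (fun w => (expR (- (- ln u) * (M t w)%:R))%:E)); last first.
    by move=> w _; rewrite opprK expRM_natr lnK ?posrE.
  rewrite (gcp_laplace lambda0 HM)//; congr EFin; rewrite -expRD; congr expR.
  rewrite /laplace_exponent /total_rate mulr_sumr mulNr mulr_suml -sumrB.
  apply: eq_bigr => j _; rewrite opprK expRM_natr lnK ?posrE//; ring.
have pE : p =1 c.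
  (* The remainder constant is [1] on both sides: on one because [u ^ M <= u ^ m] beyond [m], on the
     other because [exp (sum_j lambda_j t)] cancels [e]. *)
  apply: (@power_series_coef_unique _ p c F 1) => m u u01.
    have u01' : 0 <= u <= 1 by case/andP: u01 => /ltW -> ->.
    have /andP[l r] := probability_generating_function_bounds P mM m u01'.
    have Ffin : (F u)%:E = (\int[P]_w (u ^+ M t w)%:E)%E by rewrite /F FE.
    move: l r; rewrite -Ffin !lee_fin => l r; apply/andP; split.
      by rewrite (le_trans _ l)// ler_sum// => i _; rewrite mulrC.
    rewrite mulr1 (le_trans r)// lerD2r ler_sum// => i _.
    rewrite mulrC ler_wpM2l//; first exact: fine_ge0.
    by rewrite gerBl exprn_ge0//; case/andP : u01'.
  have u01' : 0 <= u <= 1 by case/andP: u01 => /ltW -> ->.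
  have a0 i : 0 <= lambda i * t by exact: mulr_ge0.
  have /andP[l r] := compound_weight_bounds m a0 u01'.
  have e0 : 0 <= e by exact: expR_ge0.
  rewrite /F FE//= mulr1.
  have cE : \sum_(i < m) c i * u ^+ i =
      (\sum_(i < m) compound_weight (fun i => lambda i * t) i * u ^+ i) * e.
    by rewrite mulr_suml; apply: eq_bigr => i _; rewrite /c mulrAC.
  rewrite cE ler_wpM2r//= (le_trans (ler_wpM2r e0 r))// mulrDl lerD2l -mulrA -expRD.
  rewrite (_ : _ + _ = 0) ?expR0 ?mulr1//.
  by rewrite /total_rate -mulr_suml mulNr subrr.
rewrite -[LHS]fineK; last by rewrite fin_num_measure.
rewrite -/(p n) pE /c /compound_weight mulr_suml; congr EFin.
apply: eq_bigr => x _; rewrite -/e mulrA; congr (_ * _).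
rewrite expr_sum -big_split/=; apply: eq_bigr => j _.
by rewrite exprMn; ring.
Qed.

End gcp_law.

Lemma ge0_integral_EFinB {d : measure_display} {S : measurableType d} {R : realType}
    (nu : {measure set S -> \bar R}) (A : set S) (f g : S -> R) (a b : R) :
  measurable A -> measurable_fun A f -> measurable_fun A g ->
  (forall x, A x -> 0 <= g x <= f x) ->
  (\int[nu]_(x in A) (f x)%:E = a%:E -> \int[nu]_(x in A) (g x)%:E = b%:E ->
   \int[nu]_(x in A) (f x - g x)%:E = (a - b)%:E)%E.
Proof.
move=> mA mf mg gf fa gb.
have : (\int[nu]_(x in A) ((f x - g x)%:E + (g x)%:E) = a%:E)%E.
  by rewrite -fa; apply: eq_integral => x _; rewrite -EFinD subrK.
rewrite ge0_integralD//.
- by rewrite gb EFinB => <-; rewrite addeK.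
- by move=> x /gf/andP[_ h]; rewrite lee_fin subr_ge0.
- by apply/measurable_EFinP; exact: measurable_funB.
- by move=> x /gf/andP[h _]; rewrite lee_fin.
- exact/measurable_EFinP.
Qed.

(** * Subordinators and their inverses *)

Section subordinator.
Context {d : measure_display} {T : measurableType d} {R : realType}.
Variable P : probability T R.
Local Notation mu := (@lebesgue_measure R).

(** The common interface of the random case and of the deterministic case [D t = t] at exponent [1],
    so that later arguments need no case distinction. The transform is also stated at [s = 0]. *)
Record subordinator (beta : R) (D : R -> T -> R) : Prop := Subordinator {
  subordinator_measurable : forall t, 0 <= t -> measurable_fun [set: T] (D t) ;
  subordinator_start : forall w, D 0 w = 0 ;
  subordinator_right_continuous :
    forall w t, 0 <= t -> D s w @[s --> t^'+] --> D t w ;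
  subordinator_nondecreasing : forall w s t, 0 <= s -> s <= t -> D s w <= D t w ;
  subordinator_laplace : forall t s : R, 0 <= t -> 0 <= s ->
    (\int[P]_w (expR (- s * D t w))%:E = (expR (- t * s `^ beta))%:E)%E
}.

Lemma stable_subordinator_subordinator beta D : 0 < beta <= 1 ->
  stable_subordinator P beta D -> subordinator beta D.
Proof.
move=> /andP[b0 b1]; rewrite /stable_subordinator; case: ltP => [bl1|b1'].
  move=> [[mD D0 _ _ cD] ndD lD]; split => //.
  - by move=> w t t0; have [h _] := cD w; exact: h.
  - move=> t s t0; rewrite le_eqVlt => /predU1P[<-|]; last exact: lD.
    rewrite powR0 ?gt_eqF// mulr0 expR0.
    under eq_integral do rewrite oppr0 mul0r expR0.
    by rewrite integral_cst// mul1e; exact: probability_setT.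
have {b1 b1'} -> : beta = 1 by apply/eqP; rewrite eq_le b1.
move=> DE; split.
- by move=> t t0; rewrite (_ : D t = cst t)//; apply/funext => w; exact: DE.
- by move=> w; rewrite DE.
- move=> w t t0; rewrite DE//; apply: (@cvg_trans _ (id @ t^'+)).
    apply: near_eq_cvg; near=> s; have ts : t <= s by near: s; exact: nbhs_right_ge.
    by rewrite DE// (le_trans t0).
  exact/cvg_at_right_filter/cvg_id.
- by move=> w s t s0 st; rewrite !DE// (le_trans s0).
- move=> t s t0 s0; rewrite powRr1//.
  rewrite (eq_integral (cst (expR (- t * s))%:E)); last first.
    by move=> w _; rewrite DE// !mulNr mulrC.
  by rewrite integral_cst// -[RHS]mule1; congr (_ * _)%E; exact: probability_setT.
Unshelve. all: by end_near. Qed.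

Section inverse.
Variables (beta : R) (D : R -> T -> R).
Hypotheses (b01 : 0 < beta <= 1) (HD : subordinator beta D).

Let Y := inverse_process D.

Lemma subordinator_ge0 w t : 0 <= t -> 0 <= D t w.
Proof.
by move=> t0; rewrite -(subordinator_start HD w) (subordinator_nondecreasing HD).
Qed.

Lemma inverse_process_ge0 t w : 0 <= Y t w.
Proof.
rewrite /Y /inverse_process; have [->|/set0P ne] := eqVneq [set x | 0 < x /\ t < D x w] set0.
  by rewrite inf0.
by apply: lb_le_inf => // x [/ltW].
Qed.

Lemma inverse_process_lt x t w : 0 <= t -> 0 <= x -> x < Y t w -> D x w <= t.
Proof.
move=> t0; rewrite le_eqVlt => /predU1P[<- _|x0]; first by rewrite (subordinator_start HD).
move=> xY; rewrite leNgt; apply/negP => tD.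
have : Y t w <= x by apply: ge_inf => //; exists 0 => y [/ltW].
by rewrite leNgt xY.
Qed.

Lemma inverse_process_gt x t w : (exists2 y, 0 < y & t < D y w) ->
  Y t w < x -> t < D x w.
Proof.
move=> [y y0 ty] Yx.
have ne : [set x | 0 < x /\ t < D x w] !=set0 by exists y.
have [z [z0 tz] zx] := inf_lt ne Yx.
by rewrite (lt_le_trans tz)// (subordinator_nondecreasing HD)// ltW.
Qed.

(** By monotonicity the sublevel set is an interval from [0] to [Y t]. Its right end is excluded
    exactly when [D] already exceeds [t] there, which [b] records. *)
Lemma inverse_process_itv t w : 0 <= t -> (exists2 y, 0 < y & t < D y w) ->
  exists b : bool, forall x, (0 <= x) && (D x w <= t) =
    (x \in Interval (BLeft 0) (BSide b (Y t w))).
Proof.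
move=> t0 ex; exists (t < D (Y t w) w) => x.
have Y0 := inverse_process_ge0 t w.
apply/idP/idP.
  move=> /andP[x0 xt].
  have xY : x <= Y t w.
    by rewrite leNgt; apply/negP => /(inverse_process_gt ex); rewrite ltNge xt.
  case: ltP => tY; rewrite in_itv/= x0//= lt_neqAle xY andbT.
  by apply/eqP => e; rewrite -e ltNge xt in tY.
case: ltP => tY; rewrite in_itv/= => /andP[x0 xY]; rewrite x0/=.
  exact: inverse_process_lt xY.
by rewrite (le_trans _ tY)// (subordinator_nondecreasing HD).
Qed.

Let Dp (z : R * T) : R := D (Num.max z.1 0) z.2.

Let mDp : measurable_fun [set: R * T] Dp.
Proof.
apply: right_continuous_process_measurable.
  exact: subordinator_measurable HD.
exact: subordinator_right_continuous HD.
Qed.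

Let mDpL : measurable_fun [set: measurableTypeR R * T] (fun z => Dp (z.1, z.2)).
Proof.
apply: (measurableT_comp mDp); apply: measurable_fun_pair.
  exact: measurable_fst.
exact: measurable_snd.
Qed.

(** Unlike the infimum, this formula is visibly measurable in [(t, w)]. It persists on paths that
    never exceed [t]: the infimum of the empty set is [0], and so is [fine] of the infinite
    measure. *)
Lemma inverse_process_lebesgue t w : 0 <= t ->
  Y t w = fine (mu [set x : R | 0 <= x /\ D x w <= t]).
Proof.
move=> t0.
have [[y y0 ty]|ne] := pselect (exists2 y, 0 < y & t < D y w); last first.
  have -> : [set x : R | 0 <= x /\ D x w <= t] = `[0, +oo[%classic.
    apply/seteqP; split=> x /=; rewrite in_itv/= andbT; first by case.
    move=> x0; split => //; rewrite leNgt; apply/negP => tD; apply: ne.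
    exists x => //; rewrite lt_neqAle x0 andbT eq_sym; apply/eqP => x0'.
    by move: tD; rewrite x0' (subordinator_start HD) ltNge t0.
  rewrite lebesgue_measure_itv/= /Y /inverse_process.
  rewrite (_ : [set _ | _] = set0) ?inf0 ?ltry//.
  by apply/seteqP; split=> x // -[x0 tx]; apply: ne; exists x.
have ex : exists2 y, 0 < y & t < D y w by exists y.
have Y0 := inverse_process_ge0 t w.
have [b bE] := inverse_process_itv t0 ex.
have -> : [set x : R | 0 <= x /\ D x w <= t] =
    [set` Interval (BLeft 0) (BSide b (Y t w))].
  by apply/seteqP; split=> x /=; rewrite -bE => /andP.
rewrite lebesgue_measure_itv/= lte_fin; case: ltP => [_|]; first by rewrite sube0.
by move=> Yle; apply/eqP; rewrite eq_le Yle Y0.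
Qed.

Lemma measurable_inverse_process_pair :
  measurable_fun [set: measurableTypeR R * T] (fun z => Y (Num.max z.1 0) z.2).
Proof.
pose b (z : (measurableTypeR R * T) * measurableTypeR R) :=
  (0 <= z.2) && (Dp (z.2, z.1.2) <= Num.max z.1.1 0).
pose f z : \bar R := if b z then 1%E else 0%E.
have m1 : measurable_fun setT (fun z : (measurableTypeR R * T) * measurableTypeR R => z.1.1 : R).
  exact: (measurableT_comp measurable_fst measurable_fst).
have m2 : measurable_fun setT (fun z : (measurableTypeR R * T) * measurableTypeR R => z.2 : R).
  exact: measurable_snd.
have mb : measurable_fun setT b.
  apply: measurable_and; first exact: measurable_fun_ler.
  apply: measurable_fun_ler; last exact: measurable_maxr.
  have mq : measurable_fun setT (fun z : (measurableTypeR R * T) * measurableTypeR R =>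
      (z.2 : measurableTypeR R, z.1.2)).
    apply: measurable_fun_pair => //.
    exact: (measurableT_comp measurable_snd measurable_fst).
  exact: (measurableT_comp mDpL mq).
have mf : measurable_fun setT f by exact: measurable_fun_ifT.
have f0 z : (0 <= f z)%E by rewrite /f; case: ifP.
have mF := measurable_fun_fubini_tonelli_F (m2 := mu) f mf f0.
rewrite (_ : (fun z => _) = fine \o fubini_F mu f).
  exact: measurableT_comp.
apply/funext => -[t w]; rewrite /= inverse_process_lebesgue ?le_max ?lexx ?orbT//; congr fine.
rewrite /fubini_F.
have mA : measurable ([set x | b ((t, w), x)] : set (measurableTypeR R)).
  have mbw : measurable_fun setT (fun x => b ((t, w), x)).
    exact: (measurableT_comp mb (pair1_measurable (t, w))).
  by have := mbw measurableT [set true] I; rewrite setTI.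
rewrite (_ : [set _ | _] = [set x | b ((t, w), x)]).
  rewrite -[X in mu X]setIT -integral_indic//.
  apply: eq_integral => x _; rewrite indicE /f.
  by case: ifPn => bx; [rewrite mem_set|rewrite memNset//; exact/negP].
apply/seteqP; split=> x; rewrite /b/=.
  by move=> [x0 xt]; rewrite x0 /Dp/= max_l.
by move=> /andP[x0]; rewrite /Dp/= [Num.max x 0]max_l.
Qed.

Lemma measurable_inverse_process t : 0 <= t -> measurable_fun setT (Y t).
Proof.
move=> t0; have := measurableT_comp measurable_inverse_process_pair (pair1_measurable t).
by apply: eq_measurable_fun => w _ /=; rewrite max_l.
Qed.

Lemma subordinator_measurable_le (x t : R) : 0 <= x -> measurable [set w | D x w <= t].
Proof.
move=> x0; have := subordinator_measurable HD x0 measurableT (measurable_itv `]-oo, t]).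
by rewrite setTI; congr measurable; apply/seteqP; split=> w /=; rewrite in_itv.
Qed.

(** Chernoff bound: the indicator of [D x <= t] is at most [exp (s (t - D x))]. *)
Lemma subordinator_markov (x t s : R) : 0 <= x -> 0 <= s ->
  (P [set w | (D x w <= t)%R] <= (expR (s * t - x * s `^ beta))%:E)%E.
Proof.
move=> x0 s0.
have mD : measurable_fun setT (fun w => (expR (- s * D x w))%:E).
  apply/measurable_EFinP; apply: measurableT_comp => //; apply: measurable_funM => //.
  exact: (subordinator_measurable HD).
have mB := @subordinator_measurable_le x t x0.
have -> : (expR (s * t - x * s `^ beta))%:E =
    (\int[P]_w ((expR (s * t))%:E * (expR (- s * D x w))%:E))%E.
  rewrite ge0_integralZl//.
  by rewrite (subordinator_laplace HD)// -EFinM -expRD mulNr.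
rewrite -[X in P X]setIT -integral_indic//; apply: ge0_le_integral => //.
- by apply/measurable_EFinP; exact: measurable_indic.
- exact: measurable_funeM.
- move=> w _; rewrite indicE -EFinM lee_fin; case: (boolP (w \in _)) => [/set_mem/= wB|_] /=.
    by rewrite -expRD -expR0 ler_expR mulNr subr_ge0 ler_wpM2l.
  by rewrite mulr_ge0 ?expR_ge0.
Qed.

Lemma measure_le_expR_eq0 (B : set T) (C : R) : measurable B ->
  (forall n, (P B <= (C * expR (- n.+1%:R))%:E)%E) -> P B = 0%E.
Proof.
move=> mB PC; have fin : P B \is a fin_num by rewrite fin_num_measure.
apply/eqP; rewrite eq_le measure_ge0 andbT -(fineK fin) lee_fin leNgt; apply/negP => p0.
pose n := Num.truncn (C / fine (P B)).
have := PC n; rewrite -(fineK fin) lee_fin => h.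
have h2 := expR_ge1Dx (n.+1%:R : R).
have h3 : C / fine (P B) < n.+1%:R by exact: truncnS_gt.
move: h3; rewrite ltr_pdivrMr// => h3.
move: h; rewrite expRN ler_pdivlMr ?expR_gt0// => h.
have := ler_wpM2l (ltW p0) h2; lra.
Qed.

(** The Chernoff bound at [s = 1] gives [P (D (n + 1) <= t) <= exp (t - (n + 1))]. *)
Lemma ae_subordinator_unbounded t : 0 <= t ->
  {ae P, forall w, exists2 y, 0 < y & t < D y w}.
Proof.
move=> t0; pose B n := [set w | D n.+1%:R w <= t].
have mB n : measurable (B n) by exact: subordinator_measurable_le.
exists (\bigcap_n B n); split.
- exact: bigcapT_measurable.
- apply: (@measure_le_expR_eq0 _ (expR t)); first exact: bigcapT_measurable.
  move=> n; apply: (@le_trans _ _ (P (B n))).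
    by rewrite le_measure ?inE//; [exact: bigcapT_measurable|exact: bigcap_inf].
  by rewrite (le_trans (@subordinator_markov _ t 1 _ _))// powR1 mulr1 mul1r expRD.
- by move=> w /= h n _; rewrite /B/= leNgt; apply/negP => tD; apply: h; exists n.+1%:R.
Qed.

(** If [D] is positive at every time [1 / (n + 1)], the infimum is [0]. Each exceptional event is
    null, by letting [s] grow in the Chernoff bound at level [0]. *)
Lemma ae_inverse_process0 : {ae P, forall w, Y 0 w = 0}.
Proof.
pose B n := [set w | D n.+1%:R^-1 w <= 0].
have n0 n : 0 <= n.+1%:R^-1 :> R by rewrite invr_ge0.
have mB n : measurable (B n) by exact: subordinator_measurable_le.
apply: (@negligibleS _ _ _ _ (\bigcup_n B n)); last first.
  apply: negligible_bigcup => n; exists (B n); split => //.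
  apply: (@measure_le_expR_eq0 _ 1) => // m.
  have /andP[b0 _] := b01.
  (* Solves [s ^ beta / (n + 1) = m + 1], so that the bound becomes [exp (- (m + 1))]. *)
  pose s : R := (n.+1%:R * m.+1%:R) `^ beta^-1.
  have := @subordinator_markov _ 0 s (n0 n) (powR_ge0 _ _).
  rewrite mulr0 sub0r /s -powRrM mulVf ?gt_eqF// powRr1 ?mulr_ge0//.
  by rewrite mulrA mulVf// mul1r mul1r.
move=> w /= h; apply: contrapT => /= nB; apply: h.
apply/eqP; rewrite eq_le inverse_process_ge0 andbT.
  apply/ler_addgt0Pr => e e0; rewrite add0r.
  pose n := Num.truncn e^-1.
  have ne : n.+1%:R^-1 <= e.
    by rewrite -[leRHS]invrK lef_pV2 ?posrE ?invr_gt0// ltW// truncnS_gt.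
  rewrite (le_trans _ ne)//; apply: ge_inf; first by exists 0 => y [/ltW].
  by rewrite /= invr_gt0; split => //; rewrite ltNge; apply/negP => Bn; apply: nB; exists n.
Qed.

(** Right continuity at [0] keeps [D] below [t] for a positive time. *)
Lemma inverse_process_gt0 t w : 0 < t -> (exists2 y, 0 < y & t < D y w) -> 0 < Y t w.
Proof.
move=> t0 ex.
have := @subordinator_right_continuous _ _ HD w 0 (lexx 0).
rewrite (subordinator_start HD) => /cvgrPdist_lt/(_ _ t0)[e /= e0 eD].
have e2 : 0 < e / 2 by rewrite divr_gt0.
have De : D (e / 2) w < t.
  have := eD (e / 2); rewrite /= !sub0r !normrN gtr0_norm// => /(_ _ e2).
  by rewrite ltr_pdivrMr// mulr_natr mulr2n ltrDl => /(_ e0); exact: le_lt_trans (ler_norm _).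
rewrite (lt_le_trans e2)// leNgt; apply/negP => /(inverse_process_gt ex).
by rewrite ltNge ltW.
Qed.

Let kernel_integral c t w : 0 < c -> 0 <= t -> (exists2 y, 0 < y & t < D y w) ->
  (\int[mu]_x (if (0 <= x)%R && (t < Dp (x, w))%R then (c * expR (- c * x))%:E else 0) =
   (expR (- c * Y t w))%:E)%E.
Proof.
move=> c0 t0 ex; have [b bE] := inverse_process_itv t0 ex.
have Y0 := inverse_process_ge0 t w.
have mcE : measurable_fun [set: measurableTypeR R] (fun x : R => (expR (- c * x))%:E).
  by apply/measurable_EFinP; apply: measurableT_comp => //; exact: measurable_funM.
transitivity (\int[mu]_(x in [set` Interval (BSide b (Y t w)) +oo%O]) (c%:E * (expR (- c * x))%:E))%E.
  rewrite lebesgue_integral_itv_if; apply: eq_integral => x _; rewrite -EFinM.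
  congr (if _ then _ else _).
  have := bE x; rewrite /Dp/=; case: (leP 0 x) => x0/=.
    rewrite leNgt => /(congr1 negb); rewrite negbK => ->.
    rewrite !itv_boundlr/= !bnd_simp x0/= andbT.
    by case: (b); rewrite bnd_simp -?leNgt -?ltNge.
  move=> _; apply/esym/negbTE; rewrite itv_boundlr/= andbT.
  by case: (b); rewrite bnd_simp -?leNgt -?ltNge ?(lt_le_trans x0) ?(le_trans (ltW x0)).
rewrite ge0_integralZl//; last 2 first.
- exact: measurable_funTS.
- by rewrite lee_fin ltW.
transitivity (c%:E * \int[mu]_(x in `[Y t w, +oo[) (expR (- c * x))%:E)%E.
  case: (b) => //; congr (_ * _)%E; apply: integral_itv_obnd_cbnd.
  exact: measurable_funTS.
by rewrite integral_expR_itvcy// -EFinM; congr EFin; field; rewrite gt_eqF.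
Qed.

Local Notation F c m := (fun z : (measurableTypeR R * T) * measurableTypeR R =>
  if ((0 <= z.1.1) && ((0 <= z.2) && (z.1.1 < Dp (z.2, z.1.2))))%R
  then (expR (- m * z.1.1) * (c * expR (- c * z.2)))%:E else 0%E).

Let mF c m : measurable_fun setT (F c m).
Proof.
have m1 : measurable_fun setT
    (fun z : (measurableTypeR R * T) * measurableTypeR R => z.1.1 : R).
  exact: (measurableT_comp measurable_fst measurable_fst).
have m2 : measurable_fun setT
    (fun z : (measurableTypeR R * T) * measurableTypeR R => z.2 : R).
  exact: measurable_snd.
have mD : measurable_fun setT
    (fun z : (measurableTypeR R * T) * measurableTypeR R => Dp (z.2, z.1.2)).
  apply: (measurableT_comp mDp); apply: measurable_fun_pair => //.
  exact: (measurableT_comp measurable_snd measurable_fst).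
apply: measurable_fun_ifT => //.
  apply: measurable_and; first exact: measurable_fun_ler.
  by apply: measurable_and; [exact: measurable_fun_ler|exact: measurable_fun_ltr].
apply/measurable_EFinP; apply: measurable_funM.
  by apply: measurableT_comp => //; exact: measurable_funM.
by apply: measurable_funM => //; apply: measurableT_comp => //; exact: measurable_funM.
Qed.

Let F_ge0 c m z : 0 < c -> (0 <= F c m z)%E.
Proof.
by move=> c0 /=; case: ifP => // _; rewrite lee_fin !mulr_ge0 ?expR_ge0// ltW.
Qed.

(* [exp (- c Y t)] is the integral of [c exp (- c x)] over [x] with [t < D x],
   so that after exchanging the integrals only the transform of [D x] is used. *)
Lemma inverse_process_double_laplace (c m : R) : 0 < c -> 0 < m ->
  (\int[mu]_(t in `[0%R, +oo[) ((expR (- m * t))%:E *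
     \int[P]_w (expR (- c * Y t w))%:E) = (m `^ (beta - 1) / (m `^ beta + c))%:E)%E.
Proof.
move=> c0 m0.
have f0 z : (0 <= F c m z)%E by exact: F_ge0.
have mFx : measurable_fun setT (fun z : measurableTypeR R * T =>
    \int[mu]_x F c m (z, x))%E.
  exact: (measurable_fun_fubini_tonelli_F _ (mF c m) f0).
transitivity (\int[mu]_t \int[P]_w \int[mu]_x F c m ((t, w), x))%E.
  rewrite lebesgue_integral_itv_if; apply: eq_integral => t _.
  have mFt : measurable_fun setT (fun w => \int[mu]_x F c m ((t, w), x))%E.
    exact: (measurableT_comp mFx (pair1_measurable t)).
  move: mFt; rewrite in_itv/= andbT; case: (leP 0 t) => t0 mFt; last first.
    by rewrite integral0_eq// => w _; rewrite integral0_eq.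
  have mY : measurable_fun setT (fun w => (expR (- c * Y t w))%:E).
    apply/measurable_EFinP; apply: measurableT_comp => //; apply: measurable_funM => //.
    exact: measurable_inverse_process.
  rewrite -(@ge0_integralZl _ _ _ P setT measurableT _ mY)//.
  (* The kernel formula for [exp (- c Y t)] needs a path exceeding [t], hence equality only almost
     everywhere. *)
  apply: ae_eq_integral => //.
    exact: measurable_funeM.
  have := ae_subordinator_unbounded t0; apply: filterS => w ex _.
  rewrite -(kernel_integral c0 t0 ex) -ge0_integralZl//.
  + by apply: eq_integral => x _ /=; case: ifP; rewrite ?mule0.
  + apply: measurable_fun_ifT => //.
      apply: measurable_and; first exact: measurable_fun_ler.
      apply: measurable_fun_ltr => //.
      exact: (measurableT_comp mDpL (pair2_measurable w)).
    apply/measurable_EFinP; apply: measurable_funM => //.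
    by apply: measurableT_comp => //; exact: measurable_funM.
  + by move=> x _; case: ifP => // _; rewrite lee_fin mulr_ge0 ?expR_ge0// ltW.
rewrite (@fubini_tonelli _ _ _ _ _ mu P (fun z => \int[mu]_x F c m (z, x))%E mFx); last first.
  by move=> z; apply: integral_ge0.
(* For fixed [x] the variable [t] runs over [[0, D x[], and integrating [exp (- m t)] gives
   [(1 - exp (- m D x)) / m]. *)
transitivity (\int[P]_w \int[mu]_x
   (if (0 <= x)%R then (m^-1 * (c * expR (- c * x)) * (1 - expR (- m * Dp (x, w))))%:E else 0))%E.
  apply: eq_integral => w _.
  pose G (z : measurableTypeR R * measurableTypeR R) := F c m ((z.1, w), z.2).
  have mG : measurable_fun setT G.
    apply: (measurableT_comp (mF c m)); apply: measurable_fun_pair => //.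
    exact: (measurableT_comp (pair2_measurable w) measurable_fst).
  rewrite (@fubini_tonelli _ _ _ _ _ mu mu G mG); last by move=> z; exact: f0.
  apply: eq_integral => x _; rewrite /G/=.
  case: (leP 0 x) => x0; last by rewrite integral0_eq// => t _; rewrite andbF.
  transitivity (\int[mu]_(t in `[0%R, Dp (x, w)[)
      ((c * expR (- c * x))%:E * (expR (- m * t))%:E))%E.
    rewrite lebesgue_integral_itv_if; apply: eq_integral => t _.
    by rewrite in_itv/= -EFinM mulrC.
  rewrite ge0_integralZl//; last first.
  - by rewrite lee_fin mulr_ge0 ?expR_ge0// ltW.
  - by apply: measurable_funTS; apply/measurable_EFinP; apply: measurableT_comp => //; exact: measurable_funM.
  rewrite integral_expR_itv0c//; last by rewrite /Dp/= subordinator_ge0// le_max lexx orbT.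
  by rewrite -EFinM; congr EFin; field; rewrite gt_eqF.
pose H (z : T * measurableTypeR R) : \bar R := if (0 <= z.2)%R then
  (m^-1 * (c * expR (- c * z.2)) * (1 - expR (- m * Dp (z.2, z.1))))%:E else 0%E.
have m2 : measurable_fun setT (fun z : T * measurableTypeR R => z.2 : R).
  exact: measurable_snd.
have mDpH : measurable_fun setT (fun z : T * measurableTypeR R => Dp (z.2, z.1)).
  by apply: (measurableT_comp mDp); apply: measurable_fun_pair.
have mH : measurable_fun setT H.
  apply: measurable_fun_ifT => //; first exact: measurable_fun_ler.
  apply/measurable_EFinP; apply: measurable_funM.
    apply: measurable_funM => //; apply: measurable_funM => //.
    by apply: measurableT_comp => //; exact: measurable_funM.
  apply: measurable_funB => //.
  by apply: measurableT_comp => //; exact: measurable_funM.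
have Dp0 x w : 0 <= Dp (x, w) by rewrite /Dp/= subordinator_ge0// le_max lexx orbT.
have eD1 x w : expR (- m * Dp (x, w)) <= 1.
  by rewrite expR_le1 mulNr oppr_le0 mulr_ge0// ltW.
have H0 z : (0 <= H z)%E.
  rewrite /H; case: ifP => // _; rewrite lee_fin !mulr_ge0 ?expR_ge0 ?invr_ge0 ?subr_ge0//;
    by [exact: ltW|exact: ltW c0].
rewrite (@fubini_tonelli _ _ _ _ _ P mu H mH H0).
pose M := m `^ beta; have M0 : 0 < M by exact: powR_gt0.
have cM0 : 0 < c + M by exact: addr_gt0.
(* Taking the expectation replaces [exp (- m D x)] by [exp (- x M)]; what remains is
   [(c / m) (1 / c - 1 / (c + M))]. *)
transitivity (\int[mu]_(x in `[0%R, +oo[) (m^-1 * (c * expR (- c * x)) -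
     m^-1 * (c * expR (- (c + M) * x)))%:E)%E.
  rewrite lebesgue_integral_itv_if; apply: eq_integral => x _; rewrite in_itv/= andbT /H/=.
  case: (leP 0 x) => x0; last by rewrite integral0_eq.
  have a0 : 0 <= m^-1 * (c * expR (- c * x)).
    by rewrite !mulr_ge0 ?expR_ge0 ?invr_ge0 ?(ltW c0) ?(ltW m0).
  have mDx : measurable_fun setT (D x) by exact: (subordinator_measurable HD).
  have DpE w : Dp (x, w) = D x w by rewrite /Dp/= max_l.
  under eq_integral do rewrite DpE EFinM.
  rewrite ge0_integralZl//; last first.
  - by move=> w _; rewrite lee_fin subr_ge0 -DpE.
  - apply/measurable_EFinP; apply: measurable_funB => //.
    by apply: measurableT_comp => //; exact: measurable_funM.
  rewrite (@ge0_integral_EFinB _ _ _ _ _ (cst 1) _ 1 (expR (- x * M)))//.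
  - rewrite -EFinM; congr EFin; rewrite mulrBr mulr1; congr (_ - _).
    rewrite -!mulrA; congr (_ * (_ * _)); rewrite -expRD; congr expR; ring.
  - by apply: measurableT_comp => //; exact: measurable_funM.
  - by move=> w _; rewrite expR_ge0/= -DpE.
  - transitivity (1%:E * P setT)%E; first exact: (integral_cst P measurableT 1%:E).
    by rewrite mul1e; exact: probability_setT.
  - by rewrite (subordinator_laplace HD)// ltW.
have mexp (a : R) : measurable_fun setT (fun x : R => m^-1 * (c * expR (- a * x))).
  apply: measurable_funM => //; apply: measurable_funM => //.
  by apply: measurableT_comp => //; exact: measurable_funM.
have intE (a : R) : 0 < a ->
    (\int[mu]_(x in `[0%R, +oo[) (m^-1 * (c * expR (- a * x)))%:E = (m^-1 * c / a)%:E)%E.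
  move=> a0; under eq_integral do rewrite mulrA EFinM.
  rewrite ge0_integralZl//.
  - by rewrite integral_expR_itvcy// mulr0 expR0 -EFinM div1r.
  - by apply: measurable_funTS; apply/measurable_EFinP; apply: measurableT_comp => //; exact: measurable_funM.
  - by rewrite lee_fin mulr_ge0 ?invr_ge0 ?(ltW c0) ?(ltW m0).
rewrite (@ge0_integral_EFinB _ _ _ _ _ _ _ (m^-1 * c / c) (m^-1 * c / (c + M)))//.
- congr EFin; rewrite /M.
  have -> : m `^ (beta - 1) = m `^ beta / m by rewrite (powR_subr1 beta m0) mulfK ?gt_eqF.
  by field; rewrite !gt_eqF//= addrC.
- exact: (measurable_funTS (mexp c)).
- exact: (measurable_funTS (mexp (c + M))).
- move=> x /=; rewrite in_itv/= andbT => x0.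
  rewrite !mulr_ge0 ?expR_ge0 ?invr_ge0 ?(ltW c0) ?(ltW m0)//=.
  rewrite ler_wpM2l ?invr_ge0 ?(ltW m0)// ler_wpM2l ?(ltW c0)// ler_expR.
  by rewrite !mulNr lerN2 ler_wpM2r// lerDl ltW.
- exact: intE.
- exact: intE.
Qed.

End inverse.

End subordinator.

(** * The law of the time-changed process *)

Section independent_processes.
Context {d : measure_display} {T : measurableType d} {R : realType}.
Variables (P : probability T R) (I : finType) (Z : I -> R -> T -> R).
Hypothesis mZ : forall i t, 0 <= t -> measurable_fun [set: T] (Z i t).
Implicit Types (i j : I) (J : {set I}) (t : R).

(* A pi-system generating the events of the processes indexed by [J]. *)
Definition joint_events J : set (set T) :=
  [set B | exists2 A : I -> set T, (forall j, sigma_of_process (Z j) (A j)) &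
           B = \bigcap_(j in [set` J]) A j].

Let path_events i := \bigcup_(t in [set t : R | 0 <= t]) sigma_of_variable (Z i t).

Let path_events_measurable i : path_events i `<=` measurable.
Proof.
by move=> _ [t /= t0 [B mB <-]]; exact: mZ.
Qed.

Let sigma_of_process_measurable i : sigma_of_process (Z i) `<=` measurable.
Proof. exact (g_sigma_algebra_sub_measurable (@path_events_measurable i)). Qed.

Let sigma_of_processT i : sigma_of_process (Z i) setT.
Proof. exact: (@measurableT _ (g_sigma_algebraType (path_events i))). Qed.

Let sigma_of_processI i : setI_closed (sigma_of_process (Z i)).
Proof. by move=> A B; exact: (@measurableI _ (g_sigma_algebraType (path_events i))). Qed.

Lemma joint_events_measurable J : joint_events J `<=` measurable.
Proof.
move=> _ [A FA ->]; apply: fin_bigcap_measurable => [|j _]; first exact: finite_finset.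
exact: sigma_of_process_measurable.
Qed.

Lemma measurable_joint_events J j t : j \in J -> 0 <= t ->
  measurable_fun [set: g_sigma_algebraType (joint_events J)] (Z j t).
Proof.
move=> jJ t0 _ B mB; rewrite setTI; apply: sub_gen_smallest.
exists (fun i => if i == j then Z j t @^-1` B else setT).
  move=> i; case: eqP => [->|_]; last exact: sigma_of_processT.
  apply: sub_gen_smallest; exists t => //; exists B => //; exact: setTI.
apply/seteqP; split=> [w Bw i _|w]; first by case: eqP.
by move=> /(_ j jJ); rewrite eqxx.
Qed.

Hypothesis indZ : mutually_independent P (fun i => sigma_of_process (Z i)).

Lemma independent_time_change i J (W : g_sigma_algebraType (joint_events J) -> R)
    (f : R * g_sigma_algebraType (joint_events J) -> \bar R) :
  i \notin J -> (forall w t, 0 <= t -> Z i s w @[s --> t^'+] --> Z i t w) ->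
  measurable_fun setT W -> (forall w, 0 <= W w) ->
  measurable_fun setT f -> (forall x, 0 <= f x)%E ->
  (\int[P]_w f (Z i (W w) w, w) = \int[P]_w \int[P]_w' f (Z i (W w) w', w))%E.
Proof.
move=> iJ cZ mW W0 mf f0.
pose G := path_events i.
have mZi : measurable_fun setT (fun x : R * g_sigma_algebraType G => Z i (Num.max x.1 0) x.2).
  apply: right_continuous_process_measurable => // t t0 _ B mB; rewrite setTI.
  by apply: sub_gen_smallest; exists t => //; exists B => //; exact: setTI.
pose f' (x : g_sigma_algebraType G * g_sigma_algebraType (joint_events J)) :=
  f (Z i (Num.max (W x.2) 0) x.1, x.2).
have mf' : measurable_fun setT f'.
  apply: (measurableT_comp mf); apply: measurable_fun_pair; last exact: measurable_snd.
  exact: (measurableT_comp mZi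
    (measurable_fun_pair (measurableT_comp mW measurable_snd) measurable_fst)).
have ind : independent_classes P <<s G >> <<s joint_events J >>.
  by apply: (@mutually_independent_classes _ _ _ P I (fun j => sigma_of_process (Z j))).
have fE x : f' x = f (Z i (W x.2) x.1, x.2) by rewrite /f' max_l.
have := independent_integral (path_events_measurable (i := i))
  (@joint_events_measurable J) ind mf' (fun x => f0 _).
under eq_integral do rewrite fE.
move=> ->; apply: eq_integral => w _; apply: eq_integral => w' _; exact: fE.
Qed.

End independent_processes.

Section nonnegative_law.
Context {d : measure_display} {T : measurableType d} {R : realType}.
Variable P : probability T R.
Local Open Scope ereal_scope.

Lemma integral_pushforward_itv (V : T -> R) (f : R -> \bar R) :
  measurable_fun setT V -> (forall w, 0 <= V w)%R ->
  measurable_fun setT f -> (forall x, 0 <= f x) ->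
  \int[pushforward P V]_(x in `[0%R, +oo[) f x = \int[P]_w f (V w).
Proof.
move=> mV V0 mf f0.
have mI : measurable (`[0%R, +oo[ : set R) by exact: measurable_itv.
rewrite -[LHS]/(\int[law P mV]_(x in `[0%R, +oo[) f x) integral_mkcond integral_law//.
- by apply: eq_integral => w _; rewrite patchE mem_set//= in_itv/= andbT.
- exact/(measurable_restrictT _ mI)/measurable_funTS.
- by move=> x; rewrite patchE; case: ifP.
Qed.

Lemma laplace_pushforward (V : T -> R) (eta : R) :
  measurable_fun setT V -> (forall w, 0 <= V w)%R ->
  laplace (pushforward P V) eta = \int[P]_w (expR (- eta * V w))%:E.
Proof.
move=> mV V0; rewrite /laplace (integral_pushforward_itv mV V0 (f := fun x => (expR (- eta * x))%:E))//.
by apply/measurable_EFinP; apply: measurableT_comp => //; exact: measurable_funM.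
Qed.

Lemma law_unique (U V : T -> R) :
  measurable_fun setT U -> measurable_fun setT V ->
  (forall w, 0 <= U w)%R -> (forall w, 0 <= V w)%R ->
  (forall s : R, (0 < s)%R ->
    \int[P]_w (expR (- s * U w))%:E = \int[P]_w (expR (- s * V w))%:E) ->
  forall A, measurable A -> P (U @^-1` A) = P (V @^-1` A).
Proof.
move=> mU mV U0 V0 UV A mA.
have carried (W : T -> R) (mW : measurable_fun setT W) : (forall w, 0 <= W w)%R ->
    law P mW `[0%R, +oo[%classic = 1.
  move=> W0; rewrite -[LHS]/(P (W @^-1` `[0%R, +oo[%classic)).
  rewrite (_ : _ @^-1` _ = setT); first exact: probability_setT.
  by apply/seteqP; split=> // w _ /=; rewrite in_itv/= andbT.
apply: (@laplace_unique _ (law P mU) (law P mV)) => // [||s s0]; try exact: carried.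
rewrite -[LHS]/(laplace (pushforward P U) s) -[RHS]/(laplace (pushforward P V) s).
by rewrite (laplace_pushforward _ mU U0) (laplace_pushforward _ mV V0) UV.
Qed.

(** Self-similarity: both transforms at [eta] equal [exp (- b ^ alpha * s * eta ^ alpha)]. *)
Lemma subordinator_scaling alpha (D : R -> T -> R) (b s : R) :
  (0 < alpha)%R -> subordinator P alpha D -> (0 <= b)%R -> (0 <= s)%R ->
  forall A, measurable A ->
  P [set w | A (b * D s w)%R] = P [set w | A (D (b `^ alpha * s)%R w)].
Proof.
move=> a0 HD b0 s0.
have bs0 : (0 <= b `^ alpha * s)%R by rewrite mulr_ge0// powR_ge0.
apply: (@law_unique (fun w => b * D s w)%R (D (b `^ alpha * s)%R)).
- by apply: measurable_funM => //; exact: (subordinator_measurable HD).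
- exact: (subordinator_measurable HD).
- by move=> w; rewrite mulr_ge0// (subordinator_ge0 HD).
- by move=> w; rewrite (subordinator_ge0 HD).
move=> eta eta0; rewrite (subordinator_laplace HD)// ?(ltW eta0)//.
under eq_integral do rewrite mulrA mulNr.
rewrite (subordinator_laplace HD s0 (mulr_ge0 (ltW eta0) b0)).
by rewrite powRM ?(ltW eta0)//; congr (expR _)%:E; ring.
Qed.

End nonnegative_law.

Lemma total_rate_gt0 {R : realType} (k : nat) (lambda : 'I_k -> R) :
  (0 < k)%N -> (forall j, 0 < lambda j) -> 0 < total_rate lambda.
Proof.
rewrite /total_rate; case: k lambda => // k' l _ l0.
by rewrite big_ord_recl ltr_pwDl// sumr_ge0// => j _; exact: ltW.
Qed.

Lemma measurable_time_change {d : measure_display} {S : measurableType d} {R : realType}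
    (Z : R -> S -> R) (W : S -> R) :
  (forall t, 0 <= t -> measurable_fun setT (Z t)) ->
  (forall w t, 0 <= t -> Z s w @[s --> t^'+] --> Z t w) ->
  measurable_fun setT W -> (forall w, 0 <= W w) ->
  measurable_fun setT (fun w => Z (W w) w).
Proof.
move=> mZ cZ mW W0.
have -> : (fun w => Z (W w) w) = (fun w => Z (Num.max (W w, w).1 0) (W w, w).2).
  by apply/funext => w /=; rewrite max_l.
have mWid : measurable_fun setT (fun w : S => (W w, w)) by exact: measurable_fun_pair.
exact: (measurableT_comp (right_continuous_process_measurable mZ cZ) mWid).
Qed.

Section series_of_finite_sums.
Context {d : measure_display} {T : measurableType d} {R : realType}.
Variables (D : set T) (mD : measurable D).
Variables (I : nat -> finType) (O : forall n, {set I n}) (f : forall n, I n -> T -> \bar R).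
Hypothesis mf : forall n x, measurable_fun D (f (n := n) x).
Hypothesis f0 : forall n x w, (0 <= f (n := n) x w)%E.

Lemma measurable_sum_in n : measurable_fun D (fun w => \sum_(x in O n) f x w)%E.
Proof.
under eq_fun do rewrite -big_enum/=.
exact: emeasurable_sum.
Qed.

Lemma measurable_nneseries_sum :
  measurable_fun D (fun w => \sum_(0 <= n <oo) \sum_(x in O n) f x w)%E.
Proof.
apply: ge0_emeasurable_sum => [n w _ _|n _]; first exact: sume_ge0.
exact: measurable_sum_in.
Qed.

Lemma integral_nneseries_sum (mu : {measure set T -> \bar R}) :
  (\int[mu]_(w in D) (\sum_(0 <= n <oo) \sum_(x in O n) f x w) =
   \sum_(0 <= n <oo) \sum_(x in O n) \int[mu]_(w in D) f x w)%E.
Proof.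
rewrite integral_nneseries//; last 2 first.
- by move=> n; exact: measurable_sum_in.
- by move=> n w _; exact: sume_ge0.
apply: eq_eseriesr => n _; under eq_integral do rewrite -big_enum/=.
by rewrite ge0_integral_sum// big_enum.
Qed.

End series_of_finite_sums.

Lemma ge0_integral_nat {d : measure_display} {T : measurableType d} {R : realType}
    (mu : {measure set T -> \bar R}) (N : T -> nat) (f : nat -> \bar R) :
  (forall j, measurable [set w | N w = j]) -> (forall n, 0 <= f n)%E ->
  (\int[mu]_w f (N w) = \sum_(0 <= n <oo) f n * mu [set w | N w = n])%E.
Proof.
move=> mN f0; have UN : \bigcup_n [set w | N w = n] = setT.
  by apply/seteqP; split=> // w _; exists (N w).
rewrite -UN ge0_integral_bigcup//.
- apply: eq_eseriesr => n _; rewrite (eq_integral (cst (f n))); last first.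
    by move=> w; rewrite inE => <-.
  by rewrite integral_cst.
- by rewrite UN; exact: (measurableT_comp (f := f) _ (measurable_fun_nat mN)).
- by apply/trivIsetP => i j _ _ ij; apply/seteqP; split=> // w [/= -> /eqP]; exact/negP.
Qed.

(** * Freezing the components of the time-changed process *)

Section time_changed_counting_process.
Context {d : measure_display} {T : measurableType d} {R : realType}.
Variables (P : probability T R) (alpha gamma beta b : R).
Hypotheses (alpha0 : 0 < alpha) (b0 : 0 <= b).
Variables (k : nat) (lambda : 'I_k -> R).
Hypotheses (k0 : (0 < k)%N) (lambda0 : forall j, 0 < lambda j).
Variables (M : R -> T -> nat) (Dgamma Dalpha Dbeta : R -> T -> R).
Hypothesis HM : generalized_counting_process P lambda M.
Hypothesis Hgamma : subordinator P gamma Dgamma.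
Hypothesis Halpha : subordinator P alpha Dalpha.
Hypothesis Hbeta : subordinator P beta Dbeta.

Let Y := inverse_process Dbeta.
Let X := time_changed b M Dgamma Dalpha Y.
Let Z (i : 'I_4) : R -> T -> R :=
  nth (fun _ _ => 0) [:: (fun t w => (M t w)%:R); Dgamma; Dalpha; Y] i.
Hypothesis indZ : mutually_independent P (fun i => sigma_of_process (Z i)).

Let i0 : 'I_4 := Ordinal (isT : 0 < 4)%N.
Let i1 : 'I_4 := Ordinal (isT : 1 < 4)%N.
Let i2 : 'I_4 := Ordinal (isT : 2 < 4)%N.
Let i3 : 'I_4 := Ordinal (isT : 3 < 4)%N.

Let lambda_ge0 j : 0 <= lambda j. Proof. exact: ltW. Qed.

Let Z_measurable i t : 0 <= t -> measurable_fun setT (Z i t).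
Proof.
move=> t0; case: i => -[|[|[|[|//]]]] hi; rewrite /Z/=.
- exact: (levy_measurable (gcp_levy HM)).
- exact: (subordinator_measurable Hgamma).
- exact: (subordinator_measurable Halpha).
- exact: (measurable_inverse_process Hbeta).
Qed.

Let M_right_continuous w t : 0 <= t -> (M s w)%:R @[s --> t^'+] --> ((M t w)%:R : R).
Proof. by move=> t0; have [+ _] := levy_cadlag (gcp_levy HM) w; apply. Qed.

Let Dgamma_right_continuous := subordinator_right_continuous Hgamma.
Let Dalpha_right_continuous := subordinator_right_continuous Halpha.

Let Y_ge0 t w : 0 <= Y t w. Proof. exact: inverse_process_ge0. Qed.

Variable t : R.
Hypothesis t0 : 0 <= t.

Let U w := Dgamma (Y t w) w.
Let V w := Dalpha (Y t w) w.

Let U_ge0 w : 0 <= U w. Proof. exact: (subordinator_ge0 Hgamma). Qed.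

Let Y_joint (J : {set 'I_4}) : i3 \in J ->
  measurable_fun [set: g_sigma_algebraType (joint_events Z J)] (Y t).
Proof. by move=> J3; exact: (measurable_joint_events J3 t0). Qed.

Let U_joint (J : {set 'I_4}) : i1 \in J -> i3 \in J ->
  measurable_fun [set: g_sigma_algebraType (joint_events Z J)] U.
Proof.
move=> J1 J3; apply: measurable_time_change => //; last exact: Y_joint.
by move=> s s0; exact: (measurable_joint_events J1 s0).
Qed.

Let V_joint (J : {set 'I_4}) : i2 \in J -> i3 \in J ->
  measurable_fun [set: g_sigma_algebraType (joint_events Z J)] V.
Proof.
move=> J2 J3; apply: measurable_time_change => //; last exact: Y_joint.
by move=> s s0; exact: (measurable_joint_events J2 s0).
Qed.

Let mY : measurable_fun setT (Y t). Proof. exact: (measurable_inverse_process Hbeta). Qed.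
Let mU : measurable_fun setT U.
Proof. by apply: measurable_time_change => //; exact: (subordinator_measurable Hgamma). Qed.
Let mV : measurable_fun setT V.
Proof. by apply: measurable_time_change => //; exact: (subordinator_measurable Halpha). Qed.

Let mMU : measurable_fun setT (fun w => (M (U w) w)%:R : R).
Proof.
apply: (@measurable_time_change _ _ _ (fun t w => (M t w)%:R)) => //.
exact: (levy_measurable (gcp_levy HM)).
Qed.

Lemma measurable_time_changed : measurable_fun setT (X t).
Proof. by apply: measurable_funD => //; exact: measurable_funM. Qed.

Lemma time_changed_integral_counting (f : R -> \bar R) :
  measurable_fun setT f -> (forall x, 0 <= f x)%E ->
  (\int[P]_w f (X t w) = \int[P]_w \int[P]_w' f ((M (U w) w')%:R + b * V w)%R)%E.
Proof.
move=> mf f0; pose J := [set i1; i2; i3]%SET.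
have [J1 J2 J3] : [/\ i1 \in J, i2 \in J & i3 \in J] by rewrite !inE.
apply: (@independent_time_change _ _ _ P _ Z Z_measurable indZ i0 J U
  (fun x => f (x.1 + b * V x.2)%R)) => //.
- by rewrite !inE.
- exact: U_joint.
- apply: (measurableT_comp mf); apply: measurable_funD; first exact: measurable_fst.
  apply: measurable_funM => //.
  exact: (measurableT_comp (V_joint J2 J3) measurable_snd).
Qed.

Lemma time_changed_integral_alpha (f : R * R -> \bar R) :
  measurable_fun setT f -> (forall x, 0 <= f x)%E ->
  (\int[P]_w f (U w, V w) = \int[P]_w \int[P]_w' f (U w, Dalpha (Y t w) w'))%E.
Proof.
move=> mf f0; pose J := [set i1; i3]%SET.
have [J1 J3] : i1 \in J /\ i3 \in J by rewrite !inE.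
apply: (@independent_time_change _ _ _ P _ Z Z_measurable indZ i2 J (Y t)
  (fun x => f (U x.2, x.1))) => //.
- by rewrite !inE.
- exact: Y_joint.
- apply: (measurableT_comp mf); apply: measurable_fun_pair; last exact: measurable_fst.
  exact: (measurableT_comp (U_joint J1 J3) measurable_snd).
Qed.

Lemma time_changed_integral_gamma (f : R * R -> \bar R) :
  measurable_fun setT f -> (forall x, 0 <= f x)%E ->
  (\int[P]_w f (U w, Y t w) = \int[P]_w \int[P]_w' f (Dgamma (Y t w) w', Y t w))%E.
Proof.
move=> mf f0; pose J := [set i3]%SET.
have J3 : i3 \in J by rewrite !inE.
apply: (@independent_time_change _ _ _ P _ Z Z_measurable indZ i1 J (Y t)
  (fun x => f (x.1, Y t x.2))) => //.
- by rewrite !inE.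
- exact: Y_joint.
- apply: (measurableT_comp mf); apply: measurable_fun_pair; first exact: measurable_fst.
  exact: (measurableT_comp (Y_joint J3) measurable_snd).
Qed.

(** The components are averaged out in the order [M], [Dalpha], [Dgamma]: each average is an
    exponential in the clock of the averaged process, so the next step has the same shape. *)
Lemma time_changed_laplace eta : 0 < eta ->
  (\int[P]_w (expR (- eta * X t w))%:E = \int[P]_w (expR
     (- (laplace_exponent lambda eta `^ gamma + b `^ alpha * eta `^ alpha) * Y t w))%:E)%E.
Proof.
move=> eta0; set S := laplace_exponent lambda eta.
have S0 : 0 <= S by apply: laplace_exponent_ge0 => //; exact: ltW.
have be0 : 0 <= eta * b by rewrite mulr_ge0// ltW.
have mexp (d' : measure_display) (S' : measurableType d') (c : R) (f : S' -> R) :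
    measurable_fun setT f -> measurable_fun setT (fun x => expR (c * f x)).
  by move=> mf; apply: measurableT_comp => //; exact: measurable_funM.
rewrite (time_changed_integral_counting (f := fun x => (expR (- eta * x))%:E)); last 2 first.
- by apply/measurable_EFinP; exact: mexp.
- by move=> x; rewrite lee_fin expR_ge0.
pose f1 (z : R * R) := (expR (- S * z.1) * expR (- (eta * b) * z.2))%:E.
have mf1 : measurable_fun setT f1.
  by apply/measurable_EFinP; apply: measurable_funM; apply: mexp.
transitivity (\int[P]_w f1 (U w, V w))%E.
  apply: eq_integral => w _.
  under eq_integral do rewrite mulrDr expRD EFinM.
  rewrite ge0_integralZr//; last first.
  - by apply/measurable_EFinP; apply: mexp; exact: (levy_measurable (gcp_levy HM)).
  rewrite (gcp_laplace lambda_ge0 HM) ?(ltW eta0)// -EFinM /f1/=; congr (expR _ * expR _)%:E.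
    by rewrite -/S; ring.
  by ring.
rewrite (time_changed_integral_alpha mf1); last by move=> z; rewrite lee_fin mulr_ge0 ?expR_ge0.
pose f2 (z : R * R) := (expR (- S * z.1) * expR (- (eta * b) `^ alpha * z.2))%:E.
have mf2 : measurable_fun setT f2.
  by apply/measurable_EFinP; apply: measurable_funM; apply: mexp.
transitivity (\int[P]_w f2 (U w, Y t w))%E.
  apply: eq_integral => w _; rewrite /f1 /f2/=.
  under eq_integral do rewrite EFinM.
  rewrite ge0_integralZl//; last first.
  - by apply/measurable_EFinP; apply: mexp; exact: (subordinator_measurable Halpha).
  by rewrite (subordinator_laplace Halpha)// -EFinM; congr (_ * expR _)%:E; ring.
rewrite (time_changed_integral_gamma mf2); last by move=> z; rewrite lee_fin mulr_ge0 ?expR_ge0.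
apply: eq_integral => w _; rewrite /f2/=.
under eq_integral do rewrite EFinM.
rewrite ge0_integralZr//; last first.
- by apply/measurable_EFinP; apply: mexp; exact: (subordinator_measurable Hgamma).
rewrite (subordinator_laplace Hgamma)// -EFinM -expRD; congr (expR _)%:E.
by rewrite powRM ?(ltW eta0)//; ring.
Qed.

Section mixture.
Variable phi : R -> R.
Hypothesis phi0 : forall s, 0 <= s -> 0 <= phi s.
Hypothesis mphi : measurable_fun setT (fun s : R => phi (Num.max s 0)).

Lemma exponential_mixtureE L : 0 <= L ->
  exponential_mixture gamma (pushforward P (Y t)) phi L =
  fine (\int[P]_w (expR (- L * U w) * phi (Y t w))%:E)%E.
Proof.
move=> L0; have max0 (s : R) : 0 <= Num.max s 0 by rewrite le_max lexx orbT.
have p0 (s : R) : 0 <= phi (Num.max s 0) by rewrite phi0.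
have maxY w : Num.max (Y t w) 0 = Y t w by rewrite max_l.
have mexp (d' : measure_display) (S' : measurableType d') (c : R) (f : S' -> R) :
    measurable_fun setT f -> measurable_fun setT (fun x => expR (c * f x)).
  by move=> mf; apply: measurableT_comp => //; exact: measurable_funM.
pose f1 (s : R) := (expR (- L `^ gamma * s) * phi (Num.max s 0))%:E.
have mf1 : measurable_fun setT f1.
  by apply/measurable_EFinP; apply: measurable_funM => //; exact: mexp.
pose f2 (z : R * R) := (expR (- L * z.1) * phi (Num.max z.2 0))%:E.
have mf2 : measurable_fun setT f2.
  apply/measurable_EFinP; apply: measurable_funM; first exact: mexp.
  exact: (measurableT_comp mphi measurable_snd).
rewrite /exponential_mixture; congr fine.
transitivity (\int[pushforward P (Y t)]_(s in `[0%R, +oo[) f1 s)%E.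
  apply: (@eq_integral _ _ _ (law P mY)) => s; rewrite inE/= in_itv/= andbT => s0.
  by rewrite /f1 max_l//; congr (expR _ * _)%:E; ring.
rewrite integral_pushforward_itv//; last by move=> s; rewrite lee_fin mulr_ge0 ?expR_ge0.
transitivity (\int[P]_w f2 (U w, Y t w))%E; last first.
  by apply: eq_integral => w _; rewrite /f2/= maxY.
rewrite (time_changed_integral_gamma mf2); last by move=> z; rewrite lee_fin mulr_ge0 ?expR_ge0.
apply: eq_integral => w _; rewrite /f1 /f2/=.
under [RHS]eq_integral do rewrite EFinM.
rewrite ge0_integralZr//; last 2 first.
- by apply/measurable_EFinP; apply: mexp; exact: (subordinator_measurable Hgamma).
- by rewrite lee_fin p0.
by rewrite (subordinator_laplace Hgamma)// -EFinM; congr (expR _ * _)%:E; ring.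
Qed.

(** Rewritten through [U], the mixture is an ordinary Laplace integral in [L], and finiteness at one
    [L0] to the left of [L] gives all its derivatives at [L]. *)
Lemma derive1n_exponential_mixture L0 L z :
  (\int[P]_w (expR (- L0 * U w) * phi (Y t w))%:E < +oo)%E -> 0 <= L0 < L ->
  (-1) ^+ z * derive1n z (exponential_mixture gamma (pushforward P (Y t)) phi) L =
  fine (\int[P]_w (U w ^+ z * expR (- L * U w) * phi (Y t w))%:E)%E.
Proof.
move=> fin /andP[L00 L0L].
have mphiY : measurable_fun setT (fun w => phi (Y t w)).
  rewrite (_ : (fun w => _) = (fun s => phi (Num.max s 0)) \o Y t).
    exact: measurableT_comp.
  by apply/funext => w /=; rewrite max_l.
apply: (derive1n_laplace mU mphiY U_ge0 _ fin _ z L0L) => [w|l L0l].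
  by rewrite phi0.
by rewrite exponential_mixtureE// (le_trans L00)// ltW.
Qed.

End mixture.

Let Lambda0 : 0 < total_rate lambda. Proof. exact: total_rate_gt0. Qed.

Let coef n (x : {ffun 'I_k -> 'I_n.+1}) : R :=
  \prod_(j < k) (lambda j ^+ x j / (x j)`!%:R).

Let coef_ge0 n (x : {ffun 'I_k -> 'I_n.+1}) : 0 <= coef x.
Proof. by apply: prodr_ge0 => j _; rewrite divr_ge0// exprn_ge0// ltW. Qed.

Let deg n (x : {ffun 'I_k -> 'I_n.+1}) : nat := (\sum_(j < k) x j)%N.

Let shift_probability (A : set R) (n : nat) (s : R) : R :=
  fine (P [set w | A (Dalpha (b `^ alpha * s) w + n%:R)]).

Let shift_probability_measurable A n : measurable A ->
  measurable_fun setT (fun s : R => shift_probability A n (Num.max s 0)).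
Proof.
move=> mA; apply: (measurableT_comp (fine_measurable measurableT)).
pose q (x : R * T) := Dalpha (Num.max (b `^ alpha * Num.max x.1 0) 0) x.2 + n%:R.
have mD : measurable_fun [set: R * T] (fun x => Dalpha (Num.max x.1 0) x.2).
  apply: right_continuous_process_measurable => //.
  exact: (subordinator_measurable Halpha).
have mp : measurable_fun [set: R * T] (fun x => (b `^ alpha * Num.max x.1 0, x.2)).
  apply: measurable_fun_pair => //; apply: measurable_funM => //.
  by apply: measurable_maxr.
have mq : measurable_fun setT q.
  by apply: measurable_funD => //; exact: (measurableT_comp mD mp).
have := mq measurableT _ mA; rewrite setTI => /(@measurable_fun_xsection _ _ _ _ _ P).
apply: eq_measurable_fun => s _ /=; congr (P _); apply/seteqP; split=> w /=;
  by rewrite xsectionE/= /q/= [Num.max (_ * _) 0]max_l// mulr_ge0 ?powR_ge0// le_max lexx orbT.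
Qed.

(** The law before any derivative appears. Both the identity of measures and the density statement
    start from these nonnegative expectations. *)
Lemma time_changed_law_integral A : measurable A -> P (X t @^-1` A) =
  (\sum_(0 <= n <oo) \sum_(x in Omega k n) (coef x)%:E * \int[P]_w
     (U w ^+ deg x * expR (- total_rate lambda * U w) * shift_probability A n (Y t w))%:E)%E.
Proof.
move=> mA; have m1A : measurable_fun setT (fun x : R => (\1_A x : R)%:E).
  by apply/measurable_EFinP; exact: measurable_indic.
pose e z (u : R) := u ^+ z * expR (- total_rate lambda * u).
have me z : measurable_fun setT (e z).
  by apply: measurable_funM => //; apply: measurableT_comp => //; exact: measurable_funM.
have e0 z (u : R) : 0 <= u -> 0 <= e z u by move=> u0; rewrite mulr_ge0 ?exprn_ge0 ?expR_ge0.
pose i n (v : R) : R := \1_A (n%:R + b * v).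
have mi n : measurable_fun setT (i n).
  apply: measurableT_comp; first exact: measurable_indic.
  by apply: measurable_funD => //; exact: measurable_funM.
have iE0 n v : 0 <= i n v by [].
transitivity (\int[P]_w (\1_A (X t w))%:E)%E.
  have mX := measurable_time_changed.
  transitivity (\int[P]_w (\1_(X t @^-1` A) w)%:E)%E => //.
  rewrite integral_indic ?setIT//.
  by rewrite -[X in measurable X]setTI; exact: mX.
rewrite (time_changed_integral_counting m1A)//.
transitivity (\int[P]_w \sum_(0 <= n <oo)
    \sum_(x in Omega k n) (coef x)%:E * (e (deg x) (U w) * i n (V w))%:E)%E.
  apply: eq_integral => w _.
  have mM n := gcp_measurable_eq HM n (U_ge0 w).
  rewrite (@ge0_integral_nat _ _ _ P (M (U w)) (fun n => (i n (V w))%:E))//; last first.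
    by move=> n; rewrite lee_fin.
  apply: eq_eseriesr => n _.
  transitivity ((i n (V w))%:E * P [set w' | M (U w) w' = n])%E => //.
  rewrite (gcp_law lambda_ge0 HM)// -EFinM mulr_sumr -sumEFin.
  by apply: eq_bigr => x _; rewrite -EFinM /e -/(coef x) -/(deg x); congr EFin; ring.
have mterm n x : measurable_fun setT (fun w => (e x (U w) * i n (V w))%:E).
  by apply/measurable_EFinP; apply: measurable_funM; exact: measurableT_comp.
have term0 n x w : (0 <= (e x (U w) * i n (V w))%:E)%E.
  by rewrite lee_fin mulr_ge0// e0.
rewrite (@integral_nneseries_sum _ T R setT measurableT
  (fun n => {ffun 'I_k -> 'I_n.+1}) (Omega k)
  (fun n x w => (coef x)%:E * (e (deg x) (U w) * i n (V w))%:E)%E); last 2 first.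
- by move=> n x; exact: measurable_funeM.
- by move=> n x w; rewrite mule_ge0// lee_fin.
apply: eq_eseriesr => n _; apply: eq_bigr => x _; rewrite ge0_integralZl//; last by rewrite lee_fin.
congr (_ * _)%E.
pose f (z : R * R) := (e (deg x) z.1 * i n z.2)%:E.
(* Freezing asks for a function nonnegative on the whole plane, whereas odd powers of [u] are
   negative for [u < 0]. *)
pose f' (z : R * R) := (e (deg x) (Num.max z.1 0) * i n z.2)%:E.
have fE w v : f' (U w, v) = f (U w, v) by rewrite /f' /f/= max_l.
have mf' : measurable_fun setT f'.
  apply/measurable_EFinP; apply: measurable_funM; last exact: (measurableT_comp (mi n) measurable_snd).
  apply: measurableT_comp => //; exact: measurable_maxr.
transitivity (\int[P]_w f' (U w, V w))%E; first by apply: eq_integral => w _; rewrite fE.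
rewrite time_changed_integral_alpha//; last first.
  by move=> z; rewrite lee_fin mulr_ge0// e0// le_max lexx orbT.
apply: eq_integral => w _; under eq_integral do rewrite fE /f/= EFinM.
have mDw : measurable_fun setT (Dalpha (Y t w)) by exact: (subordinator_measurable Halpha).
rewrite ge0_integralZl//; last 3 first.
- by apply/measurable_EFinP; exact: measurableT_comp.
- by move=> w' _; rewrite lee_fin.
- by rewrite lee_fin e0.
rewrite [RHS]EFinM; congr (_ * _)%E.
have mA' : measurable [set y | A (y + n%:R)].
  have mD : measurable_fun setT (fun y : R => y + n%:R) by exact: measurable_funD.
  by have := mD measurableT _ mA; rewrite setTI.
have := subordinator_scaling alpha0 Halpha b0 (Y_ge0 t w) mA'.
rewrite /shift_probability fineK ?fin_num_measure//; last first.
  have mDn : measurable_fun setT (fun w' => Dalpha (b `^ alpha * Y t w) w').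
    by apply: (subordinator_measurable Halpha); rewrite mulr_ge0 ?powR_ge0.
  by have := mDn measurableT _ mA'; rewrite setTI.
move=> <-; transitivity (\int[P]_w' (\1_[set w' | A (b * Dalpha (Y t w) w' + n%:R)] w')%:E)%E.
  apply: eq_integral => w' _; rewrite /i !indicE; congr (_%:R)%:E; congr nat_of_bool.
  by apply/idP/idP; rewrite !inE/= addrC.
rewrite integral_indic ?setIT//.
have mb : measurable_fun setT (fun w' => b * Dalpha (Y t w) w') by exact: measurable_funM.
by have := mb measurableT _ mA'; rewrite setTI.
Qed.

Lemma time_changed_law A : measurable A -> P (X t @^-1` A) =
  law_series lambda gamma (pushforward P (Y t)) (shift_probability A).
Proof.
move=> mA; rewrite time_changed_law_integral// /law_series.
apply: eq_eseriesr => n _; apply: eq_bigr => x _.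
have p0 s : 0 <= shift_probability A n s by rewrite fine_ge0.
have mp := shift_probability_measurable n mA.
have mpY : measurable_fun setT (fun w => shift_probability A n (Y t w)).
  rewrite (_ : (fun w => _) = (fun s => shift_probability A n (Num.max s 0)) \o Y t).
    exact: measurableT_comp.
  by apply/funext => w /=; rewrite max_l.
have p1 w : shift_probability A n (Y t w) <= 1.
  have mS : measurable [set w' | A (Dalpha (b `^ alpha * Y t w) w' + n%:R)].
    have mD : measurable_fun setT (fun w' => Dalpha (b `^ alpha * Y t w) w' + n%:R).
      apply: measurable_funD => //; apply: (subordinator_measurable Halpha).
      by rewrite mulr_ge0 ?powR_ge0.
    by have := mD measurableT _ mA; rewrite setTI.
  by rewrite -[leRHS]/(fine 1%:E) fine_le ?fin_num_measure// probability_le1.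
(* Probabilities are bounded by [1], so [L0 = 0] is an admissible base point. *)
have fin : (\int[P]_w (expR (- 0 * U w) * shift_probability A n (Y t w))%:E < +oo)%E.
  apply: (@le_lt_trans _ _ (\int[P]_w (cst 1%:E w))%E); last first.
    by rewrite integral_cst// mul1e [X in (X < _)%E](probability_setT P) ltry.
  apply: ge0_le_integral => //.
  - by move=> w _; rewrite lee_fin mulr_ge0 ?expR_ge0.
  - apply/measurable_EFinP; apply: measurable_funM => //.
    by apply: measurableT_comp => //; exact: measurable_funM.
  - by move=> w _; rewrite oppr0 mul0r expR0 mul1r lee_fin.
have L01 : 0 <= (0 : R) < total_rate lambda by rewrite lexx.
rewrite [RHS]EFinM -/(coef x) -/(deg x); congr (_ * _)%E.
rewrite (derive1n_exponential_mixture (fun s _ => p0 s) mp (deg x) fin L01) fineK//.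
rewrite ge0_fin_numE; last first.
  by apply: integral_ge0 => w _; rewrite lee_fin !mulr_ge0 ?exprn_ge0 ?expR_ge0.
exact: (laplace_moment_lty mU mpY U_ge0 (fun w => p0 _) fin).
Qed.

(** * The law as a density when [D_alpha] has densities *)

Section density.
Local Notation leb := (@lebesgue_measure R).
Hypothesis t_gt0 : 0 < t.
Hypothesis b_gt0 : 0 < b.
Variable ga : R -> R -> R.
Hypothesis mga : measurable_fun [set: R * R] (fun xu : R * R => ga xu.1 xu.2).
Hypothesis ga0 : forall x u, 0 <= ga x u.
Hypothesis density_ga : forall u, 0 < u -> forall A, measurable A ->
  P (Dalpha u @^-1` A) = (\int[leb]_(x in A) (ga x u)%:E)%E.

Let phi n x s := ga (x - n%:R) (b `^ alpha * s).

Let mix z L n x : \bar R :=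
  (\int[P]_w (U w ^+ z * expR (- L * U w) * phi n x (Y t w))%:E)%E.

Let kernel z L n (q : measurableTypeR R * T) : \bar R :=
  (U q.2 ^+ z * expR (- L * U q.2) * phi n q.1 (Y t q.2))%:E.

Let mphi n : measurable_fun [set: measurableTypeR R * T] (fun q => phi n q.1 (Y t q.2)).
Proof.
have mq : measurable_fun [set: measurableTypeR R * T]
    (fun q => (q.1 - n%:R, b `^ alpha * Y t q.2) : R * R).
  apply: measurable_fun_pair.
    by apply: measurable_funB => //; exact: measurable_fst.
  by apply: measurable_funM => //; exact: (measurableT_comp mY measurable_snd).
exact: (measurableT_comp mga mq).
Qed.

Let mkernel z L n : measurable_fun setT (kernel z L n).
Proof.
apply/measurable_EFinP; apply: measurable_funM; last exact: mphi.
have mU2 : measurable_fun [set: measurableTypeR R * T] (fun q => U q.2).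
  exact: (measurableT_comp mU measurable_snd).
apply: measurable_funM; first exact: measurable_funX.
by apply: measurableT_comp => //; exact: measurable_funM.
Qed.

Let kernel0 z L n q : (0 <= kernel z L n q)%E.
Proof. by rewrite lee_fin !mulr_ge0 ?exprn_ge0 ?expR_ge0 ?ga0. Qed.

Let mmix z L n : measurable_fun [set: measurableTypeR R] (mix z L n).
Proof. exact: (measurable_fun_fubini_tonelli_F _ (mkernel z L n) (kernel0 z L n)). Qed.

Let mix0 z L n x : (0 <= mix z L n x)%E.
Proof. by apply: integral_ge0 => w _; exact: (kernel0 z L n (x, w)). Qed.

Let phi_integral A n u : measurable A -> 0 < u ->
  (\int[leb]_(x in A) (phi n x u)%:E)%E = (shift_probability A n u)%:E.
Proof.
move=> mA u0; have bu0 : 0 < b `^ alpha * u by rewrite mulr_gt0// powR_gt0.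
have mD : measurable_fun setT (Dalpha (b `^ alpha * u)).
  by apply: (subordinator_measurable Halpha); exact: ltW.
have mA' : measurable [set y : R | A (y + n%:R)].
  have ms : measurable_fun setT (fun y : R => y + n%:R) by exact: measurable_funD.
  by have := ms measurableT _ mA; rewrite setTI.
rewrite /shift_probability fineK; last first.
  by rewrite fin_num_measure//; have := mD measurableT _ mA'; rewrite setTI.
rewrite -[RHS]/(P (Dalpha (b `^ alpha * u) @^-1` [set y : R | A (y + n%:R)])).
rewrite density_ga// integral_mkcond [RHS]integral_mkcond.
have mf : measurable_fun [set: R] ((fun x => (phi n x u)%:E) \_ A).
  apply/(measurable_restrictT _ mA)/measurable_funTS/measurable_EFinP.
  have mq : measurable_fun [set: R] (fun x => (x - n%:R, b `^ alpha * u)).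
    by apply: measurable_fun_pair => //; exact: measurable_funB.
  exact: (measurableT_comp mga mq).
rewrite (ge0_integral_lebesgue_affine n%:R ltr01 mf); last first.
  by move=> x; rewrite patchE; case: ifP => // _; rewrite lee_fin ga0.
rewrite mul1e; apply: eq_integral => x _; rewrite mul1r !patchE /phi addrK.
by congr (if _ then _ else _); apply/idP/idP; rewrite !inE.
Qed.

(** The densities of [Dalpha u] are given only for [u > 0]. *)
Let ae_Y_gt0 : {ae P, forall w, 0 < Y t w}.
Proof.
have := ae_subordinator_unbounded Hbeta t0; apply: filterS => w.
exact: (inverse_process_gt0 Hbeta).
Qed.

Let mix_integral A z L n : measurable A -> (\int[leb]_(x in A) mix z L n x =
  \int[P]_w (U w ^+ z * expR (- L * U w) * shift_probability A n (Y t w))%:E)%E.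
Proof.
move=> mA; pose K (q : measurableTypeR R * T) : \bar R := (kernel z L n q * (\1_A q.1)%:E)%E.
have mK : measurable_fun setT K.
  apply: emeasurable_funM => //; apply/measurable_EFinP.
  exact: (measurableT_comp (measurable_indic mA) measurable_fst).
have K0 q : (0 <= K q)%E by rewrite mule_ge0.
have mUY : measurable_fun setT (fun w => U w ^+ z * expR (- L * U w)).
  apply: measurable_funM; first exact: measurable_funX.
  by apply: measurableT_comp => //; exact: measurable_funM.
have UY0 w : 0 <= U w ^+ z * expR (- L * U w) by rewrite mulr_ge0 ?exprn_ge0 ?expR_ge0.
transitivity (\int[leb]_x \int[P]_w K (x, w))%E.
  rewrite integral_mkcond; apply: eq_integral => x _; rewrite patchE.
  have mk : measurable_fun setT (fun w => kernel z L n (x, w)).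
    exact: (measurableT_comp (mkernel z L n) (pair1_measurable x)).
  case: ifPn => xA; last first.
    by rewrite integral0_eq// => w _; rewrite /K/= indicE (negbTE xA) mule0.
  by apply: eq_integral => w _; rewrite /K/= indicE xA mule1.
rewrite (@fubini_tonelli _ _ _ _ _ leb P K mK K0).
apply: ge0_ae_eq_integral => //.
- exact: (measurable_fun_fubini_tonelli_G _ mK K0).
- apply/measurable_EFinP; apply: measurable_funM => //.
  rewrite (_ : (fun w => _) = (fun s : R => shift_probability A n (Num.max s 0)) \o Y t).
    by apply: measurableT_comp => //; exact: shift_probability_measurable.
  by apply/funext => w /=; rewrite max_l.
- by move=> w _; exact: integral_ge0.
- by move=> w _; rewrite lee_fin mulr_ge0// fine_ge0.
apply: filterS ae_Y_gt0 => w Yw _.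
rewrite EFinM -(phi_integral _ mA Yw) -ge0_integralZl//.
- rewrite [RHS]integral_mkcond; apply: eq_integral => x _; rewrite patchE /K/= indicE.
  by case: ifP => _; rewrite ?mule1 ?mule0// EFinM.
- apply: measurable_funTS; apply/measurable_EFinP.
  exact: (measurableT_comp (mphi n) (pair2_measurable w)).
- by move=> x _; rewrite lee_fin ga0.
- by rewrite lee_fin.
Qed.

Let F x : \bar R :=
  (\sum_(0 <= n <oo) \sum_(y in Omega k n) (coef y)%:E * mix (deg y) (total_rate lambda) n x)%E.

Let mF : measurable_fun [set: measurableTypeR R] F.
Proof.
apply: measurable_nneseries_sum => // n y; first exact: measurable_funeM.
by move=> x; rewrite mule_ge0// lee_fin.
Qed.

Let F0 x : (0 <= F x)%E.
Proof.
apply: nneseries_ge0 => n _ _; apply: sume_ge0 => y _.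
by rewrite mule_ge0// lee_fin.
Qed.

Let F_integral A : measurable A -> P (X t @^-1` A) = (\int[leb]_(x in A) F x)%E.
Proof.
move=> mA; rewrite time_changed_law_integral// integral_nneseries_sum//; last 2 first.
- by move=> n y; apply: measurable_funTS; exact: measurable_funeM.
- by move=> n y x; rewrite mule_ge0// lee_fin.
apply: eq_eseriesr => n _; apply: eq_bigr => y _.
rewrite ge0_integralZl// ?mix_integral ?lee_fin//.
exact: measurable_funTS.
Qed.

Let ae_fin (G : R -> \bar R) : measurable_fun [set: measurableTypeR R] G ->
  (forall x, 0 <= G x)%E -> (\int[leb]_x G x < +oo)%E ->
  {ae leb, forall x : R, G x \is a fin_num}.
Proof.
move=> mG G0 Gfin; have iG : leb.-integrable setT G.
  apply/integrableP; split => //.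
  by under eq_integral do rewrite gee0_abs//.
have := integrable_ae measurableT iG; apply: filterS => x; exact.
Qed.

(** The series [F] may be infinite at some [x], but it integrates to [1], so [fine] alters it on a
    null set only. Differentiating the mixture at [x] requires its finiteness to the left of
    [Lambda], which likewise holds for almost every [x], for all [n] at once. *)
Lemma time_changed_density : exists f : R -> R,
  [/\ measurable_fun [set: R] f, forall x, 0 <= f x,
      forall A, measurable A -> P (X t @^-1` A) = (\int[leb]_(x in A) (f x)%:E)%E
    & {ae leb, forall x : R, (f x)%:E = law_series lambda gamma (pushforward P (Y t))
        (fun n s => ga (x - n%:R) (b `^ alpha * s))}].
Proof.
have aeF : {ae leb, forall x : R, F x \is a fin_num}.
  apply: ae_fin => //; rewrite -F_integral// preimage_setT.
  by rewrite [X in (X < _)%E](probability_setT P) ltry.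
have FF : Filter (almost_everywhere leb) by exact: ae_filter_ringOfSetsType.
(* A base point in [[0, Lambda[]: being nonnegative it keeps the exponential at most [1], and it
   leaves room below [Lambda]. *)
pose L0 := total_rate lambda / 2.
have L00 : 0 <= L0 by rewrite divr_ge0// ltW.
have L0L : L0 < total_rate lambda by rewrite ltr_pdivrMr// ltr_pMr// ltr1n.
have aeM : {ae leb, forall x : R, forall n, mix 0 L0 n x \is a fin_num}.
  apply: ae_foralln => n; apply: ae_fin => //; rewrite mix_integral//.
  apply: (@le_lt_trans _ _ (\int[P]_w (cst 1%:E w))%E); last first.
    by rewrite integral_cst// mul1e [X in (X < _)%E](probability_setT P) ltry.
  have s1 w : shift_probability setT n (Y t w) = 1.
    rewrite /shift_probability (_ : [set w | _] = setT); last by apply/seteqP; split.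
    by rewrite [X in fine X](probability_setT P).
  under eq_integral do rewrite s1 mulr1 expr0 mul1r.
  apply: ge0_le_integral => //.
  - by apply/measurable_EFinP; apply: measurableT_comp => //; exact: measurable_funM.
  - by move=> w _; rewrite lee_fin expR_le1 mulNr oppr_le0 mulr_ge0.
exists (fine \o F); split.
- exact: (measurableT_comp (fine_measurable measurableT) mF).
- by move=> x; exact: fine_ge0.
- move=> A mA; rewrite F_integral//; apply: ge0_ae_eq_integral => //.
  + exact: measurable_funTS.
  + apply/measurable_funTS/measurable_EFinP.
    exact: (measurableT_comp (fine_measurable measurableT) mF).
  + by move=> x _; rewrite lee_fin fine_ge0.
  + by move: aeF; apply: filterS => x Fx _ /=; rewrite fineK.
move: aeF aeM; apply: filterS2 => x Fx Mx /=; rewrite fineK//.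
apply: eq_eseriesr => n _; apply: eq_bigr => y _.
rewrite [RHS]EFinM -/(coef y) -/(deg y); congr (_ * _)%E.
have p0 s : 0 <= s -> 0 <= phi n x s by move=> _; rewrite /phi.
have mp : measurable_fun setT (fun s : R => phi n x (Num.max s 0)).
  have mq : measurable_fun [set: R] (fun s => (x - n%:R, b `^ alpha * Num.max s 0)).
    by apply: measurable_fun_pair => //; apply: measurable_funM => //; exact: measurable_maxr.
  exact: (measurableT_comp mga mq).
have mpY : measurable_fun setT (fun w => phi n x (Y t w)).
  exact: (measurableT_comp (mphi n) (pair1_measurable x)).
have fin : (\int[P]_w (expR (- L0 * U w) * phi n x (Y t w))%:E < +oo)%E.
  have := Mx n; rewrite ge0_fin_numE//; congr (_ < _)%E.
  by apply: eq_integral => w _; rewrite expr0 mul1r.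
have L01 : 0 <= L0 < total_rate lambda by rewrite L00.
rewrite (derive1n_exponential_mixture p0 mp (deg y) fin L01) fineK//.
rewrite ge0_fin_numE; last first.
  by apply: integral_ge0 => w _; rewrite lee_fin !mulr_ge0 ?exprn_ge0 ?expR_ge0 ?ga0.
exact: (laplace_moment_lty mU mpY U_ge0 (fun w => ga0 _ _) fin).
Qed.

End density.

End time_changed_counting_process.

(** * The fractional equation *)

Section mean_shift.
Context {R : realType} (k : nat) (lambda : 'I_k -> R).
Hypotheses (k0 : (0 < k)%N) (lambda0 : forall j, 0 < lambda j).
Implicit Types (nu : set R -> \bar R) (eta gamma : R).

Lemma iter_shift n nu : iter n (@Defs.shift R) nu = pushforward nu (fun x => x + n%:R).
Proof.
elim: n => [|n IH] /=; apply/funext => A; rewrite /pushforward.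
  by congr nu; apply/seteqP; split=> x /=; rewrite addr0.
rewrite IH /Defs.shift /pushforward; congr nu.
by apply/seteqP; split=> x /=; rewrite -addrA natr1.
Qed.

(** [laplace] integrates over [[0, +oo[] only; without mass on the negatives this is the integral
    over the line, and a shift by [n] just multiplies it by [exp (- eta n)]. *)
Definition carried_by_nonneg (m : {measure set R -> \bar R}) := m `]-oo, 0[%classic = 0%E.

Lemma laplace_carried (m : {measure set R -> \bar R}) eta :
  carried_by_nonneg m -> laplace m eta = (\int[m]_x (expR (- eta * x))%:E)%E.
Proof.
move=> m0; rewrite (@ge0_negligible_integral _ _ _ m setT `]-oo, 0[%classic)//.
- rewrite /laplace; congr (integral _ _ _); apply/seteqP; split=> x /=; rewrite !in_itv/= andbT.
    by move=> x0; split=> //; rewrite ltNge x0.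
  by move=> [_ /negP]; rewrite -leNgt.
- by apply/measurable_EFinP; apply: measurableT_comp => //; exact: measurable_funM.
Qed.

Let measurable_shift n : measurable_fun setT (fun x : R => x + n%:R).
Proof. exact: measurable_funD. Qed.

(* Indexed by all of [nat] to be summed by [msum]. *)
Let m_ (m : {measure set R -> \bar R}) (i : nat) : {measure set R -> \bar R} :=
  if insub i is Some j then
    mscale (NngNum (ltW (lambda0 j))) (pushforward_measure m (measurable_shift j.+1))
  else mzero.

Let LambdaV_ge0 : 0 <= (total_rate lambda)^-1.
Proof. by rewrite invr_ge0 ltW// total_rate_gt0. Qed.

Let mean_shift_measure (m : {measure set R -> \bar R}) : {measure set R -> \bar R} :=
  mscale (NngNum LambdaV_ge0) (msum (m_ m) k).

Let mean_shift_measureE (m : {measure set R -> \bar R}) :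
  mean_shift lambda m = (mean_shift_measure m : set R -> \bar R).
Proof.
apply/funext => A; rewrite -[RHS]/(((total_rate lambda)^-1)%:E * msum (m_ m) k A)%E.
congr (_ * _)%E.
rewrite /msum; apply: eq_bigr => j _; by rewrite /m_ valK (iter_shift j.+1).
Qed.

Let mean_shift_carried (m : {measure set R -> \bar R}) : carried_by_nonneg m -> carried_by_nonneg (mean_shift_measure m).
Proof.
move=> m0; rewrite /carried_by_nonneg -mean_shift_measureE /mean_shift big1 ?mule0// => j _.
rewrite (iter_shift j.+1); apply/eqP; rewrite mule_eq0; apply/orP; right.
apply/eqP; apply: (@subset_measure0 _ _ _ m _ `]-oo, 0[%classic) => //.
  by rewrite -[X in measurable X]setTI; exact: measurable_shift.
move=> x; rewrite /= !in_itv/=; apply: le_lt_trans.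
by rewrite lerDl.
Qed.

(** The symbol of [mean_shift], that is, the number [q] by which it acts on Laplace transforms. *)
Definition mean_shift_factor eta :=
  (total_rate lambda)^-1 * \sum_(j < k) lambda j * expR (- eta * j.+1%:R).

Let laplace_mean_shift (m : {measure set R -> \bar R}) eta : carried_by_nonneg m ->
  laplace (mean_shift_measure m) eta = ((mean_shift_factor eta)%:E * laplace m eta)%E.
Proof.
move=> m0; have mc := mean_shift_carried m0.
have me : measurable_fun setT (fun x : R => (expR (- eta * x))%:E).
  by apply/measurable_EFinP; apply: measurableT_comp => //; exact: measurable_funM.
rewrite !laplace_carried// ge0_integral_mscale//= EFinM -muleA; congr (_ * _)%E.
rewrite ge0_integral_measure_sum// -sumEFin ge0_sume_distrl; last first.
  by move=> j _; rewrite lee_fin mulr_ge0 ?expR_ge0// ltW.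
apply: eq_bigr => j _; rewrite /m_ valK ge0_integral_mscale//= EFinM -muleA.
congr (_ * _)%E; rewrite ge0_integral_pushforward// preimage_setT.
rewrite -ge0_integralZl//; first by apply: eq_integral => x _; rewrite /= mulrDr expRD EFinM muleC.
Qed.

(** The iterates are mere set functions, so the induction carries along a genuine measure equal to
    each of them, to which the integration lemmas apply. *)
Lemma laplace_iter_mean_shift (m : {measure set R -> \bar R}) eta r : carried_by_nonneg m ->
  laplace (iter r (mean_shift lambda) m) eta = ((mean_shift_factor eta ^+ r)%:E * laplace m eta)%E.
Proof.
move=> m0.
suff [m' [-> _ ->]] : exists m' : {measure set R -> \bar R},
  [/\ iter r (mean_shift lambda) m = (m' : set R -> \bar R), carried_by_nonneg m' &
      laplace m' eta = ((mean_shift_factor eta ^+ r)%:E * laplace m eta)%E] by [].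
elim: r => [|r [m' [mE m'0 lE]]]; first by exists m; split => //; rewrite expr0 mul1e.
exists (mean_shift_measure m'); split.
- by rewrite iterS mE mean_shift_measureE.
- exact: mean_shift_carried.
- by rewrite laplace_mean_shift// lE muleA -EFinM exprS.
Qed.

Lemma mean_shift_factor_itv eta : 0 <= eta -> 0 <= mean_shift_factor eta <= 1.
Proof.
move=> eta0; rewrite mulr_ge0 ?sumr_ge0//=; last by move=> j _; rewrite mulr_ge0 ?expR_ge0// ltW.
rewrite ler_pdivrMl ?total_rate_gt0// mulr1; apply: ler_sum => j _.
rewrite ger_pMr ?expR_le1// mulNr oppr_le0 mulr_ge0//.
Qed.

Lemma mean_shift_factor_lt1 eta : 0 < eta -> mean_shift_factor eta < 1.
Proof.
move=> eta0; rewrite ltr_pdivrMl ?total_rate_gt0// mulr1 /total_rate.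
have lt j : lambda j * expR (- eta * j.+1%:R) < lambda j.
  by rewrite gtr_pMr// expR_lt1 mulNr oppr_lt0 mulr_gt0.
apply: ltr_sum => //.
by apply/hasP; exists (Ordinal k0); rewrite // mem_index_enum.
Qed.

Lemma laplace_exponent_mean_shift eta :
  laplace_exponent lambda eta = total_rate lambda * (1 - mean_shift_factor eta).
Proof.
rewrite mulrBr mulr1 mulrA mulfV ?gt_eqF ?total_rate_gt0// mul1r /total_rate -sumrB.
by apply: eq_bigr => j _; rewrite mulrBr mulr1.
Qed.

(** On transforms the operator expansion is the scalar binomial series at [q], and [eta > 0]
    guarantees [q < 1]. *)
Lemma fractional_shift_series (m : {measure set R -> \bar R}) gamma eta :
  carried_by_nonneg m -> laplace m eta \is a fin_num -> 0 <= gamma <= 1 -> 0 < eta ->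
  series (fractional_shift_term lambda gamma m eta) @ \oo -->
    (1 - mean_shift_factor eta) `^ gamma * fine (laplace m eta).
Proof.
move=> m0 mfin g01 eta0.
have q01 : 0 <= mean_shift_factor eta < 1.
  by have /andP[-> _] := mean_shift_factor_itv (ltW eta0); exact: mean_shift_factor_lt1.
set W := fine (laplace m eta).
suff -> : series (fractional_shift_term lambda gamma m eta) = (fun n =>
    series (fun r => (-1) ^+ r * generalized_binomial gamma r * mean_shift_factor eta ^+ r) n * W).
  by apply: cvgM; [exact: binomial_series|exact: cvg_cst].
apply/funext => n; rewrite /series/= mulr_suml; apply: eq_bigr => r _.
by rewrite /fractional_shift_term laplace_iter_mean_shift// fineM// mulrA.
Qed.

Lemma laplace_fractional_shiftE (m : {measure set R -> \bar R}) gamma eta :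
  carried_by_nonneg m -> laplace m eta \is a fin_num -> 0 <= gamma <= 1 -> 0 < eta ->
  laplace_fractional_shift lambda gamma m eta =
    laplace_exponent lambda eta `^ gamma * fine (laplace m eta).
Proof.
move=> m0 mfin g01 eta0; rewrite /laplace_fractional_shift.
rewrite (cvg_lim _ (fractional_shift_series m0 mfin g01 eta0))// mulrA.
rewrite laplace_exponent_mean_shift powRM//; first exact/ltW/total_rate_gt0.
by rewrite subr_ge0; have /andP[] := mean_shift_factor_itv (ltW eta0).
Qed.

End mean_shift.


(** * Transforms of the Caputo and Riemann-Liouville derivatives *)

Section has_laplace.
Context {R : realType}.
Local Notation leb := (@lebesgue_measure R).
Implicit Types (F G : R -> \bar R) (p v : R).

Lemma eq_has_laplace F G p v :
  (forall t : R, 0 <= t -> F t = G t) -> has_laplace G p v -> has_laplace F p v.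
Proof.
move=> FG [iG GE].
have E t : t \in [set` `[0%R, +oo[ ] ->
    ((expR (- p * t))%:E * G t = (expR (- p * t))%:E * F t)%E.
  by rewrite inE/= in_itv/= andbT => t0; rewrite FG.
split; first by apply: eq_integrable iG => //; exact: measurable_itv.
by rewrite -GE; apply: eq_integral => t /E.
Qed.

Lemma ge0_has_laplace F p v : measurable_fun [set: measurableTypeR R] F ->
  (forall t, 0 <= F t)%E ->
  (\int[leb]_(t in `[0%R, +oo[) ((expR (- p * t))%:E * F t) = v%:E)%E -> has_laplace F p v.
Proof.
move=> mF F0 FE; split=> //; apply/integrableP; split.
  apply: measurable_funTS; apply: emeasurable_funM => //; apply/measurable_EFinP.
  by apply: measurableT_comp => //; exact: measurable_funM.
under eq_integral do rewrite gee0_abs ?mule_ge0//.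
by rewrite FE ltry.
Qed.

Lemma has_laplaceN F p v : has_laplace F p v -> has_laplace (fun t => - F t)%E p (- v).
Proof.
move=> [iF FE]; split.
  apply: eq_integrable (integrableN iF) => //.
  by move=> t _; rewrite /= muleN.
under eq_integral do rewrite muleN.
by rewrite integralN/= ?FE//; exact: integrable_add_def.
Qed.

Lemma ge0_has_laplaceZ F p v c : 0 <= c -> measurable_fun [set: measurableTypeR R] F ->
  (forall t, 0 <= F t)%E ->
  (\int[leb]_(t in `[0%R, +oo[) ((expR (- p * t))%:E * F t) = v%:E)%E ->
  has_laplace (fun t => c%:E * F t)%E p (c * v).
Proof.
move=> c0 mF F0 FE; apply: ge0_has_laplace.
- exact: measurable_funeM.
- by move=> t; rewrite mule_ge0.
under eq_integral do rewrite muleCA.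
rewrite ge0_integralZl//; first by rewrite FE.
- apply: measurable_funTS; apply: emeasurable_funM => //; apply/measurable_EFinP.
  by apply: measurableT_comp => //; exact: measurable_funM.
- by move=> t _; rewrite mule_ge0.
Qed.

Lemma measurable_power_convolution (phi : R -> R) (a : R) :
  measurable_fun [set: R] phi -> (forall s, 0 <= phi s) ->
  measurable_fun [set: measurableTypeR R]
    (fun x => \int[leb]_(s in `[0%R, x[) ((x - s) `^ (- a) * phi s)%:E)%E.
Proof.
move=> mphi phi0.
pose f (z : measurableTypeR R * measurableTypeR R) : \bar R :=
  if (0 <= z.2)%R && (z.2 < z.1)%R then ((z.1 - z.2) `^ (- a) * phi z.2)%:E else 0%E.
have f0 z : (0 <= f z)%E.
  by rewrite /f; case: ifP => // _; rewrite lee_fin mulr_ge0 ?powR_ge0.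
have m1 : measurable_fun setT (fun z : measurableTypeR R * measurableTypeR R => z.1 : R).
  exact: measurable_fst.
have m2 : measurable_fun setT (fun z : measurableTypeR R * measurableTypeR R => z.2 : R).
  exact: measurable_snd.
have mf : measurable_fun setT f.
  apply: measurable_fun_ifT => //.
    by apply: measurable_and; [exact: measurable_fun_ler|exact: measurable_fun_ltr].
  apply/measurable_EFinP; apply: measurable_funM.
    exact: (measurableT_comp (measurable_powR (- a)) (measurable_funB m1 m2)).
  exact: (measurableT_comp mphi m2).
rewrite (_ : (fun x => _) = (fun x => \int[leb]_s f (x, s))%E).
  exact: (measurable_fun_fubini_tonelli_F _ mf f0).
by apply/funext => x; rewrite lebesgue_integral_itv_if; apply: eq_integral => s _; rewrite /f in_itv.
Qed.

Lemma has_laplace_caputo_bounded (beta : R) (f : R -> R) mu v :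
  0 < beta <= 1 -> 0 < mu -> measurable_fun [set: R] (fun t => f (Num.max t 0)) ->
  f 0 = 1 -> (forall t, 0 <= t -> 0 <= f t <= 1) ->
  (\int[leb]_(t in `[0%R, +oo[) ((expR (- mu * t))%:E * (f t)%:E) = v%:E)%E ->
  has_laplace_caputo beta f mu (mu `^ beta * v - mu `^ (beta - 1)).
Proof.
move=> /andP[beta0 beta1] mu0 mf f01 f0 fE.
(* Minus the increment [f s - f 0], hence nonnegative: the convolution lemma applies to it and the
   sign is restored at the end. *)
pose phi s := 1 - f (Num.max s 0).
have max0 (s : R) : 0 <= Num.max s 0 by rewrite le_max lexx orbT.
have mphi : measurable_fun [set: R] phi by exact: measurable_funB.
have phi0 s : 0 <= phi s by rewrite subr_ge0; have /andP[] := f0 _ (max0 s).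
have phiE s : 0 <= s -> f s - f 0 = - phi s by move=> s0; rewrite /phi max_l// f01 opprB.
have phi_laplace : (\int[leb]_(t in `[0%R, +oo[) (expR (- mu * t) * phi t)%:E = (mu^-1 - v)%:E)%E.
  have mexp : measurable_fun setT (fun t : R => expR (- mu * t)).
    by apply: measurableT_comp => //; exact: measurable_funM.
  transitivity (\int[leb]_(t in `[0%R, +oo[) (expR (- mu * t) - expR (- mu * t) * f (Num.max t 0))%:E)%E.
    by apply: eq_integral => t _; rewrite mulrBr mulr1.
  apply: ge0_integral_EFinB => //.
  - exact: measurable_funTS.
  - by apply: measurable_funTS; exact: measurable_funM.
  - move=> t _; have /andP[h0 h1] := f0 _ (max0 t).
    by rewrite mulr_ge0 ?expR_ge0//= ger_pMr ?expR_gt0.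
  - by rewrite integral_expR_itvcy// mulr0 expR0 div1r.
  - rewrite -fE; apply: eq_integral => t; rewrite inE/= in_itv/= andbT => t0.
    by rewrite max_l// EFinM.
(* Here [1 / mu - v] is the transform of [phi], and [mu ^ (beta - 1)] comes from the fractional
   kernel; multiplying by [mu] gives the Caputo transform. *)
exists (- (mu `^ (beta - 1) * (mu^-1 - v))); last first.
  by rewrite (powR_subr1 beta mu0); field; rewrite gt_eqF.
case: (ltP beta 1) => [bl1|b1].
  have bb : 0 < beta < 1 by rewrite beta0.
  pose G t : \bar R := (((gamma_function (1 - beta))^-1)%:E *
    \int[leb]_(s in `[0%R, t[) ((t - s) `^ (- beta) * phi s)%:E)%E.
  have Gamma0 : 0 <= (gamma_function (1 - beta))^-1 :> R.
    by rewrite invr_ge0 ltW// gamma_function_gt0.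
  have conv0 t : (0 <= \int[leb]_(s in `[0%R, t[) ((t - s) `^ (- beta) * phi s)%:E)%E.
    by apply: integral_ge0 => s _; rewrite lee_fin mulr_ge0 ?powR_ge0.
  have mconv := @measurable_power_convolution phi beta mphi phi0.
  apply: (@eq_has_laplace _ (fun t => - G t)%E).
    move=> t t0; rewrite /caputo_integral bl1 /G -muleN; congr (_ * _)%E.
    rewrite -integral_ge0N//; last first.
      by move=> s _; rewrite lee_fin mulr_ge0 ?powR_ge0.
    apply: eq_integral => s; rewrite inE/= in_itv/= => /andP[s0 _].
    by rewrite phiE// mulrN.
  apply: has_laplaceN; apply: ge0_has_laplace.
  - exact: measurable_funeM.
  - by move=> t; rewrite mule_ge0// lee_fin.
  have := @laplace_convolution _ _ R leb id phi beta mu (@measurable_id _ _ _) mphi phi0 bb mu0.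
  by move=> ->; rewrite EFinM phi_laplace.
have -> : beta = 1 by apply/eqP; rewrite eq_le beta1.
rewrite subrr powRr0 mul1r.
apply: (@eq_has_laplace _ (fun t => - (phi t)%:E)%E).
  by move=> t t0; rewrite /caputo_integral ltxx phiE.
apply: has_laplaceN; apply: ge0_has_laplace => //.
exact/measurable_EFinP.
Qed.

(** The fractional integral contributes [eta ^ (alpha - 1)], and the outer derivative the missing
    factor [eta]. *)
Lemma laplace_RL_derivativeE {d : measure_display} {T : measurableType d}
    (P : probability T R) (X : T -> R) (alpha eta : R) : 0 < alpha <= 1 -> 0 < eta ->
  measurable_fun setT X -> (forall w, 0 <= X w) ->
  laplace_RL_derivative alpha (pushforward P X) eta =
    ((eta `^ alpha)%:E * laplace (pushforward P X) eta)%E.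
Proof.
move=> /andP[alpha0 alpha1] eta0 mX X0; rewrite /laplace_RL_derivative.
case: ltP => [al1|a1]; last first.
  have -> : alpha = 1 by apply/eqP; rewrite eq_le alpha1.
  by rewrite powRr1// ltW.
have aa : 0 < alpha < 1 by rewrite alpha0.
rewrite (powR_subr1 alpha eta0) mulrC EFinM -muleA; congr (_ * _)%E.
pose nu : probability R R := law P mX.
transitivity ((eta `^ (alpha - 1))%:E *
    \int[nu]_(s in id @^-1` `[0%R, +oo[) (expR (- eta * id s) * cst 1 s)%:E)%E; last first.
  congr (_ * _)%E; rewrite -[RHS]/(\int[nu]_(x in `[0%R, +oo[) (expR (- eta * x))%:E)%E.
  by apply: eq_integral => s _; rewrite mulr1.
have <- := @laplace_convolution _ _ R nu id (cst (1 : R)) alpha eta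
  (@measurable_id _ _ _) (measurable_cst (1 : R)) (fun=> ler01) aa eta0.
apply: eq_integral => x _; congr (_ * _)%E; rewrite /RL_integral; congr (_ * _)%E.
rewrite -[LHS]/(\int[nu]_(s in `[0%R, x[) ((x - s) `^ (- alpha))%:E)%E.
by apply: eq_integral => s _; rewrite mulr1.
Qed.

End has_laplace.

(** * The equation in the transformed variables *)

Section solves_equation.
Context {d : measure_display} {T : measurableType d} {R : realType}.
Variables (P : probability T R) (alpha beta gamma b : R).
Hypotheses (alpha01 : 0 < alpha <= 1) (gamma01 : 0 < gamma <= 1) (beta01 : 0 < beta <= 1).
Variables (k : nat) (lambda : 'I_k -> R) (Dbeta : R -> T -> R).
Hypotheses (k0 : (0 < k)%N) (lambda0 : forall j, 0 < lambda j).
Hypothesis Hbeta : subordinator P beta Dbeta.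
Local Notation leb := (@lebesgue_measure R).
Let Y := inverse_process Dbeta.

Section inverse_laplace.
Variable c : R.
Hypothesis c0 : 0 < c.

Definition inverse_laplace (t : R) : R :=
  fine (\int[P]_w (expR (- c * Y (Num.max t 0) w))%:E)%E.

Let max_ge0 (t : R) : 0 <= Num.max t 0. Proof. by rewrite le_max lexx orbT. Qed.

Let mexpY (t : R) : measurable_fun setT (fun w => expR (- c * Y (Num.max t 0) w)).
Proof.
apply: measurableT_comp => //; apply: measurable_funM => //.
exact: (measurable_inverse_process Hbeta).
Qed.

Let expY_le1 (t : R) : (\int[P]_w (expR (- c * Y (Num.max t 0) w))%:E <= 1)%E.
Proof.
have <- : (\int[P]_w (cst 1%:E w) = 1)%E.
  by rewrite integral_cst// mul1e; exact: probability_setT.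
apply: ge0_le_integral => //.
- exact/measurable_EFinP.
- by move=> w _; rewrite lee_fin expR_le1 mulNr oppr_le0 mulr_ge0 ?(ltW c0)// inverse_process_ge0.
Qed.

Let expY_ge0 (t : R) : (0 <= \int[P]_w (expR (- c * Y (Num.max t 0) w))%:E)%E.
Proof. by apply: integral_ge0 => w _; rewrite lee_fin expR_ge0. Qed.

Lemma inverse_laplaceE (t : R) : 0 <= t ->
  (\int[P]_w (expR (- c * Y t w))%:E = (inverse_laplace t)%:E)%E.
Proof.
move=> t0; rewrite /inverse_laplace -[in LHS](max_l t0) fineK// ge0_fin_numE//.
by rewrite (le_lt_trans (expY_le1 t))// ltry.
Qed.

Lemma inverse_laplace_itv (t : R) : 0 <= inverse_laplace t <= 1.
Proof.
rewrite fine_ge0//= -[leRHS]/(fine 1%:E) fine_le//.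
by rewrite ge0_fin_numE// (le_lt_trans (expY_le1 t))// ltry.
Qed.

Lemma inverse_laplace0 : inverse_laplace 0 = 1.
Proof.
rewrite /inverse_laplace maxxx.
rewrite (@ae_eq_integral _ _ _ P setT (cst 1%:E))//.
- rewrite integral_cst// mul1e.
  by rewrite [X in fine X](probability_setT P).
- by apply/measurable_EFinP; have := mexpY 0; rewrite maxxx.
- have := ae_inverse_process0 beta01 Hbeta; apply: filterS => w Y0 _.
  by rewrite /Y Y0 mulr0 expR0.
Qed.

Lemma measurable_inverse_laplace : measurable_fun [set: measurableTypeR R] inverse_laplace.
Proof.
apply: (measurableT_comp (fine_measurable measurableT)).
pose f (z : measurableTypeR R * T) := (expR (- c * Y (Num.max z.1 0) z.2))%:E.
have mf : measurable_fun setT f.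
  apply/measurable_EFinP; apply: measurableT_comp => //; apply: measurable_funM => //.
  exact: (measurable_inverse_process_pair Hbeta).
have f0 z : (0 <= f z)%E by rewrite lee_fin expR_ge0.
exact: (measurable_fun_fubini_tonelli_F _ mf f0).
Qed.

Lemma laplace_inverse_laplace (mu : R) : 0 < mu ->
  (\int[leb]_(t in `[0%R, +oo[) ((expR (- mu * t))%:E * (inverse_laplace t)%:E) =
   (mu `^ (beta - 1) / (mu `^ beta + c))%:E)%E.
Proof.
move=> mu0; rewrite -(inverse_process_double_laplace Hbeta c0 mu0).
apply: eq_integral => t; rewrite inE/= in_itv/= andbT => t0.
by rewrite -inverse_laplaceE.
Qed.

End inverse_laplace.

Variable X : R -> T -> R.
Hypothesis mX : forall t, 0 <= t -> measurable_fun setT (X t).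
Hypothesis X0 : forall t w, 0 <= t -> 0 <= X t w.
Hypothesis XE : forall eta t, 0 < eta -> 0 <= t ->
  (\int[P]_w (expR (- eta * X t w))%:E = \int[P]_w (expR
     (- (laplace_exponent lambda eta `^ gamma + b `^ alpha * eta `^ alpha) * Y t w))%:E)%E.

Lemma solves_equation_laplace :
  solves_equation alpha beta gamma b lambda (fun t => pushforward P (X t)).
Proof.
move=> eta mu eta0 mu0.
set S := laplace_exponent lambda eta.
pose c := S `^ gamma + b `^ alpha * eta `^ alpha.
have S0 : 0 < S.
  rewrite /S laplace_exponent_mean_shift// mulr_gt0 ?total_rate_gt0// subr_gt0.
  exact: mean_shift_factor_lt1.
(* Strict positivity comes from [S] alone, so [b = 0] is covered. *)
have c0 : 0 < c by rewrite ltr_pwDl ?powR_gt0// mulr_ge0 ?powR_ge0.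
pose W := inverse_laplace c.
have W0 t : 0 <= W t by have /andP[] := inverse_laplace_itv c0 t.
have WE t : 0 <= t -> laplace (pushforward P (X t)) eta = (W t)%:E.
  move=> t0; rewrite laplace_pushforward; [|exact: mX|by move=> w; exact: X0].
  by rewrite XE// -inverse_laplaceE.
have mW : measurable_fun [set: measurableTypeR R] (fun t => (W t)%:E).
  by apply/measurable_EFinP; exact (measurable_inverse_laplace c).
have g01 : 0 <= gamma <= 1 by case/andP: gamma01 => /ltW -> ->.
have carried t (t0 : 0 <= t) : carried_by_nonneg (law P (mX t0)).
  rewrite /carried_by_nonneg -[LHS]/(P (X t @^-1` `]-oo, 0[%classic)).
  rewrite (_ : _ @^-1` _ = set0) ?measure0//.
  by apply/seteqP; split=> // w /=; rewrite in_itv/= ltNge X0.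
have fin t (t0 : 0 <= t) : laplace (law P (mX t0)) eta \is a fin_num.
  by rewrite -[X in X \is a fin_num]/(laplace (pushforward P (X t)) eta) WE.
split.
  move=> t t0; apply: cvgP.
  exact: (fractional_shift_series k0 lambda0 (carried t t0) (fin t t0) g01 eta0).
pose v := mu `^ (beta - 1) / (mu `^ beta + c).
have vE := laplace_inverse_laplace c0 mu0.
exists (mu `^ beta * v - mu `^ (beta - 1)), (eta `^ alpha * v), (S `^ gamma * v); split.
- apply: has_laplace_caputo_bounded => //.
  + rewrite (_ : (fun t => _) = W); first exact (measurable_inverse_laplace c).
    apply/funext => t; have m0 : 0 <= Num.max t 0 by rewrite le_max lexx orbT.
    by rewrite (WE _ m0)/= /W /inverse_laplace [Num.max (Num.max t 0) 0]max_l.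
  + rewrite WE//=; exact (inverse_laplace0 c).
  + move=> t t0; rewrite WE//=; exact (inverse_laplace_itv c0 t).
  + rewrite -vE; apply: eq_integral => t; rewrite inE/= in_itv/= andbT => t0.
    by rewrite WE.
- apply: (@eq_has_laplace _ _ (fun t => (eta `^ alpha)%:E * (W t)%:E)%E).
    move=> t t0; rewrite laplace_RL_derivativeE// ?WE//; first exact: mX.
    by move=> w; exact: X0.
  by apply: ge0_has_laplaceZ => //; exact: powR_ge0.
- apply: (@eq_has_laplace _ _ (fun t => (S `^ gamma)%:E * (W t)%:E)%E).
    move=> t t0.
    rewrite (laplace_fractional_shiftE k0 lambda0 (carried t t0) (fin t t0) g01 eta0).
    by rewrite -[X in fine X]/(laplace (pushforward P (X t)) eta) WE// EFinM.
  by apply: ge0_has_laplaceZ => //; exact: powR_ge0.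
(* The three terms add up to [(mu ^ beta + c) v - mu ^ (beta - 1)]. *)
rewrite /v /c; field; rewrite gt_eqF// ltr_pwDl ?powR_gt0//.
by rewrite addr_ge0 ?powR_ge0// mulr_ge0 ?powR_ge0.
Qed.

End solves_equation.

Lemma probability_ae_cst {d : measure_display} {T : measurableType d} {R : realType}
    (P : probability T R) (X : T -> R) (a : R) (A : set R) :
  measurable_fun setT X -> {ae P, forall w, X w = a} -> measurable A ->
  P (X @^-1` A) = \d_a A.
Proof.
move=> mX Xa mA; have mXA : measurable (X @^-1` A) by rewrite -[_ @^-1` _]setTI; exact: mX.
transitivity (\int[P]_w (\1_(X @^-1` A) w)%:E)%E; first by rewrite integral_indic// setIT.
rewrite (@ae_eq_integral _ _ _ P setT (cst (\1_A a)%:E))//.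
- by rewrite integral_cst// [X in (_ * X)%E](probability_setT P) mule1.
- exact/measurable_EFinP/measurable_indic.
- by move: Xa; apply: filterS => w Xw _; rewrite /= -Xw.
Qed.

Theorem theorem3p2 (R : realType) (d : measure_display) (T : measurableType d)
  (P : probability T R)
  (alpha gamma beta b : R)
  (Halpha : 0 < alpha <= 1) (Hgamma : 0 < gamma <= 1) (Hbeta : 0 < beta <= 1)
  (Hb : 0 <= b)
  (k : nat) (Hk : (1 <= k)%N) (lambda : 'I_k -> R)
  (Hlambda : forall j, 0 < lambda j)
  (M : R -> T -> nat) (Dgamma Dalpha Dbeta Ybeta : R -> T -> R)
  (HM : generalized_counting_process P lambda M)
  (HDgamma : stable_subordinator P gamma Dgamma)
  (HDalpha : stable_subordinator P alpha Dalpha)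
  (HDbeta : stable_subordinator P beta Dbeta)
  (HYbeta : Ybeta = inverse_process Dbeta)
  (Hindep : mutually_independent P (fun i : 'I_4 =>
     nth set0 [:: sigma_of_process (fun t omega => (M t omega)%:R : R);
                  sigma_of_process Dgamma;
                  sigma_of_process Dalpha;
                  sigma_of_process Ybeta] i)) :
  let X := time_changed b M Dgamma Dalpha Ybeta in
  let w := fun t : R => (pushforward P (X t) : set R -> \bar R) in
  let h := fun t : R => (pushforward P (Ybeta t) : set R -> \bar R) in
  let g := fun u : R => (pushforward P (Dalpha u) : set R -> \bar R) in
  [/\ (* X(t) is a random variable *)
      forall t : R, 0 <= t -> measurable_fun [set: T] (X t),
      (* the law, as an identity of measures in x, where g_alpha(x - n, u) dx
         and h_beta(s, t) ds are the (possibly degenerate) laws of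
         n + D_alpha(u) and Y_beta(t) *)
      forall t : R, 0 < t -> forall A : set R, measurable A ->
        w t A = law_series lambda gamma (h t)
          (fun n s => fine (g (b `^ alpha * s) [set y | A (y + n%:R)])),
      (* the same identity pointwise in x, when D_alpha has genuine densities
         g_alpha(x, u) *)
      0 < b -> alpha < 1 ->
        forall ga : R -> R -> R,
        measurable_fun [set: R * R] (fun xu : R * R => ga xu.1 xu.2) ->
        (forall x u : R, 0 <= ga x u) ->
        (forall u : R, 0 < u -> forall A : set R, measurable A ->
           g u A = (\int[lebesgue_measure]_(x in A) (ga x u)%:E)%E) ->
        forall t : R, 0 < t -> exists f : R -> R,
          [/\ measurable_fun [set: R] f,
              forall x : R, 0 <= f x,
              forall A : set R, measurable A ->
                w t A = (\int[lebesgue_measure]_(x in A) (f x)%:E)%E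
            & {ae lebesgue_measure, forall x : R,
                (f x)%:E = law_series lambda gamma (h t)
                  (fun n s => ga (x - n%:R) (b `^ alpha * s))}],
      (* the initial condition w(x, 0) = delta(x) *)
      forall A : set R, measurable A -> w 0 A = \d_(0 : R) A
    & solves_equation alpha beta gamma b lambda w].
Proof.
subst Ybeta.
have SG := stable_subordinator_subordinator Hgamma HDgamma.
have SA := stable_subordinator_subordinator Halpha HDalpha.
have SB := stable_subordinator_subordinator Hbeta HDbeta.
have alpha0 : 0 < alpha by case/andP: Halpha.
have ind : mutually_independent P (fun i : 'I_4 => sigma_of_process
    (nth (fun _ _ => 0) [:: (fun t w => (M t w)%:R); Dgamma; Dalpha; inverse_process Dbeta] i)).
  move=> J A FA; apply: Hindep => i /FA.
  by case: i => -[|[|[|[|//]]]].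
move=> X w h g.
have mX t : 0 <= t -> measurable_fun [set: T] (X t).
  exact: (measurable_time_changed b HM SG SA SB).
have X0 t omega : 0 <= t -> 0 <= X t omega.
  move=> t0; rewrite addr_ge0// mulr_ge0// (subordinator_ge0 SA)//.
  exact: inverse_process_ge0.
split.
- exact: mX.
- move=> t t0 A mA.
  exact: (time_changed_law alpha0 Hb Hk Hlambda HM SG SA SB ind (ltW t0) mA).
- move=> b0 _ ga mga ga0 gaE t t0.
  exact: (time_changed_density alpha0 Hb Hk Hlambda HM SG SA SB ind (ltW t0) t0 b0 mga ga0 gaE).
(* The clock vanishes at time [0] only almost surely, which is enough to identify the law. *)
- move=> A mA; apply: probability_ae_cst => //; first exact: mX.
  have := ae_inverse_process0 Hbeta SB; apply: filterS => omega Y0.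
  rewrite /X /time_changed Y0 (subordinator_start SG) (subordinator_start SA) (gcp_start HM).
  by rewrite mulr0 addr0.
- apply: (solves_equation_laplace Halpha Hgamma Hbeta Hk Hlambda SB mX X0).
  move=> eta t eta0 t0.
  exact: (time_changed_laplace Hb Hlambda HM SG SA SB ind t0 eta0).
Qed.
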